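(* Let $k\geq 2$, let $\chi_1,\chi_2$ be primitive quadratic Dirichlet characters with conductors $q_1,q_2$ such that $\chi_1\chi_2(-1)=(-1)^k$, and let $m$ be a real number. Let $G$ be a finite generating set of $\Gamma_1(q_1q_2)$. If for every $\gamma\in G$ the function $h_{\gamma,\chi_1,\chi_2,k}$ coincides on its domain with a polynomial belonging to $\mathcal P(k;m,q_1)$, then $\widetilde S_{\chi_1,\chi_2,k}(\Gamma_1(q_1q_2))\subseteq m\mathbb Z/q_1$, i.e. $\widetilde S_{\chi_1,\chi_2,k}(\gamma)\in\{mn/q_1:n\in\mathbb Z\}$ for every $\gamma\in\Gamma_1(q_1q_2)$ with nonzero lower-left entry.
   Context: Notation: $e(z)=\exp(2\pi iz)$; $\tau(\chi)$ is the Gauss sum; $j(\gamma,z)=cz+d$ for $\gamma=\begin{pmatrix}a&b\\c&d\end{pmatrix}$. $E_{\chi_1,\chi_2,k}(z)=2\sum_{N\ge1}\sum_{A\mid N}\chi_1(A)\overline{\chi_2}(N/A)(N/A)^{k-1}e(Nz)$ on the upper half plane; $P_{k-2}(z;X,Y)=(Xz+Y)^{k-2}$. For $\gamma\in\Gamma_0(q_1q_2)$ with $c\neq0$, $S_{\chi_1,\chi_2,k}(\gamma)=(-1)^k\tau(\overline{\chi_1})(k-1)\int_\infty^{\gamma\infty}E_{\chi_1,\chi_2,k}(z)P_{k-2}(z;1,-a/c)\,dz$, and (for quadratic $\chi_1,\chi_2$) $\widetilde S_{\chi_1,\chi_2,k}(\gamma)=c^{k-2}S_{\chi_1,\chi_2,k}(\gamma)$.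 On the set $(\Gamma_0(q_1q_2))(\infty)$ of cusps $\gamma\infty$, $\gamma\in\Gamma_0(q_1q_2)$, define $\widehat S_{\chi_1,\chi_2,k}(\infty)=0$ and $\widehat S_{\chi_1,\chi_2,k}(\mathfrak a)=(-1)^k\tau(\overline{\chi_1})(k-1)\int_\infty^{\mathfrak a}E_{\chi_1,\chi_2,k}(z)P_{k-2}(z;1,-\mathfrak a)dz$ for $\mathfrak a\ne\infty$ (so $\widehat S(\gamma\infty)=S(\gamma)$). For $\gamma\in\Gamma_0(q_1q_2)$ let $h_{\gamma,\chi_1,\chi_2,k}(\mathfrak a)=\widehat S_{\chi_1,\chi_2,k}(\mathfrak a)-j(\gamma,\mathfrak a)^{k-2}\widehat S_{\chi_1,\chi_2,k}(\gamma\mathfrak a)$ for $\mathfrak a\in(\Gamma_0(q_1q_2))(\infty)\setminus\{\infty\}$. Finally $$\mathcal P(k;m,q)=\Big\{\sum_{n=0}^{k-2}a_nx^{k-n-2}\in\mathbb Q[x]:\ q^{n+1}a_n\in m\mathbb Z\ \text{for all }n\Big\}.$$ *)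

(* Defs.v *)
From Stdlib Require Import Reals ZArith QArith Znumtheory List.
From Coquelicot Require Import Coquelicot.
Open Scope R_scope.

(** e(z) = exp(2 pi i z), z = x + i y. *)
Definition e (z : C) : C :=
  (RtoC (exp (- 2 * PI * Im z)) *
  (cos (2 * PI * Re z), sin (2 * PI * Re z)))%C.

(** Dirichlet characters, represented Z -> Z (a quadratic character takes
    only the values 0, 1, -1). *)
Definition dirichlet_char (q : Z) (chi : Z -> Z) : Prop :=
  (1 <= q)%Z /\
  chi 1%Z = 1%Z /\
  (forall m n, chi (m * n)%Z = (chi m * chi n)%Z) /\
  (forall n, chi (n + q)%Z = chi n) /\
  (forall n, chi n = 0%Z <-> Z.gcd n q <> 1%Z).

(** quadratic = of order exactly 2: real-valued (values in {0,1,-1}) and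
    not principal. *)
Definition quadratic_char (q : Z) (chi : Z -> Z) : Prop :=
  dirichlet_char q chi /\
  (forall n, chi n = 0%Z \/ chi n = 1%Z \/ chi n = (-1)%Z) /\
  (exists n, chi n = (-1)%Z).

(** chi mod q is primitive (i.e. has conductor q): it is not induced by a
    character of any modulus d | q with d < q. *)
Definition primitive_char (q : Z) (chi : Z -> Z) : Prop :=
  dirichlet_char q chi /\
  forall d, (1 <= d)%Z -> (d | q)%Z -> (d < q)%Z ->
    exists n, Z.gcd n q = 1%Z /\ (n mod d = 1 mod d)%Z /\ chi n <> 1%Z.

Definition prim_quad_char (q : Z) (chi : Z -> Z) : Prop :=
  quadratic_char q chi /\ primitive_char q chi.

Definition chiC (chi : Z -> Z) (n : Z) : C := RtoC (IZR (chi n)).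

Definition gauss_sum (q : Z) (chi : Z -> C) : C :=
  fold_right Cplus (RtoC 0)
    (map (fun a : nat => (chi (Z.of_nat a) * e (RtoC (INR a / IZR q)))%C)
         (seq 0 (Z.to_nat q))).

Definition E_coeff (chi1 chi2 : Z -> Z) (k N : nat) : C :=
  fold_right Cplus (RtoC 0)
    (map (fun A : nat =>
            if Nat.eqb (N mod A) 0 then
              (chiC chi1 (Z.of_nat A) * Cconj (chiC chi2 (Z.of_nat (N / A)))
              * RtoC (INR (N / A) ^ (k - 1)))%C
            else RtoC 0)
         (seq 1 N)).

Definition CSeries (a : nat -> C) : C :=
  (Series (fun n => Re (a n)), Series (fun n => Im (a n))).

Definition Eis (chi1 chi2 : Z -> Z) (k : nat) (z : C) : C :=
  (2 * CSeries (fun n => E_coeff chi1 chi2 k (S n) * e (RtoC (INR (S n)) * z)))%C.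

Definition Ppoly (k : nat) (z X Y : C) : C := Cpow (X * z + Y)%C (k - 2).

(** Integral from infinity to the real cusp x along the vertical half-line
    Re z = x: int_infty^x f(z) dz = - i int_0^infty f(x + i y) dy. *)
Definition int_from_infty (f : C -> C) (x : R) : C :=
  (- Ci * RInt_gen (V := C_R_CompleteNormedModule)
                  (fun y : R => f (x, y)) (at_right 0) (Rbar_locally p_infty))%C.

Definition Shat_fin (chi1 chi2 : Z -> Z) (q1 : Z) (k : nat) (a : R) : C :=
  (RtoC ((-1) ^ k) * gauss_sum q1 (fun n => Cconj (chiC chi1 n)) * RtoC (INR k - 1)
  * int_from_infty (fun z => Eis chi1 chi2 k z * Ppoly k z (RtoC 1) (RtoC (- a))) a)%C.

(** Cusps: None = infinity, Some a = the real (rational) cusp a. *)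
Definition Shat (chi1 chi2 : Z -> Z) (q1 : Z) (k : nat) (c : option R) : C :=
  match c with None => RtoC 0 | Some a => Shat_fin chi1 chi2 q1 k a end.

Record M2Z := mkM2Z { ma : Z; mb : Z; mc : Z; md : Z }.
Definition mmul (g h : M2Z) : M2Z :=
  mkM2Z (ma g * ma h + mb g * mc h) (ma g * mb h + mb g * md h)
        (mc g * ma h + md g * mc h) (mc g * mb h + md g * md h).
Definition minv (g : M2Z) : M2Z := mkM2Z (md g) (- mb g) (- mc g) (ma g).
Definition mid : M2Z := mkM2Z 1 0 0 1.

Definition Gamma0 (N : Z) (g : M2Z) : Prop :=
  (ma g * md g - mb g * mc g = 1)%Z /\ (N | mc g)%Z.
Definition Gamma1 (N : Z) (g : M2Z) : Prop :=
  Gamma0 N g /\ (ma g mod N = 1 mod N)%Z /\ (md g mod N = 1 mod N)%Z.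

Inductive generated (G : list M2Z) : M2Z -> Prop :=
| gen_id : generated G mid
| gen_mul : forall g h, generated G g -> In h G -> generated G (mmul g h)
| gen_mulinv : forall g h, generated G g -> In h G -> generated G (mmul g (minv h)).

Definition generating_set (N : Z) (G : list M2Z) : Prop :=
  (forall g, In g G -> Gamma1 N g) /\ (forall g, Gamma1 N g -> generated G g).

Definition act_cusp (g : M2Z) (c : option R) : option R :=
  match c with
  | None => if Z.eqb (mc g) 0 then None else Some (IZR (ma g) / IZR (mc g))
  | Some a =>
      let den := IZR (mc g) * a + IZR (md g) in
      if Req_EM_T den 0 then None else Some ((IZR (ma g) * a + IZR (mb g)) / den)
  end.
Definition jfac (g : M2Z) (a : R) : R := IZR (mc g) * a + IZR (md g).

Definition S (chi1 chi2 : Z -> Z) (q1 : Z) (k : nat) (g : M2Z) : C :=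
  (RtoC ((-1) ^ k) * gauss_sum q1 (fun n => Cconj (chiC chi1 n)) * RtoC (INR k - 1)
  * int_from_infty
      (fun z => Eis chi1 chi2 k z
                * Ppoly k z (RtoC 1) (RtoC (- (IZR (ma g) / IZR (mc g)))))
      (IZR (ma g) / IZR (mc g)))%C.
Definition Stilde (chi1 chi2 : Z -> Z) (q1 : Z) (k : nat) (g : M2Z) : C :=
  (RtoC (IZR (mc g) ^ (k - 2)) * S chi1 chi2 q1 k g)%C.

Definition hfun (chi1 chi2 : Z -> Z) (q1 : Z) (k : nat) (g : M2Z) (a : R) : C :=
  (Shat chi1 chi2 q1 k (Some a)
  - RtoC (jfac g a ^ (k - 2)) * Shat chi1 chi2 q1 k (act_cusp g (Some a)))%C.

(** the domain (Gamma_0(N))(infty) \ {infty} *)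
Definition finite_Gamma0_cusp (N : Z) (a : R) : Prop :=
  exists g, Gamma0 N g /\ act_cusp g None = Some a.

Definition poly_eval (k : nat) (coef : nat -> Q) (x : R) : R :=
  fold_right Rplus 0
    (map (fun n => Q2R (coef n) * x ^ (k - n - 2)) (seq 0 (k - 1))).

Definition in_Pkmq (k : nat) (m : R) (q : Z) (coef : nat -> Q) : Prop :=
  forall n, (n <= k - 2)%nat -> exists t : Z, IZR q ^ (n + 1) * Q2R (coef n) = m * IZR t.

(* Main.v *)
Require Import Defs.
From Stdlib Require Import Reals ZArith QArith Znumtheory List Lra Lia.
From Coquelicot Require Import Coquelicot.
Open Scope R_scope.

(** Write [St(A, C) = C^(k-2) Shat(A/C)], with [St(A, 0) = 0]. If [g] is a generator and
    [C <> 0], then [St(v) - St(g v) = C^(k-2) h_g(A/C)] for [v = (A, C)], and this lies in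
    [mZ/q1] because [q1 | C]. Summing along a word in the generators would prove the theorem,
    except that [h_g] is not defined at infinity, so one also needs [St(g (1, 0))] in
    [mZ/q1] for the generators themselves. This is the only analytic point, and it does not
    require the modularity of the Eisenstein series.

    Let [x = A/C] with [q1 q2 | C]. The coefficients [chi1(m) chi2(n) e(mnx)] of the double
    series are periodic modulo [C] with mean zero in [m] and in [n], so a double Abel
    summation shows that the integral defining [Shat(x)] converges and equals a constant times
    [sum_m chi1(m) m^(1-k) D_m(x)], where [D_m(x)] is the Abel sum of [chi2(n) e(mnx)] over [n].

    If [k >= 3], these values are continuous along the cusps [x_n = g T^n g^-1 (infinity)],
    which tend to [g(infinity)]. Hence in
    [h_g(b + n) = Shat(b) - (c n)^(k-2) Shat(x_n)], [b = g^-1(infinity)], division by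
    [n^(k-2)] yields [St(g (1, 0)) = - a_0] for the coefficient [a_0] of [x^(k-2)] in [h_g].
    If [k = 2], expanding [chi1] in sines turns the series into a Dedekind sum in two
    sawtooth functions, whose symmetry gives [Shat(g(infinity)) = - Shat(g^-1(infinity))],
    and [Shat(g^-1(infinity))] is the constant [h_g]. *)

(** [Defs] binds [S] to the Dedekind sum. *)
Local Notation S := Datatypes.S.

(** * Finite sums and limits *)

(** The scaling law [n^(p+1) kern p (s n) t = kern p s (n t)] with [p = k - 2] absorbs the weight
    [n^(k-1)] of the Eisenstein coefficients. Up to constants, the integral over [y >= Y] is
    therefore the double sum of [chi1(m) chi2(n) e(mnx)] against [kern p (2 pi m) (n Y)]. This
    weight decreases in both indices and its mixed differences have one sign, so Abel summation
    works in both directions and the limit [Y -> 0] can be taken row by row. The obstacle is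
    continuity: the denominators [c_n = c^2 n] of the cusps [x_n] grow. Rows [m] up to about
    [c n / (2 q2)] have a bound uniform in [n], from a closed form of [D_m] with only [q2] terms.
    Later rows are controlled only through partial sums of [D_m], for which Parseval gives
    [c_n^(3/2)] instead of the trivial order [c_n^2]. The tail is then of order [n^(3/2) n^(1-k)],
    which tends to zero for [k >= 3]. For [k = 2] this bound grows, whence the exact evaluation by
    Dedekind sums in that weight. *)

Fixpoint rsum (f : nat -> R) (n : nat) : R :=
  match n with O => 0 | S n' => rsum f n' + f n' end.

Lemma rsum_ext f g n : (forall i, (i < n)%nat -> f i = g i) -> rsum f n = rsum g n.
Proof.
  induction n as [|n IH]; intros H; simpl; [easy|].
  rewrite IH, H; auto.
Qed.

Lemma rsum_plus f g n : rsum (fun i => f i + g i) n = rsum f n + rsum g n.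
Proof. induction n as [|n IH]; simpl; lra. Qed.

Lemma rsum_minus f g n : rsum (fun i => f i - g i) n = rsum f n - rsum g n.
Proof. induction n as [|n IH]; simpl; lra. Qed.

Lemma rsum_scal c f n : rsum (fun i => c * f i) n = c * rsum f n.
Proof. induction n as [|n IH]; simpl; lra. Qed.

Lemma rsum_zero f n : (forall i, (i < n)%nat -> f i = 0) -> rsum f n = 0.
Proof.
  induction n as [|n IH]; intros H; simpl; [easy|].
  rewrite IH, H; auto; lra.
Qed.

Lemma rsum_const c n : rsum (fun _ => c) n = INR n * c.
Proof. induction n as [|n IH]; [simpl; lra|]. rewrite S_INR; simpl; lra. Qed.

Lemma rsum_le f g n :
  (forall i, (i < n)%nat -> f i <= g i) -> rsum f n <= rsum g n.
Proof.
  induction n as [|n IH]; intros H; simpl; [lra|].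
  apply Rplus_le_compat; auto.
Qed.

Lemma rsum_nonneg f n : (forall i, (i < n)%nat -> 0 <= f i) -> 0 <= rsum f n.
Proof. intros H. rewrite <- (rsum_zero (fun _ => 0) n); auto using rsum_le. Qed.

Lemma rsum_abs f n : Rabs (rsum f n) <= rsum (fun i => Rabs (f i)) n.
Proof.
  induction n as [|n IH]; simpl; [rewrite Rabs_R0; lra|].
  eapply Rle_trans; [apply Rabs_triang|lra].
Qed.

Lemma rsum_app f n m : rsum f (n + m) = rsum f n + rsum (fun i => f (n + i)%nat) m.
Proof.
  induction m as [|m IH]; [rewrite Nat.add_0_r; simpl; lra|].
  rewrite Nat.add_succ_r; simpl; lra.
Qed.

Lemma rsum_S_l f n : rsum f (S n) = f O + rsum (fun i => f (S i)) n.
Proof. rewrite <- (Nat.add_1_l n), rsum_app; simpl; lra. Qed.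

Lemma rsum_mono f n m :
  (forall i, 0 <= f i) -> (n <= m)%nat -> rsum f n <= rsum f m.
Proof.
  intros Hf Hnm. replace m with (n + (m - n))%nat by lia. rewrite rsum_app.
  pose proof (rsum_nonneg (fun i => f (n + i)%nat) (m - n) (fun i _ => Hf _)); lra.
Qed.

Lemma rsum_swap (f : nat -> nat -> R) n m :
  rsum (fun i => rsum (fun j => f i j) m) n = rsum (fun j => rsum (fun i => f i j) n) m.
Proof.
  induction n as [|n IH]; simpl; [symmetry; now apply rsum_zero|].
  now rewrite IH, rsum_plus.
Qed.

Lemma rsum_telescope f n : rsum (fun i => f i - f (S i)) n = f O - f n.
Proof. induction n as [|n IH]; simpl; lra. Qed.

(** Summation by parts. The boundary term vanishes when [n] is a multiple of a period over which [b]
    sums to zero; this is why later double sums run to [q * c]. *)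
Lemma rsum_abel b a n :
  rsum (fun i => b i * a i) n
  = rsum b n * a n + rsum (fun i => rsum b (S i) * (a i - a (S i))) n.
Proof. induction n as [|n IH]; simpl in *; [lra|]. rewrite IH; lra. Qed.

Lemma rsum_single f n i0 :
  (i0 < n)%nat -> (forall i, (i < n)%nat -> i <> i0 -> f i = 0) -> rsum f n = f i0.
Proof.
  intros H0 H. replace n with (i0 + S (n - i0 - 1))%nat by lia.
  rewrite rsum_app, rsum_S_l, Nat.add_0_r.
  rewrite (rsum_zero f), (rsum_zero (fun i => f (i0 + S i)%nat)); [lra| |];
    intros i Hi; apply H; lia.
Qed.

Lemma rsum_rev f n : rsum (fun i => f (n - 1 - i)%nat) n = rsum f n.
Proof.
  induction n as [|n IH]; [easy|]. rewrite rsum_S_l. simpl rsum at 2.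
  rewrite <- IH, Rplus_comm. f_equal; [|f_equal; lia].
  apply rsum_ext; intros i Hi; f_equal; lia.
Qed.

Lemma rsum_continuity (f : nat -> R -> R) n x :
  (forall i, continuity_pt (f i) x) -> continuity_pt (fun y => rsum (fun i => f i y) n) x.
Proof.
  intros H; induction n as [|n IH]; simpl.
  - now apply continuity_pt_const.
  - apply (continuity_pt_plus (fun y => rsum (fun i => f i y) n)); auto.
Qed.

Lemma is_lim_seq_rsum (f : nat -> nat -> R) (l : nat -> R) n :
  (forall i, (i < n)%nat -> is_lim_seq (f i) (l i)) ->
  is_lim_seq (fun k => rsum (fun i => f i k) n) (rsum l n).
Proof.
  induction n as [|n IH]; intros H; simpl.
  - apply is_lim_seq_const.
  - apply is_lim_seq_plus'; auto.
Qed.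

Lemma sum_n_rsum (f : nat -> R) n : sum_n f n = rsum f (S n).
Proof.
  induction n as [|n IH]; [rewrite sum_O; simpl; lra|].
  rewrite sum_Sn, IH; reflexivity.
Qed.

Lemma is_series_rsum (f : nat -> R) (l : R) : is_series f l <-> is_lim_seq (rsum f) l.
Proof.
  rewrite (is_lim_seq_incr_1 (rsum f)). split; intros H.
  - apply (is_lim_seq_ext (sum_n f)); [apply sum_n_rsum|exact H].
  - apply (is_lim_seq_ext _ (sum_n f)) in H; [exact H|].
    intros n; symmetry; apply sum_n_rsum.
Qed.

Lemma is_lim_seq_abs_le (u : nat -> R) (l a B : R) :
  is_lim_seq u l -> eventually (fun n => Rabs (u n - a) <= B) -> Rabs (l - a) <= B.
Proof.
  intros Hu HB.
  assert (H : is_lim_seq (fun n => Rabs (u n - a)) (Rabs (l - a))).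
  { apply (is_lim_seq_abs _ (l - a)).
    apply is_lim_seq_minus'; [exact Hu|apply is_lim_seq_const]. }
  pose proof (is_lim_seq_le_loc _ (fun _ => B) _ B HB H (is_lim_seq_const B)).
  exact H0.
Qed.

Lemma is_lim_seq_eps (u : nat -> R) (l : R) :
  (forall eps : R, 0 < eps -> exists N, forall n, (N <= n)%nat -> Rabs (u n - l) < eps) ->
  is_lim_seq u l.
Proof.
  intros H. apply is_lim_seq_spec. intros eps. destruct (H eps (cond_pos eps)) as [N HN].
  exists N. exact HN.
Qed.

Lemma is_lim_seq_inj (u : nat -> R) (l l' : R) : is_lim_seq u l -> is_lim_seq u l' -> l = l'.
Proof.
  intros H H'. apply is_lim_seq_unique in H, H'.
  rewrite H in H'. now injection H'.
Qed.

Lemma is_lim_seq_inv_INR_S : is_lim_seq (fun n => / INR (S n)) 0.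
Proof.
  apply (is_lim_seq_incr_1 (fun n => / INR n)).
  apply (is_lim_seq_inv _ p_infty); [apply is_lim_seq_INR|easy].
Qed.

Definition periodic (c : nat) (f : nat -> R) : Prop := forall i, f (i + c)%nat = f i.

Lemma periodic_mul c f q : periodic c f -> periodic (q * c) f.
Proof.
  intros H. induction q as [|q IH]; intros i; simpl; [f_equal; lia|].
  rewrite Nat.add_assoc, IH. apply H.
Qed.

Lemma periodic_mod c f i : c <> O -> periodic c f -> f i = f (i mod c)%nat.
Proof.
  intros Hc H. rewrite (Nat.div_mod_eq i c) at 1.
  rewrite Nat.add_comm, Nat.mul_comm. apply periodic_mul, H.
Qed.

Lemma rsum_periodic_zero c f :
  periodic c f -> rsum f c = 0 -> periodic c (rsum f).
Proof.
  intros Hf H0 i. rewrite Nat.add_comm, rsum_app, H0, Rplus_0_l.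
  apply rsum_ext; intros j _. rewrite Nat.add_comm; apply Hf.
Qed.

Lemma rsum_periodic_shift c f s :
  periodic c f -> rsum (fun i => f (s + i)%nat) c = rsum f c.
Proof.
  intros Hf. pose proof (rsum_app f s c) as H1. pose proof (rsum_app f c s) as H2.
  rewrite (Nat.add_comm c s) in H2.
  rewrite (rsum_ext (fun i => f (c + i)%nat) f s) in H2; [lra|].
  intros i _. rewrite Nat.add_comm; apply Hf.
Qed.

Lemma rsum_periodic_mult c f q :
  periodic c f -> rsum f c = 0 -> rsum f (q * c) = 0.
Proof.
  intros Hf H0.
  exact (periodic_mul c (rsum f) q (rsum_periodic_zero c f Hf H0) O).
Qed.

Lemma periodic_bounded c f :
  c <> O -> periodic c f -> exists K, 0 <= K /\ forall i, Rabs (f i) <= K.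
Proof.
  intros Hc Hf. exists (rsum (fun i => Rabs (f i)) c). split.
  - apply rsum_nonneg; intros; apply Rabs_pos.
  - intros i. rewrite (periodic_mod c f i Hc Hf).
    assert (Hi : (i mod c < c)%nat) by now apply Nat.mod_upper_bound.
    set (j := (i mod c)%nat) in *.
    eapply Rle_trans; [|apply (rsum_mono _ (S j) c); [intros; apply Rabs_pos|lia]].
    simpl. pose proof (rsum_nonneg (fun i => Rabs (f i)) j (fun i _ => Rabs_pos _)); lra.
Qed.

(** Differences of partial sums of [b] are at most [2 * B]; the boundary term and the telescoping
    differences of the weight add up to [w s], whatever [n] is. *)
Lemma abel_inequality b w B n s :
  (forall i, Rabs (rsum b i) <= B) ->
  (forall i, 0 <= w i) -> (forall i, w (S i) <= w i) -> (s <= n)%nat ->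
  Rabs (rsum (fun i => b i * w i) n - rsum (fun i => b i * w i) s) <= 2 * B * w s.
Proof.
  intros Hb Hw Hd Hsn.
  assert (HB : 0 <= B) by (eapply Rle_trans; [apply Rabs_pos|apply (Hb O)]).
  replace n with (s + (n - s))%nat by lia. rewrite rsum_app.
  replace (_ + _ - _) with (rsum (fun i => b (s + i)%nat * w (s + i)%nat) (n - s)) by lra.
  rewrite (rsum_abel (fun i => b (s + i)%nat) (fun i => w (s + i)%nat)).
  assert (Hs : forall i, Rabs (rsum (fun j => b (s + j)%nat) i) <= 2 * B).
  { intros i. pose proof (rsum_app b s i) as E. pose proof (Hb s). pose proof (Hb (s + i)%nat).
    replace (rsum (fun j => b (s + j)%nat) i) with (rsum b (s + i) - rsum b s) by lra.
    eapply Rle_trans; [apply Rabs_triang|]. rewrite Rabs_Ropp; lra. }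
  eapply Rle_trans; [apply Rabs_triang|].
  rewrite Rabs_mult, (Rabs_pos_eq (w _)) by apply Hw.
  eapply Rle_trans; [apply Rplus_le_compat; [apply Rmult_le_compat_r;
    [apply Hw|apply Hs]|apply rsum_abs]|].
  eapply Rle_trans; [apply Rplus_le_compat_l, (rsum_le _
    (fun i => 2 * B * (w (s + i)%nat - w (S (s + i)))))|].
  - intros i _. rewrite Nat.add_succ_r, Rabs_mult.
    rewrite (Rabs_pos_eq (_ - _)) by (specialize (Hd (s + i)%nat); lra).
    apply Rmult_le_compat_r; [specialize (Hd (s + i)%nat); lra|apply Hs].
  - rewrite rsum_scal.
    rewrite (rsum_ext _ (fun i => w (s + i)%nat - w (s + S i)%nat))
      by (intros; now rewrite Nat.add_succ_r).
    rewrite (rsum_telescope (fun i => w (s + i)%nat)), Nat.add_0_r; lra.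
Qed.

(** * Truncated gamma integrals *)

Lemma ex_derive_continuity_pt (f : R -> R) (x : R) : ex_derive f x -> continuity_pt f x.
Proof.
  intros H. apply continuity_pt_filterlim.
  exact (ex_derive_continuous (K := R_AbsRing) (V := R_NormedModule) f x H).
Qed.

Lemma MVT_closed (f df : R -> R) (a b : R) :
  a <= b -> (forall x, a <= x <= b -> is_derive f x (df x)) ->
  exists c, a <= c <= b /\ f b - f a = df c * (b - a).
Proof.
  intros Hab H. destruct (MVT_gen f a b df) as [c Hc].
  - rewrite Rmin_left, Rmax_right by lra. intros; apply H; lra.
  - rewrite Rmin_left, Rmax_right by lra. intros x Hx.
    apply continuity_pt_filterlim.
    apply (ex_derive_continuous (K := R_AbsRing) (V := R_NormedModule)).
    exists (df x); now apply H.
  - rewrite Rmin_left, Rmax_right in Hc by lra. now exists c.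
Qed.

Lemma pow_le_fact_exp (q : nat) (t : R) : 0 <= t -> t ^ q <= INR (fact q) * exp t.
Proof.
  intros Ht. pose proof (exp_ge_taylor t q Ht) as H.
  assert (Hq : t ^ q / INR (fact q) <= sum_f_R0 (fun k => t ^ k / INR (fact k)) q).
  { destruct q as [|q]; [apply Rle_refl|]. cbn [sum_f_R0].
    assert (0 <= sum_f_R0 (fun k => t ^ k / INR (fact k)) q); [|lra].
    apply cond_pos_sum. intros k. apply Rdiv_le_0_compat; [now apply pow_le|apply INR_fact_lt_0]. }
  pose proof (INR_fact_lt_0 q).
  apply (Rmult_le_reg_r (/ INR (fact q))); [now apply Rinv_0_lt_compat|].
  replace (INR (fact q) * exp t * / INR (fact q)) with (exp t) by (field; lra).
  unfold Rdiv in Hq; lra.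
Qed.

(** [kern p s t] is the integral of [x^p exp(-s x)] over [x >= t]. *)
Fixpoint kern (p : nat) (s t : R) : R :=
  match p with
  | O => exp (- (s * t)) / s
  | S p' => (t ^ p * exp (- (s * t)) + INR p * kern p' s t) / s
  end.

Lemma kern_derive p s t : 0 < s -> is_derive (kern p s) t (- (t ^ p * exp (- (s * t)))).
Proof.
  intros Hs. induction p as [|p IH].
  - cbn. auto_derive; [easy|]. field; lra.
  - change (kern (S p) s) with
      (fun t => (t ^ S p * exp (- (s * t)) + INR (S p) * kern p s t) / s).
    assert (Hd : Derive (fun x => kern p s x) t = - (t ^ p * exp (- (s * t))))
      by (apply is_derive_unique, IH).
    auto_derive.
    + repeat split. eexists; apply IH.
    + rewrite Hd. change (match p with O => 1 | S _ => INR p + 1 end) with (INR (S p)).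
      rewrite S_INR. simpl pow. field; lra.
Qed.

Lemma kern_nonneg p s t : 0 < s -> 0 <= t -> 0 <= kern p s t.
Proof.
  intros Hs Ht. induction p as [|p IH]; cbn [kern]; apply Rdiv_le_0_compat; try easy.
  - apply Rlt_le, exp_pos.
  - apply Rplus_le_le_0_compat; apply Rmult_le_pos; auto using pos_INR.
    + now apply pow_le.
    + apply Rlt_le, exp_pos.
Qed.

Lemma kern_antitone_s p s s' t :
  0 < s <= s' -> 0 <= t -> kern p s' t <= kern p s t.
Proof.
  intros Hs Ht.
  assert (Hi : / s' <= / s) by (apply Rinv_le_contravar; lra).
  assert (Hi' : 0 <= / s') by (apply Rlt_le, Rinv_0_lt_compat; lra).
  assert (He : exp (- (s' * t)) <= exp (- (s * t))).
  { destruct (Req_dec (s' * t) (s * t)) as [->|]; [lra|].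
    apply Rlt_le, exp_increasing. nra. }
  pose proof (exp_pos (- (s' * t))).
  induction p as [|p IH]; cbn [kern]; unfold Rdiv; apply Rmult_le_compat; auto; try lra.
  - apply Rplus_le_le_0_compat; apply Rmult_le_pos; auto using pos_INR.
    + now apply pow_le.
    + lra.
    + apply kern_nonneg; lra.
  - apply Rplus_le_compat; apply Rmult_le_compat_l; auto using pos_INR, pow_le.
Qed.

Lemma kern_at_0 p s : 0 < s -> kern p s 0 = INR (fact p) / s ^ (p + 1).
Proof.
  intros Hs. induction p as [|p IH].
  - cbn. rewrite Rmult_0_r, Ropp_0, exp_0. field; lra.
  - cbn [kern]. rewrite IH, pow_i by lia. rewrite fact_simpl, mult_INR.
    rewrite Nat.add_succ_l. simpl pow. field. split; [|lra]. apply pow_nonzero; lra.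
Qed.

(** The change of variable [x -> n x] in the truncated gamma integral. It moves the divisor [n] from
    the frequency to the truncation point and consumes exactly [p + 1 = k - 1] powers of [n]. *)
Lemma kern_scale p s n t :
  0 < s -> 0 < n -> n ^ (p + 1) * kern p (s * n) t = kern p s (n * t).
Proof.
  intros Hs Hn. induction p as [|p IH]; cbn [kern];
    replace (s * n * t) with (s * (n * t)) by ring.
  - cbn. field; lra.
  - rewrite <- IH, Rpow_mult_distr.
    replace (S p + 1)%nat with (S (p + 1)) by lia.
    replace (S p) with (p + 1)%nat at 3 by lia.
    replace (S p) with (p + 1)%nat at 5 by lia. simpl pow. field; lra.
Qed.

Lemma kern_exp_bound p t : 0 <= t ->
  exists K, 0 <= K /\ forall s, 1 <= s -> kern p s t <= K * exp (- (s * t)).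
Proof.
  intros Ht. induction p as [|p (K & HK & IH)].
  - exists 1. split; [lra|]. intros s Hs. cbn. pose proof (exp_pos (- (s * t))).
    apply Rmult_le_reg_r with s; [lra|]. field_simplify; [nra|lra].
  - exists (t ^ S p + INR (S p) * K). pose proof (pos_INR (S p)).
    assert (0 <= t ^ S p) by now apply pow_le. split; [nra|].
    intros s Hs. specialize (IH s Hs). cbn [kern].
    pose proof (exp_pos (- (s * t))).
    pose proof (Rmult_le_compat_l _ _ _ H IH) as H2.
    set (M := t ^ S p + INR (S p) * K).
    assert (H3 : t ^ S p * exp (- (s * t)) + INR (S p) * kern p s t <= M * exp (- (s * t))).
    { unfold M. rewrite Rmult_plus_distr_r, (Rmult_assoc (INR _)). lra. }
    assert (HM : 0 <= M) by (apply Rplus_le_le_0_compat; [easy|now apply Rmult_le_pos]).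
    assert (H4 : 0 <= M * exp (- (s * t))) by (apply Rmult_le_pos; lra).
    apply Rmult_le_reg_r with s; [lra|].
    unfold Rdiv. rewrite Rmult_assoc, Rinv_l by lra. nra.
Qed.

(** The integrand [x^p exp(-s x)] is at most [p!] once [s >= 2], so the bound is uniform in [s]; the
    frequencies [2 pi m] satisfy this. *)
Lemma kern_diff_bound p s :
  2 <= s -> forall t, 0 <= t -> Rabs (kern p s t - kern p s 0) <= INR (fact p) * t.
Proof.
  intros Hs t Ht.
  destruct (MVT_closed (kern p s) (fun t => - (t ^ p * exp (- (s * t)))) 0 t) as (c & Hc & ->).
  - easy.
  - intros; apply kern_derive; lra.
  - rewrite Rminus_0_r, Rabs_mult, Rabs_Ropp, (Rabs_pos_eq t) by easy.
    apply Rmult_le_compat_r; [easy|].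
    assert (0 <= c ^ p) by (apply pow_le; lra).
    pose proof (exp_pos (- (s * c))). rewrite Rabs_pos_eq by nra.
    pose proof (pow_le_fact_exp p c (proj1 Hc)).
    assert (exp c * exp (- (s * c)) <= 1).
    { rewrite <- exp_plus. rewrite <- exp_0. destruct (Req_dec c 0) as [->|];
        [right; f_equal; ring|apply Rlt_le, exp_increasing; nra]. }
    pose proof (INR_fact_lt_0 p). pose proof (exp_pos c). nra.
Qed.

(** The mean value theorem is applied twice, to [kern] and to its derivative. The factor [exp (- t)]
    is kept because the points [t = j Y] are summed later: it reduces about [1 / Y] terms of size
    [Y^2] to a total of order [Y]. *)
Lemma kern_second_difference p s :
  2 <= s -> exists K, 0 <= K /\ forall t Y, 0 <= t -> 0 <= Y ->
  Rabs (kern p s t - 2 * kern p s (t + Y) + kern p s (t + 2 * Y)) <= K * Y ^ 2 * exp (- t).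
Proof.
  intros Hs.
  set (K := INR p * INR (fact (pred p)) + s * INR (fact p)).
  assert (HK : 0 <= K).
  { unfold K. pose proof (pos_INR p). pose proof (INR_fact_lt_0 (pred p)).
    pose proof (INR_fact_lt_0 p). nra. }
  exists K. split; [exact HK|]. intros t Y Ht HY.
  set (w := fun x => x ^ p * exp (- (s * x))).
  set (dw := fun x => INR p * x ^ pred p * exp (- (s * x)) - s * x ^ p * exp (- (s * x))).
  assert (Hdw : forall x, 0 <= x -> Rabs (dw x) <= K * exp (- x)).
  { intros x Hx. unfold dw.
    (* Since [s >= 2], the exponential splits in two: one factor absorbs the powers of [x], the
       other survives as decay. *)
    assert (E : exp (- (s * x)) <= exp (- x) * exp (- x)).
    { rewrite <- exp_plus. destruct (Req_dec x 0) as [->|];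
        [right; f_equal; ring|]. destruct (Req_dec s 2) as [->|];
        [right; f_equal; ring|]. apply Rlt_le, exp_increasing. nra. }
    assert (E1 : exp x * exp (- x) = 1) by (rewrite <- exp_plus, Rplus_opp_r; apply exp_0).
    assert (B : forall q, x ^ q * exp (- (s * x)) <= INR (fact q) * exp (- x)).
    { intros q. pose proof (pow_le_fact_exp q x Hx). pose proof (pow_le x q Hx).
      pose proof (exp_pos (- x)). pose proof (exp_pos x).
      pose proof (INR_fact_lt_0 q).
      apply Rle_trans with (x ^ q * (exp (- x) * exp (- x))); [nra|].
      apply Rle_trans with (INR (fact q) * exp x * (exp (- x) * exp (- x))); [nra|].
      right. replace (INR (fact q) * exp x * (exp (- x) * exp (- x))) with
        (INR (fact q) * (exp x * exp (- x)) * exp (- x)) by ring. rewrite E1; ring. }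
    pose proof (B p). pose proof (B (pred p)). pose proof (pos_INR p).
    pose proof (exp_pos (- (s * x))).
    pose proof (pow_le x p Hx). pose proof (pow_le x (pred p) Hx).
    eapply Rle_trans; [apply Rabs_triang|].
    rewrite Rabs_Ropp, !Rabs_pos_eq by (repeat apply Rmult_le_pos; lra).
    unfold K. nra. }
  assert (Hder : forall x, is_derive w x (dw x)).
  { intros x. unfold w, dw. auto_derive; [easy|]. ring. }
  destruct (MVT_closed (fun x => kern p s x - kern p s (x + Y))
    (fun x => - (w x) + w (x + Y)) t (t + Y)) as (c & Hc & E); [lra| |].
  { intros x Hx. unfold w.
    pose proof (kern_derive p s x ltac:(lra)) as D1.
    pose proof (kern_derive p s (x + Y) ltac:(lra)) as D2.
    auto_derive.
    - repeat split; eexists; eassumption.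
    - apply is_derive_unique in D1, D2. change (fun x => kern p s x) with (kern p s).
      rewrite D1, D2. ring. }
  destruct (MVT_closed w dw c (c + Y)) as (d & Hd & E'); [lra|auto|].
  replace (kern p s t - 2 * kern p s (t + Y) + kern p s (t + 2 * Y))
    with (- ((kern p s (t + Y) - kern p s (t + Y + Y)) - (kern p s t - kern p s (t + Y))))
    by (replace (t + 2 * Y) with (t + Y + Y) by ring; ring).
  rewrite E. replace (- w c + w (c + Y)) with (w (c + Y) - w c) by ring. rewrite E'.
  replace (- (dw d * (c + Y - c) * (t + Y - t))) with (- (dw d * Y ^ 2)) by ring.
  rewrite Rabs_Ropp, Rabs_mult, (Rabs_pos_eq (Y ^ 2)) by nra.
  specialize (Hdw d ltac:(lra)).
  assert (exp (- d) <= exp (- t)).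
  { destruct (Req_dec d t) as [->|]; [lra|]. apply Rlt_le, exp_increasing. lra. }
  assert (0 <= Y ^ 2) by nra.
  replace (K * Y ^ 2 * exp (- t)) with (K * exp (- t) * Y ^ 2) by ring.
  apply Rmult_le_compat_r; [easy|]. nra.
Qed.

(** * Abel summation of doubly periodic sums *)

(** Monotonicity reduces to [s = 1], and scaling exchanges the roles of [s] and [t]:
    [kern p 1 t = t^(p+1) kern p t 1], which decays exponentially in [t]. *)
Lemma kern_inv_bound p :
  exists K, 0 <= K /\ forall s t, 1 <= s -> 1 <= t -> kern p s t <= K / t.
Proof.
  destruct (kern_exp_bound p 1) as (K & HK & H); [lra|].
  exists (K * INR (fact (S (S p)))). split.
  { apply Rmult_le_pos; [easy|apply pos_INR]. }
  intros s t Hs H1.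
  apply Rle_trans with (kern p 1 t); [apply kern_antitone_s; lra|].
  rewrite <- (Rmult_1_r t) at 1. rewrite <- kern_scale, Rmult_1_l by lra.
  specialize (H t H1). rewrite Rmult_1_r in H.
  pose proof (pow_le_fact_exp (S (S p)) t ltac:(lra)) as H2.
  assert (E : exp t * exp (- t) = 1) by (rewrite <- exp_plus, Rplus_opp_r; apply exp_0).
  pose proof (exp_pos (- t)).
  apply Rmult_le_reg_r with t; [lra|]. unfold Rdiv.
  rewrite (Rmult_assoc _ (/ t)), Rinv_l, Rmult_1_r by lra.
  apply Rle_trans with (K * (t ^ S (S p) * exp (- t))).
  - replace (t ^ S (S p)) with (t ^ (p + 1) * t)
      by (rewrite Nat.add_1_r; simpl; ring).
    assert (0 <= t ^ (p + 1) * t) by (apply Rmult_le_pos; [apply pow_le|]; lra).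
    replace (t ^ (p + 1) * kern p t 1 * t) with (t ^ (p + 1) * t * kern p t 1) by ring.
    replace (K * (t ^ (p + 1) * t * exp (- t))) with (t ^ (p + 1) * t * (K * exp (- t))) by ring.
    now apply Rmult_le_compat_l.
  - apply Rmult_le_compat_l; [easy|].
    apply Rle_trans with (INR (fact (S (S p))) * exp t * exp (- t)).
    + apply Rmult_le_compat_r; lra.
    + rewrite Rmult_assoc, E; lra.
Qed.

(** A lower Riemann sum of [exp (- x)]; the inequality [1 + Y <= exp Y] makes it telescope. *)
Lemma exp_sum_bound Y n : 0 <= Y -> Y * rsum (fun j => exp (- (INR (S j) * Y))) n <= 1.
Proof.
  intros HY. rewrite <- rsum_scal.
  apply Rle_trans with
    (rsum (fun j => exp (- (INR j * Y)) - exp (- (INR (S j) * Y))) n).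
  - apply rsum_le. intros j _.
    replace (- (INR j * Y)) with (- (INR (S j) * Y) + Y) by (rewrite S_INR; ring).
    rewrite exp_plus. pose proof (exp_ineq1_le Y). pose proof (exp_pos (- (INR (S j) * Y))). nra.
  - rewrite (rsum_telescope (fun j => exp (- (INR j * Y)))). simpl INR.
    rewrite Rmult_0_l, Ropp_0, exp_0. pose proof (exp_pos (- (INR n * Y))); lra.
Qed.

(** Summation by parts against the zero-mean [h] leaves second differences of [kern],
    which are of size [Y^2]. *)
Lemma kern_equidistribution p s c h :
  2 <= s -> c <> O -> periodic c h -> rsum h c = 0 ->
  exists K, 0 <= K /\ forall Y q, 0 <= Y ->
  Rabs (rsum (fun j => h j * (kern p s (INR (S j) * Y) - kern p s (INR (S (S j)) * Y)))
     (q * c)) <= K * Y.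
Proof.
  intros Hs Hc Hh H0.
  destruct (periodic_bounded c (rsum h) Hc (rsum_periodic_zero c h Hh H0)) as (B & HB & HBb).
  destruct (kern_second_difference p s Hs) as (K & HK & HKb).
  exists (B * K). split; [now apply Rmult_le_pos|]. intros Y q HY.
  rewrite (rsum_abel h (fun j => kern p s (INR (S j) * Y) - kern p s (INR (S (S j)) * Y))).
  rewrite (rsum_periodic_mult c h q Hh H0), Rmult_0_l, Rplus_0_l.
  eapply Rle_trans; [apply rsum_abs|].
  apply Rle_trans with
    (rsum (fun j => B * K * Y * Y * exp (- (INR (S j) * Y))) (q * c)).
  - apply rsum_le. intros j _. rewrite Rabs_mult.
    set (t := INR (S j) * Y).
    assert (Ht : 0 <= t) by (apply Rmult_le_pos; [apply pos_INR|easy]).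
    specialize (HKb t Y Ht HY).
    replace (INR (S (S j)) * Y) with (t + Y) by (unfold t; rewrite (S_INR (S j)); ring).
    replace (INR (S (S (S j))) * Y) with (t + 2 * Y)
      by (unfold t; rewrite (S_INR (S (S j))), (S_INR (S j)); ring).
    replace (kern p s t - kern p s (t + Y) - (kern p s (t + Y) - kern p s (t + 2 * Y)))
      with (kern p s t - 2 * kern p s (t + Y) + kern p s (t + 2 * Y)) by ring.
    replace (B * K * Y * Y * exp (- t)) with (B * (K * Y ^ 2 * exp (- t))) by ring.
    apply Rmult_le_compat; auto using Rabs_pos.
  - rewrite rsum_scal. replace (B * K * Y * Y * _) with
      (B * K * Y * (Y * rsum (fun j => exp (- (INR (S j) * Y))) (q * c))) by ring.
    rewrite <- (Rmult_1_r (B * K * Y)) at 2. apply Rmult_le_compat_l.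
    + repeat apply Rmult_le_pos; easy.
    + now apply exp_sum_bound.
Qed.

Definition doubly_balanced (c : nat) (v : nat -> nat -> R) : Prop :=
  c <> O /\ (forall i, periodic c (v i)) /\ (forall j, periodic c (fun i => v i j)) /\
  (forall i, rsum (v i) c = 0) /\ (forall j, rsum (fun i => v i j) c = 0).

Definition psum2 (v : nat -> nat -> R) (i j : nat) : R :=
  rsum (fun i' => rsum (v i') j) i.

(** The Cesaro mean over a period of the partial sums of the row [v i], that
    is, its Abel sum. *)
Definition row_mean (c : nat) (v : nat -> nat -> R) (i : nat) : R :=
  / INR c * rsum (fun j => rsum (v i) (S j)) c.

Lemma psum2_periodic_l c v j : doubly_balanced c v -> periodic c (fun i => psum2 v i j).
Proof.
  intros (Hc & Hr & Hl & Zr & Zl). apply rsum_periodic_zero.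
  - intros i. apply rsum_ext. intros j' _. apply Hl.
  - rewrite rsum_swap. now apply rsum_zero.
Qed.

Lemma psum2_periodic_r c v i : doubly_balanced c v -> periodic c (psum2 v i).
Proof.
  intros (Hc & Hr & Hl & Zr & Zl) j. apply rsum_ext. intros i' _.
  now apply rsum_periodic_zero.
Qed.

Lemma psum2_bounded c v : doubly_balanced c v ->
  exists K, 0 <= K /\ forall i j, Rabs (psum2 v i j) <= K.
Proof.
  intros H. assert (Hc : c <> O) by apply H.
  destruct (periodic_bounded c (fun i => rsum (fun j => Rabs (psum2 v i j)) c) Hc)
    as (K & HK & HKb).
  { intros i. apply rsum_ext. intros j _. f_equal.
    apply (psum2_periodic_l c v j H i). }
  exists K. split; [easy|]. intros i j.
  rewrite (periodic_mod c (psum2 v i) j Hc (psum2_periodic_r c v i H)).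
  assert (Hj : (j mod c < c)%nat) by now apply Nat.mod_upper_bound.
  specialize (HKb i). rewrite Rabs_pos_eq in HKb by (apply rsum_nonneg; intros; apply Rabs_pos).
  set (j' := (j mod c)%nat) in *. eapply Rle_trans; [|apply HKb].
  eapply Rle_trans; [|apply (rsum_mono _ (S j') c); [intros; apply Rabs_pos|lia]].
  simpl. pose proof (rsum_nonneg (fun j => Rabs (psum2 v i j)) j' (fun _ _ => Rabs_pos _)); lra.
Qed.

Lemma row_mean_psum c v i :
  rsum (row_mean c v) i = / INR c * rsum (fun j => psum2 v i (S j)) c.
Proof. unfold row_mean, psum2. now rewrite rsum_scal, rsum_swap. Qed.

Lemma row_mean_psum_bound c v K : c <> O ->
  (forall i j, Rabs (psum2 v i j) <= K) -> forall i, Rabs (rsum (row_mean c v) i) <= K.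
Proof.
  intros Hc HK i. rewrite row_mean_psum, Rabs_mult.
  assert (Hc' : 0 < INR c) by (apply lt_0_INR; lia).
  rewrite Rabs_pos_eq by (apply Rlt_le, Rinv_0_lt_compat, Hc').
  apply Rmult_le_reg_l with (INR c); [easy|].
  rewrite <- Rmult_assoc, Rinv_r, Rmult_1_l by lra.
  eapply Rle_trans; [apply rsum_abs|]. rewrite <- rsum_const. apply rsum_le; auto.
Qed.

(** On a square whose side is a multiple of the period the boundary terms vanish in both directions,
    and only mixed second differences of the weight remain. *)
Lemma double_abel c v a q : doubly_balanced c v ->
  rsum (fun i => rsum (fun j => v i j * a i j) (q * c)) (q * c)
  = rsum (fun i => rsum (fun j => psum2 v (S i) (S j)
      * (a i j - a (S i) j - (a i (S j) - a (S i) (S j)))) (q * c)) (q * c).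
Proof.
  intros (Hc & Hr & Hl & Zr & Zl).
  rewrite (rsum_ext _ (fun i => rsum (fun j => rsum (v i) (S j) * (a i j - a i (S j))) (q * c))).
  2:{ intros i _. rewrite (rsum_abel (v i) (a i)).
      rewrite (rsum_periodic_mult c (v i) q) by auto. lra. }
  rewrite rsum_swap, (rsum_swap (fun i j => psum2 v (S i) (S j) * _)).
  apply rsum_ext. intros j _.
  rewrite (rsum_abel (fun i => rsum (v i) (S j)) (fun i => a i j - a i (S j))).
  rewrite (rsum_periodic_mult c (fun i => rsum (v i) (S j)) q).
  - rewrite Rmult_0_l, Rplus_0_l. apply rsum_ext. intros i _. unfold psum2. ring.
  - intros i. apply rsum_ext. intros j' _. apply Hl.
  - rewrite rsum_swap. now apply rsum_zero.
Qed.

Lemma two_pi_nat i : 2 <= 2 * PI * INR (S i).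
Proof. pose proof PI2_1. rewrite S_INR. pose proof (pos_INR i). unfold PI2 in *. nra. Qed.

Lemma kern_nat_decreasing p i t : 0 <= t ->
  kern p (2 * PI * INR (S (S i))) t <= kern p (2 * PI * INR (S i)) t.
Proof.
  intros Ht. apply kern_antitone_s; [|easy].
  pose proof (two_pi_nat i). pose proof PI_RGT_0. rewrite (S_INR (S i)). lra.
Qed.

(** The mixed differences of the weight have a constant sign, so sums of their absolute values
    telescope. This controls infinitely many rows uniformly in the truncation point. *)
Lemma kern_diff_decreasing p s s' t t' : 0 < s <= s' -> 0 <= t <= t' ->
  kern p s t' - kern p s' t' <= kern p s t - kern p s' t.
Proof.
  intros Hs Ht.
  destruct (MVT_closed (fun x => kern p s x - kern p s' x)
    (fun x => - (x ^ p * (exp (- (s * x)) - exp (- (s' * x))))) t t') as (c & Hc & E); [lra| |].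
  - intros x Hx.
    pose proof (kern_derive p s x ltac:(lra)) as D1.
    pose proof (kern_derive p s' x ltac:(lra)) as D2.
    auto_derive; [repeat split; eexists; eassumption|].
    apply is_derive_unique in D1, D2.
    change (fun x => kern p s x) with (kern p s). change (fun x => kern p s' x) with (kern p s').
    rewrite D1, D2. ring.
  - assert (0 <= c ^ p) by (apply pow_le; lra).
    assert (exp (- (s' * c)) <= exp (- (s * c))).
    { destruct (Req_dec (s' * c) (s * c)) as [->|]; [lra|].
      apply Rlt_le, exp_increasing. nra. }
    assert (0 <= c ^ p * (exp (- (s * c)) - exp (- (s' * c)))) by (apply Rmult_le_pos; lra).
    nra.
Qed.

Lemma kern_at_0_small p eps : 0 < eps ->
  exists N, forall n, (N <= n)%nat -> kern p (2 * PI * INR (S n)) 0 < eps.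
Proof.
  intros He. destruct (archimed_cor1 (eps / INR (fact p))) as (N & HN & HN0).
  { apply Rdiv_lt_0_compat; [easy|apply INR_fact_lt_0]. }
  exists N. intros n Hn. pose proof (two_pi_nat n) as H2. rewrite kern_at_0 by lra.
  pose proof (INR_fact_lt_0 p) as Hf.
  assert (Hs : INR N <= 2 * PI * INR (S n)).
  { apply le_INR in Hn. rewrite S_INR. pose proof PI2_1. unfold PI2 in *.
    pose proof (pos_INR n). nra. }
  set (s := 2 * PI * INR (S n)) in *.
  assert (HN' : 0 < INR N) by now apply lt_0_INR.
  assert (Hp : s <= s ^ (p + 1)).
  { rewrite <- (pow_1 s) at 1. apply Rle_pow; [lra|lia]. }
  apply Rle_lt_trans with (INR (fact p) * / INR N).
  - unfold Rdiv. apply Rmult_le_compat_l; [lra|]. apply Rinv_le_contravar; lra.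
  - apply Rmult_lt_reg_l with (/ INR (fact p)); [now apply Rinv_0_lt_compat|].
    rewrite <- Rmult_assoc, Rinv_l, Rmult_1_l by lra. unfold Rdiv in HN. lra.
Qed.

Lemma row_mean_series_cv p c v : doubly_balanced c v ->
  ex_finite_lim_seq (rsum (fun i => row_mean c v i * kern p (2 * PI * INR (S i)) 0)).
Proof.
  intros H. assert (Hc : c <> O) by apply H.
  destruct (psum2_bounded c v H) as (K & HK & HKb).
  pose proof (row_mean_psum_bound c v K Hc HKb) as HD.
  apply ex_lim_seq_cauchy_corr. intros eps.
  destruct (kern_at_0_small p (eps / (2 * K + 1))) as (N & HN).
  { apply Rdiv_lt_0_compat; [apply cond_pos|lra]. }
  assert (Hm : forall s n, (N <= s)%nat -> (s <= n)%nat ->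
    Rabs (rsum (fun i => row_mean c v i * kern p (2 * PI * INR (S i)) 0) n
        - rsum (fun i => row_mean c v i * kern p (2 * PI * INR (S i)) 0) s) < eps).
  { intros s n Hs Hn. eapply Rle_lt_trans.
    - apply (abel_inequality _ (fun i => kern p (2 * PI * INR (S i)) 0) K); auto.
      + intros i. apply kern_nonneg; [pose proof (two_pi_nat i)|]; lra.
      + intros i. apply kern_nat_decreasing; lra.
    - specialize (HN s Hs).
      pose proof (kern_nonneg p (2 * PI * INR (S s)) 0 ltac:(pose proof (two_pi_nat s); lra) ltac:(lra)).
      apply Rle_lt_trans with ((2 * K + 1) * kern p (2 * PI * INR (S s)) 0); [nra|].
      apply Rmult_lt_reg_l with (/ (2 * K + 1)); [apply Rinv_0_lt_compat; lra|].
      rewrite <- Rmult_assoc, Rinv_l, Rmult_1_l by lra. unfold Rdiv in HN; lra. }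
  exists N. intros n m Hn Hm'. destruct (Nat.le_ge_cases n m).
  - rewrite Rabs_minus_sym. now apply Hm.
  - now apply Hm.
Qed.

(** The coefficients [psum2 v (S i) (S j)] are split into their mean over [j], which is a partial
    sum of row means, and a periodic remainder [h] of mean zero. The mean telescopes to [psi] near
    zero; the remainder contributes [O(Y)] by [kern_equidistribution]. *)
Lemma row_contribution p c v i : doubly_balanced c v ->
  let psi t := kern p (2 * PI * INR (S i)) t - kern p (2 * PI * INR (S (S i))) t in
  exists K, 0 <= K /\ forall Y, 0 < Y -> eventually (fun q =>
    Rabs (rsum (fun j => psum2 v (S i) (S j)
       * (psi (INR (S j) * Y) - psi (INR (S (S j)) * Y))) (q * c)
      - rsum (row_mean c v) (S i) * psi 0) <= K * Y).
Proof.
  intros H psi. assert (Hc : c <> O) by apply H.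
  set (U := rsum (row_mean c v) (S i)).
  set (h := fun j => psum2 v (S i) (S j) - U).
  assert (Hh : periodic c h).
  { intros j. unfold h. f_equal. exact (psum2_periodic_r c v (S i) H (S j)). }
  assert (Hh0 : rsum h c = 0).
  { unfold h. rewrite rsum_minus, rsum_const. unfold U. rewrite row_mean_psum.
    assert (INR c <> 0) by now apply not_0_INR. field; easy. }
  pose proof (two_pi_nat i) as H1. pose proof (two_pi_nat (S i)) as H2.
  destruct (kern_equidistribution p _ c h H1 Hc Hh Hh0) as (K1 & HK1 & E1).
  destruct (kern_equidistribution p _ c h H2 Hc Hh Hh0) as (K2 & HK2 & E2).
  destruct (kern_inv_bound p) as (K3 & HK3 & E3).
  exists (K1 + K2 + Rabs U * (2 * INR (fact p) + 1)).
  pose proof (Rabs_pos U) as HU. pose proof (INR_fact_lt_0 p) as Hf.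
  split; [nra|]. intros Y HY.
  (* Beyond [T] the kernel is at most [K3 / t <= Y]; [Q] makes the last point of the sum exceed [T],
     so the far end of the telescoping sum is also [O(Y)]. *)
  set (T := Rmax 1 (K3 / Y)).
  destruct (nfloor_ex (T / Y)) as (Q & HQ).
  { apply Rdiv_le_0_compat; [|easy]. unfold T. pose proof (Rmax_l 1 (K3 / Y)); lra. }
  exists (S Q). intros q Hq.
  specialize (E1 Y q ltac:(lra)). specialize (E2 Y q ltac:(lra)).
  rewrite (rsum_ext _ (fun j =>
     (h j * (kern p (2 * PI * INR (S i)) (INR (S j) * Y)
            - kern p (2 * PI * INR (S i)) (INR (S (S j)) * Y))
     - h j * (kern p (2 * PI * INR (S (S i))) (INR (S j) * Y)
            - kern p (2 * PI * INR (S (S i))) (INR (S (S j)) * Y)))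
     + U * (psi (INR (S j) * Y) - psi (INR (S (S j)) * Y)))).
  2:{ intros j _. unfold h, psi. ring. }
  rewrite rsum_plus, rsum_minus, rsum_scal, (rsum_telescope (fun j => psi (INR (S j) * Y))).
  simpl (INR 1). rewrite Rmult_1_l.
  assert (P0 : Rabs (psi Y - psi 0) <= 2 * INR (fact p) * Y).
  { unfold psi. pose proof (kern_diff_bound p _ H1 Y ltac:(lra)) as A1.
    pose proof (kern_diff_bound p _ H2 Y ltac:(lra)) as A2.
    apply Rabs_le_between in A1, A2. apply Rabs_le. lra. }
  assert (P1 : Rabs (psi (INR (S (q * c)) * Y)) <= Y).
  { set (t := INR (S (q * c)) * Y).
    assert (Ht : T <= t).
    { unfold t. assert (INR Q + 1 <= INR (S (q * c))).
      { rewrite <- S_INR. apply le_INR. nia. }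
      apply Rmult_le_reg_r with (/ Y); [now apply Rinv_0_lt_compat|].
      rewrite Rmult_assoc, Rinv_r, Rmult_1_r by lra. unfold Rdiv in HQ. lra. }
    assert (Ht1 : 1 <= t) by (pose proof (Rmax_l 1 (K3 / Y)); unfold T in Ht; lra).
    assert (Ht2 : K3 / Y <= t) by (pose proof (Rmax_r 1 (K3 / Y)); unfold T in Ht; lra).
    assert (Hb : K3 / t <= Y).
    { apply Rmult_le_reg_r with t; [lra|]. unfold Rdiv.
      rewrite Rmult_assoc, Rinv_l, Rmult_1_r by lra.
      apply Rmult_le_reg_r with (/ Y); [now apply Rinv_0_lt_compat|].
      rewrite (Rmult_comm Y t), Rmult_assoc, Rinv_r by lra. unfold Rdiv in Ht2; lra. }
    unfold psi. pose proof (E3 (2 * PI * INR (S i)) t ltac:(lra) Ht1).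
    pose proof (kern_nonneg p (2 * PI * INR (S (S i))) t ltac:(lra) ltac:(lra)).
    pose proof (kern_nat_decreasing p i t ltac:(lra)).
    apply Rabs_le. lra. }
  match type of E1 with Rabs ?x <= _ => set (X1 := x) in * end.
  match type of E2 with Rabs ?x <= _ => set (X2 := x) in * end.
  set (p1 := psi (INR (S (q * c)) * Y)) in *.
  replace (X1 - X2 + U * (psi Y - p1) - U * psi 0) with
    ((X1 - X2) + U * ((psi Y - psi 0) - p1)) by ring.
  eapply Rle_trans; [apply Rabs_triang|]. rewrite Rabs_mult.
  assert (Rabs (X1 - X2) <= (K1 + K2) * Y).
  { apply Rabs_le_between in E1, E2. apply Rabs_le. lra. }
  assert (Rabs ((psi Y - psi 0) - p1) <= (2 * INR (fact p) + 1) * Y).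
  { apply Rabs_le_between in P0, P1. apply Rabs_le. lra. }
  pose proof (Rmult_le_compat_l _ _ _ HU H3). lra.
Qed.

(** The constant depends on [M], so this treats only finitely many rows before [Y] tends to zero. *)
Lemma head_contribution p c v M : doubly_balanced c v ->
  let psi i t := kern p (2 * PI * INR (S i)) t - kern p (2 * PI * INR (S (S i))) t in
  exists K, 0 <= K /\ forall Y, 0 < Y -> eventually (fun q =>
    Rabs (rsum (fun i => rsum (fun j => psum2 v (S i) (S j)
       * (psi i (INR (S j) * Y) - psi i (INR (S (S j)) * Y))) (q * c)) M
      - rsum (fun i => rsum (row_mean c v) (S i) * psi i 0) M) <= K * Y).
Proof.
  intros H psi. induction M as [|M (K1 & HK1 & IH)].
  - exists 0. split; [lra|]. intros Y HY. exists O. intros q _. simpl.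
    rewrite Rminus_0_r, Rabs_R0. lra.
  - destruct (row_contribution p c v M H) as (K2 & HK2 & IR).
    exists (K1 + K2). split; [lra|]. intros Y HY.
    destruct (IH Y HY) as [Q1 A1], (IR Y HY) as [Q2 A2].
    exists (Q1 + Q2)%nat. intros q Hq.
    specialize (A1 q ltac:(lia)). specialize (A2 q ltac:(lia)).
    change (rsum ?f (S M)) with (rsum f M + f M). cbv beta.
    fold (psi M 0) in A2.
    apply Rabs_le_between in A1, A2. apply Rabs_le. unfold psi in *. lra.
Qed.

(** The rows before [M] converge one by one as [Y -> 0]. All later rows together are at most
    [K * w M], for every [Y] and every side of the square, because [psum2] is bounded and the mixed
    differences telescope. A last Abel summation turns the head into a partial sum of the series
    with limit [V]. *)
Lemma square_sums_limit p c v : doubly_balanced c v ->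
  exists V : R,
  is_lim_seq (rsum (fun i => row_mean c v i * kern p (2 * PI * INR (S i)) 0)) V /\
  forall eps, 0 < eps -> exists delta, 0 < delta /\
  forall Y J : R, 0 < Y < delta ->
  is_lim_seq (fun q => rsum (fun i => rsum (fun j =>
     v i j * kern p (2 * PI * INR (S i)) (INR (S j) * Y)) (q * c)) (q * c)) J ->
  Rabs (J - V) < eps.
Proof.
  intros H. assert (Hc : c <> O) by apply H.
  destruct (row_mean_series_cv p c v H) as (V & HV). exists V. split; [exact HV|].
  destruct (psum2_bounded c v H) as (K & HK & HKb).
  pose proof (row_mean_psum_bound c v K Hc HKb) as HD.
  intros eps He.
  (* [4 * K] collects [2 * K] from the tail of the series for [V], [K] from the rows beyond [M], and
     [K] from the boundary term of the Abel summation of the head. *)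
  destruct (kern_at_0_small p (eps / 2 / (4 * K + 1))) as (M & HM).
  { apply Rdiv_lt_0_compat; lra. }
  specialize (HM M ltac:(lia)).
  destruct (head_contribution p c v M H) as (K2 & HK2 & Hhead).
  exists (eps / 2 / (K2 + 1)). split; [apply Rdiv_lt_0_compat; lra|].
  intros Y J HY HJ.
  set (w := fun i => kern p (2 * PI * INR (S i)) 0) in *.
  set (psi := fun i t => kern p (2 * PI * INR (S i)) t - kern p (2 * PI * INR (S (S i))) t) in *.
  assert (Hw : forall i, 0 <= w i).
  { intros i. apply kern_nonneg; [pose proof (two_pi_nat i)|]; lra. }
  assert (Hwd : forall i, w (S i) <= w i) by (intros; apply kern_nat_decreasing; lra).
  assert (A1 : Rabs (V - rsum (fun i => row_mean c v i * w i) M) <= 2 * K * w M).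
  { apply (is_lim_seq_abs_le _ _ _ _ HV). exists M. intros n Hn.
    apply (abel_inequality _ w K); auto. }
  assert (A2 : rsum (fun i => rsum (row_mean c v) (S i) * psi i 0) M
    = rsum (fun i => row_mean c v i * w i) M - rsum (row_mean c v) M * w M).
  { rewrite (rsum_abel (row_mean c v) w). unfold psi, w. lra. }
  assert (A3 : Rabs (J - rsum (fun i => rsum (row_mean c v) (S i) * psi i 0) M)
    <= K2 * Y + K * w M).
  { apply (is_lim_seq_abs_le _ _ _ _ HJ).
    destruct (Hhead Y ltac:(lra)) as (Q & HQ). exists (Q + M)%nat. intros q Hq.
    specialize (HQ q ltac:(lia)). rewrite (double_abel c v _ q H).
    rewrite (rsum_ext _ (fun i => rsum (fun j => psum2 v (S i) (S j)
       * (psi i (INR (S j) * Y) - psi i (INR (S (S j)) * Y))) (q * c))).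
    2:{ intros i _. apply rsum_ext. intros j _. unfold psi. ring. }
    match goal with |- Rabs (rsum ?g _ - _) <= _ => set (f := g) end.
    assert (HQ' : Rabs (rsum f M
      - rsum (fun i => rsum (row_mean c v) (S i) * psi i 0) M) <= K2 * Y) by exact HQ.
    replace (rsum f (q * c)) with (rsum f M + rsum (fun i => f (M + i)%nat) (q * c - M)).
    2:{ rewrite <- rsum_app. f_equal. nia. }
    (* Two telescopings: summing over [j] leaves [psi (M + i) Y], and summing over [i] leaves [kern]
       at frequency [M + 1]. *)
    assert (A4 : Rabs (rsum (fun i => f (M + i)%nat) (q * c - M)) <= K * w M).
    { eapply Rle_trans; [apply rsum_abs|].
      apply Rle_trans with (rsum (fun i => K * psi (M + i)%nat Y) (q * c - M)).
      - apply rsum_le. intros i _. unfold f.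
        eapply Rle_trans; [apply rsum_abs|].
        apply Rle_trans with (rsum (fun j => K * (psi (M + i)%nat (INR (S j) * Y)
           - psi (M + i)%nat (INR (S (S j)) * Y))) (q * c)).
        + apply rsum_le. intros j _. rewrite Rabs_mult.
          rewrite (Rabs_pos_eq (_ - _)).
          * apply Rmult_le_compat_r; [|apply HKb]. apply Rge_le, Rge_minus, Rle_ge.
            apply kern_diff_decreasing.
            -- pose proof (two_pi_nat (M + i)). pose proof PI_RGT_0.
               rewrite (S_INR (S (M + i))). lra.
            -- rewrite (S_INR (S j)). pose proof (pos_INR (S j)). nra.
          * apply Rge_le, Rge_minus, Rle_ge. apply kern_diff_decreasing.
            -- pose proof (two_pi_nat (M + i)). pose proof PI_RGT_0.
               rewrite (S_INR (S (M + i))). lra.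
            -- rewrite (S_INR (S j)). pose proof (pos_INR (S j)). nra.
        + rewrite rsum_scal. apply Rmult_le_compat_l; [easy|].
          rewrite (rsum_telescope (fun j => psi (M + i)%nat (INR (S j) * Y))).
          simpl (INR 1). rewrite Rmult_1_l.
          assert (0 <= psi (M + i)%nat (INR (S (q * c)) * Y)); [|lra].
          apply Rge_le, Rge_minus, Rle_ge, kern_nat_decreasing.
          apply Rmult_le_pos; [apply pos_INR|lra].
      - rewrite rsum_scal. apply Rmult_le_compat_l; [easy|]. unfold psi.
        rewrite (rsum_ext _ (fun i => kern p (2 * PI * INR (S (M + i))) Y
            - kern p (2 * PI * INR (S (M + S i))) Y)).
        2:{ intros i _. now rewrite Nat.add_succ_r. }
        rewrite (rsum_telescope (fun i => kern p (2 * PI * INR (S (M + i))) Y)).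
        rewrite Nat.add_0_r. unfold w.
        assert (HT : forall s t, 0 < s -> 0 <= t -> kern p s t <= kern p s 0).
        { intros s t Hs Ht.
          destruct (MVT_closed (kern p s) (fun t => - (t ^ p * exp (- (s * t)))) 0 t)
            as (d & Hd & E); [easy|intros; now apply kern_derive|].
          assert (0 <= d ^ p) by (apply pow_le; lra).
          pose proof (exp_pos (- (s * d))).
          assert (0 <= d ^ p * exp (- (s * d))) by (apply Rmult_le_pos; lra). nra. }
        pose proof (two_pi_nat M). pose proof (two_pi_nat (M + (q * c - M))).
        pose proof (HT (2 * PI * INR (S M)) Y ltac:(lra) ltac:(lra)).
        pose proof (kern_nonneg p (2 * PI * INR (S (M + (q * c - M)))) Y ltac:(lra) ltac:(lra)).
        lra. }
    apply Rabs_le_between in HQ', A4. apply Rabs_le. lra. }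
  assert (A5 : Rabs (rsum (row_mean c v) M * w M) <= K * w M).
  { rewrite Rabs_mult, (Rabs_pos_eq (w M)) by auto. apply Rmult_le_compat_r; auto. }
  assert (A6 : (4 * K + 1) * w M <= eps / 2).
  { apply Rmult_le_reg_l with (/ (4 * K + 1)); [apply Rinv_0_lt_compat; lra|].
    rewrite <- Rmult_assoc, Rinv_l, Rmult_1_l by lra.
    rewrite (Rmult_comm _ (eps / 2)). apply Rlt_le, HM. }
  assert (A7 : K2 * Y < eps / 2).
  { destruct HY as [HY0 HY]. apply Rmult_lt_compat_l with (r := K2 + 1) in HY; [|lra].
    replace ((K2 + 1) * (eps / 2 / (K2 + 1))) with (eps / 2) in HY by (field; lra). nra. }
  rewrite A2 in A3. specialize (Hw M).
  apply Rabs_le_between in A1, A3, A5. apply Rabs_lt_between. nra.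
Qed.

(** * The Mellin integral of an exponential series *)

Local Ltac nonzero := repeat split; solve [apply PI_neq0 | apply not_0_INR; lia].

Definition poly_bounded (b : nat -> R) : Prop :=
  exists K q, 0 <= K /\ forall n, Rabs (b n) <= K * INR (S n) ^ q.

(** Fourier coefficients are indexed from [0], so [b n] belongs to the frequency [n + 1]. *)
Definition expser (b : nat -> R) (y : R) : R :=
  Series (fun n => b n * exp (- (2 * PI * INR (S n) * y))).

Definition kernser (p : nat) (b : nat -> R) (y : R) : R :=
  Series (fun n => b n * kern p (2 * PI * INR (S n)) y).

(** These coefficients give, up to sign, the antiderivative of [expser b] that decays at
    infinity. *)
Definition int_coef (b : nat -> R) (n : nat) : R := b n / (2 * PI * INR (S n)).

Lemma ex_series_Rmult_l (c : R) (a : nat -> R) :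
  ex_series a -> ex_series (fun n => c * a n).
Proof. exact (ex_series_scal_l (K := R_AbsRing) (V := R_NormedModule) c a). Qed.

Lemma two_pi_nat_pos n : 0 < 2 * PI * INR (S n).
Proof. pose proof (two_pi_nat n); lra. Qed.

Lemma exp_pow_nat x n : exp x ^ n = exp (INR n * x).
Proof.
  induction n as [|n IH]; [simpl; now rewrite Rmult_0_l, exp_0|].
  rewrite S_INR, <- tech_pow_Rmult, IH, <- exp_plus. f_equal; ring.
Qed.

(** The larger point [exp (- PI y)], with half the exponent, still keeps [b n] times its [n]-th
    power bounded, since the exponential beats polynomial growth. *)
Lemma poly_bounded_radius b y : poly_bounded b -> 0 < y ->
  Rbar_lt (Rabs (exp (- (2 * PI * y)))) (CV_radius b).
Proof.
  intros (K & q & HK & Hb) Hy. pose proof PI_RGT_0 as HP.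
  set (a := PI * y). assert (Ha : 0 < a) by (unfold a; nra).
  apply Rbar_lt_le_trans with (exp (- a)).
  - cbn [Rbar_lt]. rewrite Rabs_pos_eq by (apply Rlt_le, exp_pos).
    apply exp_increasing. unfold a. nra.
  - apply (proj1 (CV_radius_bounded b)).
    exists (K * (INR (fact q) * exp a / a ^ q)). intros n.
    rewrite Rabs_mult, exp_pow_nat, (Rabs_pos_eq (exp _)) by (apply Rlt_le, exp_pos).
    pose proof (pow_le_fact_exp q (a * INR (S n))
      ltac:(apply Rmult_le_pos; [lra|apply pos_INR])) as H1.
    rewrite Rpow_mult_distr in H1. specialize (Hb n).
    pose proof (exp_pos (INR n * - a)) as He.
    apply Rle_trans with (K * INR (S n) ^ q * exp (INR n * - a)).
    + apply Rmult_le_compat_r; lra.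
    + rewrite Rmult_assoc. apply Rmult_le_compat_l; [easy|].
      assert (Hp : 0 < a ^ q) by now apply pow_lt.
      apply Rmult_le_reg_l with (a ^ q); [easy|].
      replace (a ^ q * (INR (fact q) * exp a / a ^ q)) with
        (INR (fact q) * exp (a * INR (S n)) * exp (INR n * - a)).
      * rewrite <- Rmult_assoc. apply Rmult_le_compat_r; lra.
      * rewrite (Rmult_assoc (INR (fact q))), <- exp_plus.
        replace (a * INR (S n) + INR n * - a) with a by (rewrite S_INR; ring).
        field; lra.
Qed.

Lemma ex_series_expser_abs b y : poly_bounded b -> 0 < y ->
  ex_series (fun n => Rabs (b n) * exp (- (2 * PI * INR (S n) * y))).
Proof.
  intros Hb Hy. pose proof (CV_disk_inside b _ (poly_bounded_radius b y Hb Hy)) as H.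
  apply (ex_series_Rmult_l (exp (- (2 * PI * y)))) in H.
  revert H. apply ex_series_ext. intros n.
  rewrite Rabs_mult, exp_pow_nat, (Rabs_pos_eq (exp _)) by (apply Rlt_le, exp_pos).
  rewrite (Rmult_comm (Rabs (b n))), <- Rmult_assoc, <- exp_plus, Rmult_comm.
  f_equal. f_equal. rewrite S_INR; ring.
Qed.

(** As a power series without constant term in [exp (- 2 PI y)], the series can be differentiated
    term by term. *)
Lemma expser_PSeries b y :
  expser b y = PSeries (PS_incr_1 b) (exp (- (2 * PI * y))).
Proof.
  rewrite PSeries_incr_1. unfold expser, PSeries. rewrite <- Series_scal_l.
  apply Series_ext. intros n. rewrite exp_pow_nat.
  replace (- (2 * PI * INR (S n) * y)) with (- (2 * PI * y) + INR n * - (2 * PI * y))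
    by (rewrite S_INR; ring).
  rewrite exp_plus. ring.
Qed.

Lemma int_coef_poly_bounded b : poly_bounded b -> poly_bounded (int_coef b).
Proof.
  intros (K & q & HK & Hb). exists K, q. split; [easy|]. intros n.
  unfold int_coef, Rdiv. rewrite Rabs_mult. pose proof (two_pi_nat n) as H.
  rewrite (Rabs_pos_eq (/ _)) by (apply Rlt_le, Rinv_0_lt_compat; lra).
  rewrite <- (Rmult_1_r (K * _)). apply Rmult_le_compat; auto using Rabs_pos.
  - apply Rlt_le, Rinv_0_lt_compat; lra.
  - rewrite <- Rinv_1. apply Rinv_le_contravar; lra.
Qed.

Lemma expser_derive b y : poly_bounded b -> 0 < y ->
  is_derive (expser (int_coef b)) y (- expser b y).
Proof.
  intros Hb Hy.
  apply (is_derive_ext (fun y => PSeries (PS_incr_1 (int_coef b)) (exp (- (2 * PI * y))))).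
  { intros t. symmetry. apply expser_PSeries. }
  evar_last.
  - apply (is_derive_comp (PSeries (PS_incr_1 (int_coef b))) (fun y => exp (- (2 * PI * y)))).
    + apply is_derive_PSeries. rewrite CV_radius_incr_1.
      apply poly_bounded_radius; auto using int_coef_poly_bounded.
    + auto_derive; [easy|]. reflexivity.
  - unfold scal; simpl; unfold mult; simpl.
    rewrite expser_PSeries, PSeries_incr_1.
    rewrite (PSeries_ext _ (PS_scal (/ (2 * PI)) b)).
    + rewrite PSeries_scal. field. apply PI_neq0.
    + intros n. unfold PS_derive, PS_incr_1, int_coef, PS_scal.
      unfold scal; simpl; unfold mult; simpl.
      change (match n with O => 1 | S _ => INR n + 1 end) with (INR (S n)).
      field; nonzero.
Qed.

Lemma ex_series_kernser_abs p b y : poly_bounded b -> 0 < y ->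
  ex_series (fun n => Rabs (b n * kern p (2 * PI * INR (S n)) y)).
Proof.
  intros Hb Hy. destruct (kern_exp_bound p y ltac:(lra)) as (K & HK & HKb).
  apply (ex_series_le (K := R_AbsRing) (V := R_CompleteNormedModule) _ (fun n => K * (Rabs (b n) * exp (- (2 * PI * INR (S n) * y))))).
  - intros n. change (Rabs (Rabs (b n * kern p (2 * PI * INR (S n)) y))
      <= K * (Rabs (b n) * exp (- (2 * PI * INR (S n) * y)))).
    rewrite Rabs_Rabsolu, Rabs_mult.
    pose proof (two_pi_nat n).
    rewrite (Rabs_pos_eq (kern _ _ _)) by (apply kern_nonneg; lra).
    specialize (HKb (2 * PI * INR (S n)) ltac:(lra)).
    pose proof (Rmult_le_compat_l _ _ _ (Rabs_pos (b n)) HKb). lra.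
  - apply (ex_series_Rmult_l K _ (ex_series_expser_abs b y Hb Hy)).
Qed.

Lemma kernser_0 b y : kernser 0 b y = expser (int_coef b) y.
Proof.
  apply Series_ext. intros n. unfold int_coef. cbn [kern]. field; nonzero.
Qed.

Lemma kernser_S p b y : poly_bounded b -> 0 < y ->
  kernser (S p) b y
  = y ^ S p * expser (int_coef b) y + INR (S p) * kernser p (int_coef b) y.
Proof.
  intros Hb Hy. pose proof (int_coef_poly_bounded b Hb) as Hb'.
  unfold kernser, expser. rewrite <- !Series_scal_l. rewrite <- Series_plus.
  - apply Series_ext. intros n. unfold int_coef. cbn [kern]. field; nonzero.
  - apply (ex_series_Rmult_l (y ^ S p)). apply ex_series_Rabs.
    generalize (ex_series_expser_abs _ y Hb' Hy). apply ex_series_ext. intros n.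
    now rewrite Rabs_mult, (Rabs_pos_eq (exp _)) by (apply Rlt_le, exp_pos).
  - apply (ex_series_Rmult_l (INR (S p))). apply ex_series_Rabs.
    now apply ex_series_kernser_abs.
Qed.

(** Term-by-term differentiation is done for [expser] alone. The recursion [kernser_S] and the
    product rule reduce [p + 1] to [p] with coefficients [int_coef b], and the two terms carrying
    [expser (int_coef b)] cancel. *)
Lemma kernser_derive p : forall b y, poly_bounded b -> 0 < y ->
  is_derive (kernser p b) y (- (y ^ p * expser b y)).
Proof.
  induction p as [|p IH]; intros b y Hb Hy.
  - apply (is_derive_ext (expser (int_coef b))).
    { intros t. symmetry. apply kernser_0. }
    rewrite Rmult_1_l. now apply expser_derive.
  - pose proof (int_coef_poly_bounded b Hb) as Hb'.
    apply (is_derive_ext_loc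
      (fun y => y ^ S p * expser (int_coef b) y + INR (S p) * kernser p (int_coef b) y)).
    { exists (mkposreal y Hy). intros t Ht. symmetry. apply kernser_S; [easy|].
      unfold ball in Ht; simpl in Ht; unfold AbsRing_ball, abs, minus, plus, opp in Ht;
        simpl in Ht. apply Rabs_lt_between in Ht. lra. }
    pose proof (expser_derive b y Hb Hy) as D1. pose proof (IH _ y Hb' Hy) as D2.
    set (f := expser (int_coef b)) in *. set (g := kernser p (int_coef b)) in *.
    auto_derive.
    + repeat split; eexists; eassumption.
    + change (fun x => f x) with f. change (fun x => g x) with g.
      rewrite (is_derive_unique _ _ _ D1), (is_derive_unique _ _ _ D2).
      change (match p with O => 1 | S _ => INR p + 1 end) with (INR (S p)).
      simpl pow. ring.
Qed.

(** Multiplying the coefficients by their frequencies keeps them polynomially bounded, so [expser b]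
    is itself an [expser (int_coef b')], hence differentiable. *)
Lemma expser_continuous b y : poly_bounded b -> 0 < y -> continuous (expser b) y.
Proof.
  intros (K & q & HK & Hb) Hy.
  set (b' := fun n => b n * (2 * PI * INR (S n))).
  assert (Hb' : poly_bounded b').
  { exists (K * (2 * PI)), (S q). pose proof PI_RGT_0. split; [nra|]. intros n. unfold b'.
    rewrite Rabs_mult. pose proof (two_pi_nat n). rewrite (Rabs_pos_eq (_ * _)) by lra.
    apply Rle_trans with (K * INR (S n) ^ q * (2 * PI * INR (S n))).
    - apply Rmult_le_compat_r; [lra|apply Hb].
    - rewrite <- tech_pow_Rmult. right. ring. }
  apply (continuous_ext (expser (int_coef b'))).
  - intros t. apply Series_ext. intros n. unfold int_coef, b'. field; nonzero.
  - apply (ex_derive_continuous (K := R_AbsRing) (V := R_NormedModule)).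
    eexists. now apply expser_derive.
Qed.

Lemma kernser_decay p b : poly_bounded b ->
  exists K, 0 <= K /\ forall y, 1 <= y -> Rabs (kernser p b y) <= K / y.
Proof.
  intros Hb.
  destruct (kern_exp_bound p 1 ltac:(lra)) as (K & HK & HKb).
  pose proof (ex_series_expser_abs b 1 Hb ltac:(lra)) as Hex.
  set (A := Series (fun n => Rabs (b n) * exp (- (2 * PI * INR (S n) * 1)))) in *.
  assert (HA : 0 <= A).
  { apply (is_lim_seq_le (fun _ => 0) (rsum (fun n => Rabs (b n) * exp (- (2 * PI * INR (S n) * 1))))
      0 A); [|apply is_lim_seq_const|now apply is_series_rsum, Series_correct].
    intros n. apply rsum_nonneg. intros i _.
    apply Rmult_le_pos; [apply Rabs_pos|apply Rlt_le, exp_pos]. }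
  set (F := INR (fact (S (S p)))). assert (HF : 0 < F) by apply INR_fact_lt_0.
  exists (K * A * exp 1 * F). split.
  { pose proof (exp_pos 1). repeat apply Rmult_le_pos; lra. }
  intros y Hy.
  (* Scaling gives [kern p s y = y^(p+1) kern p (s y) 1], and [(s - 1) (y - 1) >= 0] gives
     [exp (- s y) <= exp (1 - y) exp (- s)], which separates [y] from the summation index. *)
  assert (Hterm : forall n, kern p (2 * PI * INR (S n)) y
     <= K * (y ^ (p + 1) * exp (1 - y)) * exp (- (2 * PI * INR (S n) * 1))).
  { intros n. set (s := 2 * PI * INR (S n)). assert (Hs : 2 <= s) by apply two_pi_nat.
    rewrite <- (Rmult_1_r y) at 1. rewrite <- kern_scale by lra.
    assert (Hyp : 0 <= y ^ (p + 1)) by (apply pow_le; lra).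
    specialize (HKb (s * y) ltac:(nra)).
    apply Rle_trans with (y ^ (p + 1) * (K * exp (- (s * y * 1)))).
    - now apply Rmult_le_compat_l.
    - replace (K * (y ^ (p + 1) * exp (1 - y)) * exp (- (s * 1))) with
        (y ^ (p + 1) * (K * (exp (1 - y) * exp (- (s * 1))))) by ring.
      apply Rmult_le_compat_l; [easy|]. apply Rmult_le_compat_l; [easy|].
      rewrite <- exp_plus.
      destruct (Req_dec (- (s * y * 1)) (1 - y + - (s * 1))) as [->|]; [lra|].
      apply Rlt_le, exp_increasing. nra. }
  assert (Hexy : exp y * exp (- y) = 1) by (rewrite <- exp_plus, Rplus_opp_r; apply exp_0).
  eapply Rle_trans.
  { apply Series_Rabs. apply ex_series_kernser_abs; [easy|lra]. }
  eapply Rle_trans.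
  { apply (Series_le _ (fun n => K * (y ^ (p + 1) * exp (1 - y))
      * (Rabs (b n) * exp (- (2 * PI * INR (S n) * 1))))).
    - intros n. split; [apply Rabs_pos|]. rewrite Rabs_mult.
      rewrite (Rabs_pos_eq (kern _ _ _)).
      + pose proof (Rmult_le_compat_l _ _ _ (Rabs_pos (b n)) (Hterm n)). lra.
      + apply kern_nonneg; [apply two_pi_nat_pos|lra].
    - now apply (ex_series_Rmult_l (K * (y ^ (p + 1) * exp (1 - y)))). }
  rewrite Series_scal_l. fold A.
  apply Rmult_le_reg_r with y; [lra|]. unfold Rdiv.
  rewrite (Rmult_assoc _ (/ y)), Rinv_l, Rmult_1_r by lra.
  replace (1 - y) with (1 + - y) by ring. rewrite exp_plus.
  replace (K * (y ^ (p + 1) * (exp 1 * exp (- y))) * A * y)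
    with (K * A * exp 1 * (y ^ S (S p) * exp (- y)))
    by (rewrite Nat.add_1_r; simpl; ring).
  apply Rmult_le_compat_l.
  { pose proof (exp_pos 1). repeat apply Rmult_le_pos; lra. }
  pose proof (pow_le_fact_exp (S (S p)) y ltac:(lra)) as H1. fold F in H1.
  pose proof (exp_pos (- y)).
  apply Rle_trans with (F * exp y * exp (- y)); [apply Rmult_le_compat_r; lra|].
  rewrite Rmult_assoc, Hexy; lra.
Qed.

(** [- kernser p b] is an antiderivative that vanishes at infinity by [kernser_decay]; all that
    remains of convergence is the limit at zero. *)
Lemma is_RInt_gen_expser p b (V : R) : poly_bounded b ->
  filterlim (kernser p b) (at_right 0) (locally V) ->
  is_RInt_gen (fun y => y ^ p * expser b y) (at_right 0) (Rbar_locally p_infty) V.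
Proof.
  intros Hb HV P [eps HP].
  destruct (kernser_decay p b Hb) as (K & HK & HKb).
  assert (He : 0 < eps / 2) by (pose proof (cond_pos eps); lra).
  apply (Filter_prod _ _ _
    (fun a => 0 < a /\ Rabs (kernser p b a - V) < eps / 2)
    (fun z => 1 < z /\ Rabs (kernser p b z) < eps / 2)).
  - apply filter_and.
    + exists (mkposreal 1 Rlt_0_1). intros; lra.
    + apply (HV (fun x => Rabs (x - V) < eps / 2)).
      exists (mkposreal _ He). intros x Hx. exact Hx.
  - exists (Rmax 1 (K / (eps / 2) + 1)). intros z Hz.
    assert (H1 : 1 < z) by (eapply Rle_lt_trans; [apply Rmax_l|apply Hz]).
    assert (H2 : K / (eps / 2) + 1 < z) by (eapply Rle_lt_trans; [apply Rmax_r|apply Hz]).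
    split; [easy|]. eapply Rle_lt_trans; [apply HKb; lra|].
    apply Rmult_lt_reg_r with z; [lra|]. unfold Rdiv at 1.
    rewrite Rmult_assoc, Rinv_l, Rmult_1_r by lra.
    apply Rmult_lt_reg_l with (/ (eps / 2)); [now apply Rinv_0_lt_compat|].
    rewrite <- (Rmult_assoc (/ _) (eps / 2)), Rinv_l by lra. unfold Rdiv in H2 |- *. lra.
  - intros a z [Ha1 Ha2] [Hz1 Hz2]. simpl fst; simpl snd.
    exists (minus (- kernser p b z) (- kernser p b a)). split.
    + apply (is_RInt_derive (V := R_CompleteNormedModule) (fun y => - kernser p b y)
        (fun y => y ^ p * expser b y)).
      * intros x Hx.
        assert (Hx0 : 0 < x) by (eapply Rlt_le_trans; [|apply Hx]; apply Rmin_glb_lt; lra).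
        rewrite <- (Ropp_involutive (x ^ p * _)).
        apply (is_derive_opp (V := R_NormedModule)). now apply kernser_derive.
      * intros x Hx.
        assert (Hx0 : 0 < x) by (eapply Rlt_le_trans; [|apply Hx]; apply Rmin_glb_lt; lra).
        apply (continuous_mult (K := R_AbsRing) (fun y => y ^ p) (expser b)).
        -- apply (ex_derive_continuous (K := R_AbsRing) (V := R_NormedModule)).
           auto_derive. easy.
        -- now apply expser_continuous.
    + apply HP. change (Rabs ((- kernser p b z - - kernser p b a) - V) < eps).
      apply Rabs_lt_between in Ha2, Hz2. apply Rabs_lt_between. lra.
Qed.

Lemma is_RInt_gen_pair (Fa Fb : (R -> Prop) -> Prop) {HFa : Filter Fa} {HFb : Filter Fb}
  (f g : R -> R) (lf lg : R) :
  is_RInt_gen f Fa Fb lf -> is_RInt_gen g Fa Fb lg ->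
  is_RInt_gen (V := C_R_NormedModule) (fun y => (f y, g y)) Fa Fb (lf, lg).
Proof.
  intros Hf Hg P [eps HP].
  specialize (Hf (fun x => ball lf eps x) (locally_ball lf eps)).
  specialize (Hg (fun x => ball lg eps x) (locally_ball lg eps)).
  unfold filtermapi in *.
  generalize (filter_and (F := filter_prod Fa Fb) _ _ Hf Hg). apply filter_imp.
  intros [a z] [(x & Hx & Bx) (y & Hy & By)]. exists (x, y). split.
  - now apply (is_RInt_fct_extend_pair (U := R_NormedModule) (V := R_NormedModule)).
  - apply HP. split; assumption.
Qed.

(** * Lambert series *)

Definition divsum (F : nat -> nat -> R) (N : nat) : R :=
  rsum (fun i => if Nat.eqb (N mod S i) 0 then F (S i) (N / S i)%nat else 0) N.

(** The pairs are sorted by their product, and the region [m n <= X] is written as part of the full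
    square so that it can be compared with square sums. *)
Lemma rsum_divsum F X :
  rsum (fun N => divsum F (S N)) X
  = rsum (fun i => rsum (fun j => if Nat.leb (S i * S j) X then F (S i) (S j) else 0) X) X.
Proof.
  induction X as [|X IH]; [easy|].
  change (rsum (fun N => divsum F (S N)) (S X))
    with (rsum (fun N => divsum F (S N)) X + divsum F (S X)).
  rewrite IH.
  rewrite (rsum_ext _ (fun i =>
    rsum (fun j => if Nat.leb (S i * S j) X then F (S i) (S j) else 0) (S X)
    + (if Nat.eqb (S X mod S i) 0 then F (S i) (S X / S i)%nat else 0)) (S X)).
  - rewrite rsum_plus. fold (divsum F (S X)). f_equal.
    cbn [rsum]. rewrite (rsum_zero (fun j => if Nat.leb (S X * S j) X then _ else _)).
    2:{ intros j _. destruct (Nat.leb_spec (S X * S j) X); [nia|easy]. }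
    destruct (Nat.leb_spec (S X * S X) X); [nia|].
    rewrite Rplus_0_l, Rplus_0_r. apply rsum_ext. intros i _.
    destruct (Nat.leb_spec (S i * S X) X); [nia|]. lra.
  - intros i Hi. set (d := (S X / S i)%nat).
    pose proof (Nat.div_mod_eq (S X) (S i)) as E. fold d in E.
    assert (Hr : (S X mod S i < S i)%nat) by (apply Nat.mod_upper_bound; lia).
    destruct (Nat.eqb_spec (S X mod S i) 0) as [H0|H0].
    + assert (Hd : (1 <= d <= S X)%nat) by nia.
      rewrite (rsum_ext _ (fun j =>
        (if Nat.leb (S i * S j) X then F (S i) (S j) else 0)
        + (if Nat.eqb j (d - 1) then F (S i) d else 0))).
      * rewrite rsum_plus. f_equal. rewrite (rsum_single _ _ (d - 1)); [now rewrite Nat.eqb_refl|lia|].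
        intros j Hj Hne. destruct (Nat.eqb_spec j (d - 1)); easy.
      * intros j Hj.
        destruct (Nat.leb_spec (S i * S j) (S X)), (Nat.leb_spec (S i * S j) X),
          (Nat.eqb_spec j (d - 1)); try lra; try nia.
        subst j. replace (S (d - 1)) with d by lia. lra.
    + rewrite Rplus_0_r. apply rsum_ext. intros j Hj.
      destruct (Nat.leb_spec (S i * S j) (S X)), (Nat.leb_spec (S i * S j) X); try easy; try nia.
      exfalso. apply H0. replace (S X) with (S j * S i)%nat by nia. apply Nat.Div0.mod_mul.
Qed.

Lemma divsum_ext F G N :
  (forall m n, (m * n)%nat = N -> F m n = G m n) -> divsum F N = divsum G N.
Proof.
  intros H. apply rsum_ext. intros i _. destruct (Nat.eqb_spec (N mod S i) 0) as [E|]; [|easy].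
  apply H. pose proof (Nat.div_mod_eq N (S i)). lia.
Qed.

Lemma divsum_scal F c N : divsum (fun m n => F m n * c) N = divsum F N * c.
Proof.
  unfold divsum. rewrite Rmult_comm, <- rsum_scal. apply rsum_ext. intros i _.
  destruct (Nat.eqb (N mod S i) 0); ring.
Qed.

Lemma divsum_poly_bounded (u : nat -> nat -> R) (B : R) q :
  (forall m n, Rabs (u m n) <= B) ->
  poly_bounded (fun N => divsum (fun m n => u m n * INR n ^ q) (S N)).
Proof.
  intros HB. assert (HB0 : 0 <= B) by (eapply Rle_trans; [apply Rabs_pos|apply (HB O O)]).
  exists B, (S q). split; [easy|]. intros N. eapply Rle_trans; [apply rsum_abs|].
  apply Rle_trans with (rsum (fun _ => B * INR (S N) ^ q) (S N)).
  - apply rsum_le. intros i Hi.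
    assert (Hq : 0 <= B * INR (S N) ^ q) by (apply Rmult_le_pos; [easy|apply pow_le, pos_INR]).
    destruct (Nat.eqb (S N mod S i) 0); [|now rewrite Rabs_R0].
    rewrite Rabs_mult, (Rabs_pos_eq (_ ^ _)) by apply pow_le, pos_INR.
    apply Rmult_le_compat; [apply Rabs_pos|apply pow_le, pos_INR|apply HB|].
    apply pow_incr. split; [apply pos_INR|]. apply le_INR.
    apply Nat.Div0.div_le_upper_bound; lia.
  - rewrite rsum_const. right. simpl. ring.
Qed.

(** Three spare powers of [x] are extracted because a square of side [X] has [X^2] entries: those
    with product above [X] then total [O(1 / X)]. *)
Lemma pow_exp_decay q x Y : 0 < x -> 0 < Y ->
  x ^ q * exp (- (x * Y)) <= INR (fact (q + 3)) / Y ^ (q + 3) / x ^ 3.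
Proof.
  intros Hx HY. assert (HxY : 0 < x * Y) by nra.
  pose proof (pow_le_fact_exp (q + 3) (x * Y) ltac:(lra)) as H.
  rewrite Rpow_mult_distr, pow_add in H.
  assert (E : exp (x * Y) * exp (- (x * Y)) = 1) by (rewrite <- exp_plus, Rplus_opp_r; apply exp_0).
  assert (H3 : 0 < x ^ 3) by now apply pow_lt.
  assert (HYp : 0 < Y ^ (q + 3)) by now apply pow_lt.
  pose proof (exp_pos (- (x * Y))).
  apply Rmult_le_reg_r with (x ^ 3 * Y ^ (q + 3)); [nra|].
  replace (INR (fact (q + 3)) / Y ^ (q + 3) / x ^ 3 * (x ^ 3 * Y ^ (q + 3)))
    with (INR (fact (q + 3))) by (field; lra).
  replace (x ^ q * exp (- (x * Y)) * (x ^ 3 * Y ^ (q + 3)))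
    with (x ^ q * x ^ 3 * Y ^ (q + 3) * exp (- (x * Y))) by ring.
  apply Rle_trans with (INR (fact (q + 3)) * exp (x * Y) * exp (- (x * Y))).
  - apply Rmult_le_compat_r; lra.
  - rewrite Rmult_assoc, E; lra.
Qed.

(** The Fourier series orders the pairs by [N = m n], whereas double Abel summation needs squares.
    For fixed [Y > 0] the difference of the two orderings is at most [M / X]. *)
Lemma kernser_square_sums p (u : nat -> nat -> R) (B Y : R) :
  (forall m n, Rabs (u m n) <= B) -> 0 < Y ->
  is_lim_seq (fun X => rsum (fun i => rsum (fun j =>
      u (S i) (S j) * kern p (2 * PI * INR (S i)) (INR (S j) * Y)) X) X)
    (kernser p (fun N => divsum (fun m n => u m n * INR n ^ (p + 1)) (S N)) Y).
Proof.
  intros HB HY. assert (HB0 : 0 <= B) by (eapply Rle_trans; [apply Rabs_pos|apply (HB O O)]).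
  set (b := fun N => divsum (fun m n => u m n * INR n ^ (p + 1)) (S N)).
  set (H := fun m n => u m n * INR n ^ (p + 1) * kern p (2 * PI * INR (m * n)) Y).
  assert (L1 : is_lim_seq (rsum (fun N => divsum H (S N))) (kernser p b Y)).
  { apply is_series_rsum.
    apply (is_series_ext (fun n => b n * kern p (2 * PI * INR (S n)) Y)).
    - intros N. unfold b. rewrite <- divsum_scal. apply divsum_ext.
      intros m n E. unfold H. now rewrite E.
    - apply Series_correct, ex_series_Rabs, ex_series_kernser_abs; [|easy].
      now apply divsum_poly_bounded with B. }
  destruct (kern_exp_bound p Y ltac:(lra)) as (K & HK & HKb).
  set (M := B * K * (INR (fact (p + 1 + 3)) / Y ^ (p + 1 + 3))).
  assert (HM : 0 <= M).
  { unfold M. repeat apply Rmult_le_pos; try lra; [apply pos_INR|].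
    apply Rlt_le, Rinv_0_lt_compat, pow_lt, HY. }
  assert (HH : forall i j, Rabs (H (S i) (S j)) <= M / INR (S i * S j) ^ 3).
  { intros i j. unfold H.
    set (x := INR (S i * S j)).
    assert (Hx : 1 <= x) by (apply (le_INR 1); lia).
    assert (Hn : 0 <= INR (S j) <= x).
    { split; [apply pos_INR|apply le_INR; nia]. }
    pose proof PI2_1 as HP. unfold PI2 in HP.
    assert (H1 : kern p (2 * PI * x) Y <= K * exp (- (x * Y))).
    { eapply Rle_trans; [apply HKb; nra|]. apply Rmult_le_compat_l; [easy|].
      apply Rlt_le, exp_increasing. assert (0 < x * Y) by nra. nra. }
    pose proof (kern_nonneg p (2 * PI * x) Y ltac:(nra) ltac:(lra)) as H0.
    rewrite !Rabs_mult, (Rabs_pos_eq (kern _ _ _)), (Rabs_pos_eq (_ ^ _)) by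
      (auto; apply pow_le; lra).
    pose proof (pow_exp_decay (p + 1) x Y ltac:(lra) HY) as H2.
    assert (H3 : INR (S j) ^ (p + 1) <= x ^ (p + 1)) by now apply pow_incr.
    assert (H4 : 0 <= INR (S j) ^ (p + 1)) by (apply pow_le; lra).
    rewrite Rmult_assoc.
    apply Rle_trans with (B * (x ^ (p + 1) * (K * exp (- (x * Y))))).
    - apply Rmult_le_compat; auto using Rabs_pos; [now apply Rmult_le_pos|].
      apply Rmult_le_compat; auto.
    - replace (B * (x ^ (p + 1) * (K * exp (- (x * Y)))))
        with (B * K * (x ^ (p + 1) * exp (- (x * Y)))) by ring.
      unfold M. replace (B * K * (INR (fact (p + 1 + 3)) / Y ^ (p + 1 + 3)) / x ^ 3)
        with (B * K * (INR (fact (p + 1 + 3)) / Y ^ (p + 1 + 3) / x ^ 3)) by (unfold Rdiv; ring).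
      apply Rmult_le_compat_l; [nra|easy]. }
  assert (HE : forall i j, u (S i) (S j) * kern p (2 * PI * INR (S i)) (INR (S j) * Y)
    = H (S i) (S j)).
  { intros i j. unfold H. rewrite <- kern_scale.
    - rewrite mult_INR, <- Rmult_assoc. do 2 f_equal. ring.
    - apply two_pi_nat_pos.
    - apply lt_0_INR; lia. }
  apply (is_lim_seq_ext (fun X => rsum (fun N => divsum H (S N)) X
     + rsum (fun i => rsum (fun j => if Nat.leb (S i * S j) X then 0 else H (S i) (S j)) X) X)).
  { intros X. rewrite rsum_divsum, <- rsum_plus. apply rsum_ext. intros i _.
    rewrite <- rsum_plus. apply rsum_ext. intros j _. rewrite HE.
    destruct (Nat.leb (S i * S j) X); lra. }
  rewrite <- (Rplus_0_r (kernser p b Y)). apply is_lim_seq_plus'; [exact L1|].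
  apply is_lim_seq_abs_0. apply is_lim_seq_incr_1.
  apply (is_lim_seq_le_le (fun _ => 0) _ (fun X => M / INR (S X))).
  - intros X. split; [apply Rabs_pos|].
    eapply Rle_trans; [apply rsum_abs|].
    assert (HX : 0 < INR (S X)) by (apply lt_0_INR; lia).
    apply Rle_trans with (rsum (fun i => rsum (fun j => M / INR (S X) ^ 3) (S X)) (S X)).
    + apply rsum_le. intros i _. eapply Rle_trans; [apply rsum_abs|].
      apply rsum_le. intros j _.
      assert (0 < INR (S X) ^ 3) by now apply pow_lt.
      destruct (Nat.leb_spec (S i * S j) (S X)).
      * rewrite Rabs_R0. apply Rdiv_le_0_compat; lra.
      * eapply Rle_trans; [apply HH|]. apply Rmult_le_compat_l; [easy|].
        apply Rinv_le_contravar; [easy|]. apply pow_incr.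
        split; [apply pos_INR|apply le_INR; lia].
    + rewrite !rsum_const. right. field. lra.
  - apply is_lim_seq_const.
  - apply (is_lim_seq_ext (fun X => M * / INR (S X))); [easy|].
    replace (Finite 0) with (Rbar_mult M 0) by (simpl; f_equal; ring).
    apply is_lim_seq_scal_l.
    exact is_lim_seq_inv_INR_S.
Qed.

Lemma is_RInt_gen_balanced p c (u : nat -> nat -> R) (B : R) :
  (forall m n, Rabs (u m n) <= B) ->
  let v := fun i j => u (S i) (S j) in
  doubly_balanced c v ->
  exists V : R,
  is_lim_seq (rsum (fun i => row_mean c v i * kern p (2 * PI * INR (S i)) 0)) V /\
  is_RInt_gen (fun y => y ^ p *
      expser (fun N => divsum (fun m n => u m n * INR n ^ (p + 1)) (S N)) y)
    (at_right 0) (Rbar_locally p_infty) V.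
Proof.
  intros HB v Hv. assert (Hc : c <> O) by apply Hv.
  destruct (square_sums_limit p c v Hv) as (V & HV & Hlim).
  exists V. split; [exact HV|]. apply is_RInt_gen_expser.
  - now apply divsum_poly_bounded with B.
  - intros P [eps HP]. destruct (Hlim eps (cond_pos eps)) as (d & Hd & H).
    exists (mkposreal d Hd). intros y Hy Hy0. apply HP.
    apply (H y).
    + change (Rabs (y - 0) < d) in Hy. rewrite Rminus_0_r, Rabs_pos_eq in Hy; lra.
    (* Only sides that are multiples of the period occur in [square_sums_limit]. *)
    + apply (is_lim_seq_subseq (fun X => rsum (fun i => rsum (fun j =>
          v i j * kern p (2 * PI * INR (S i)) (INR (S j) * y)) X) X) _ (fun q => (q * c)%nat)).
      * apply eventually_subseq. intros n. nia.
      * now apply (kernser_square_sums p u B y).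
Qed.

(** * Characters twisted by additive characters *)

(** The free phase treats both components of an additive character at once: [phi = 0] gives the
    cosine, [phi = - PI / 2] the sine. *)
Definition trig_term (g : nat -> R) (alpha phi : R) (j : nat) : R :=
  g (S j) * cos (alpha * INR (S j) + phi).

Lemma cos_add_two_pi_Z x k : cos (x + 2 * PI * IZR k) = cos x.
Proof.
  rewrite cos_plus.
  assert (E : cos (2 * PI * IZR k) = 1 /\ sin (2 * PI * IZR k) = 0).
  { assert (Hs : sin (PI * IZR k) = 0) by (apply sin_eq_0_1; exists k; ring).
    replace (2 * PI * IZR k) with (2 * (PI * IZR k)) by ring.
    rewrite cos_2a_sin, sin_2a, Hs. lra. }
  destruct E as [-> ->]. lra.
Qed.

Section TrigSums.

Variables (g : nat -> R) (q c : nat) (alpha : R) (k : Z).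
Hypothesis Hg : periodic q g.
Hypothesis Hqc : Nat.divide q c.
Hypothesis Hc : c <> O.
Hypothesis Halpha : alpha * INR c = 2 * PI * IZR k.
Hypothesis Hsin : sin (alpha * INR q / 2) <> 0.

Lemma trig_term_periodic phi : periodic c (trig_term g alpha phi).
Proof.
  intros j. unfold trig_term. destruct Hqc as [r ->].
  rewrite <- Nat.add_succ_l, (periodic_mul q g r Hg). f_equal.
  rewrite plus_INR.
  replace (alpha * (INR (S j) + INR (r * q)) + phi)
    with (alpha * INR (S j) + phi + alpha * INR (r * q)) by ring.
  rewrite Halpha. apply cos_add_two_pi_Z.
Qed.

(** Real form of multiplying a sum of [g(n) e(n theta)] by [1 - e(q theta)]: since [g] has period
    [q], shifting by [q] only advances the angle by [alpha q], and [2 sin(beta) cos(y) = sin(y +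
    beta) - sin(y - beta)] with [beta = alpha q / 2]. *)
Lemma trig_psum_shift phi n :
  let phi' := phi - alpha * INR q / 2 + PI / 2 in
  2 * sin (alpha * INR q / 2) * rsum (trig_term g alpha phi) n
  = rsum (trig_term g alpha phi') n
    - (rsum (trig_term g alpha phi') (n + q) - rsum (trig_term g alpha phi') q).
Proof.
  intros phi'. rewrite (Nat.add_comm n q), rsum_app. unfold Rminus at 2.
  rewrite Rplus_comm with (r1 := rsum _ q), Rplus_assoc, Rplus_opp_r, Rplus_0_r.
  rewrite <- rsum_scal, <- rsum_minus. apply rsum_ext. intros j _. unfold trig_term.
  replace (S (q + j)) with (S j + q)%nat by lia. rewrite (Hg (S j)), plus_INR.
  set (beta := alpha * INR q / 2) in *. set (x := alpha * INR (S j)).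
  replace (alpha * (INR (S j) + INR q) + phi') with (x + phi + beta + PI / 2)
    by (unfold x, phi', beta; field).
  replace (x + phi') with (x + phi - beta + PI / 2) by (unfold phi'; ring).
  assert (E : forall y, cos (y + PI / 2) = - sin y).
  { intros y. rewrite cos_plus, cos_PI2, sin_PI2. ring. }
  rewrite !E, sin_plus, sin_minus. ring.
Qed.

Lemma trig_sum_zero phi : rsum (trig_term g alpha phi) c = 0.
Proof.
  pose proof (trig_psum_shift phi c) as H. cbv zeta in H.
  set (phi' := phi - alpha * INR q / 2 + PI / 2) in H.
  assert (E : rsum (trig_term g alpha phi') (c + q)
     = rsum (trig_term g alpha phi') c + rsum (trig_term g alpha phi') q).
  { rewrite rsum_app. f_equal. apply rsum_ext. intros j _.
    rewrite Nat.add_comm. apply trig_term_periodic. }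
  rewrite E in H. assert (H0 : 2 * sin (alpha * INR q / 2)
    * rsum (trig_term g alpha phi) c = 0) by lra.
  apply Rmult_integral in H0. destruct H0 as [H0|H0]; [lra|easy].
Qed.

(** Averaging [trig_psum_shift] over a period cancels the two moving partial sums. What is left has
    [q] terms and no trace of [c], so row means at cusps of different denominators become
    comparable. *)
Lemma trig_mean_closed phi :
  / INR c * rsum (fun j => rsum (trig_term g alpha phi) (S j)) c
  = rsum (trig_term g alpha (phi - alpha * INR q / 2 + PI / 2)) q
    / (2 * sin (alpha * INR q / 2)).
Proof.
  set (phi' := phi - alpha * INR q / 2 + PI / 2).
  assert (Hc' : INR c <> 0) by now apply not_0_INR.
  assert (E : 2 * sin (alpha * INR q / 2)
      * rsum (fun j => rsum (trig_term g alpha phi) (S j)) c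
    = INR c * rsum (trig_term g alpha phi') q).
  { rewrite <- rsum_scal.
    rewrite (rsum_ext _ (fun j => (rsum (trig_term g alpha phi') (S j)
       - rsum (trig_term g alpha phi') (S j + q)) + rsum (trig_term g alpha phi') q)).
    2:{ intros j _. rewrite trig_psum_shift. fold phi'. ring. }
    rewrite rsum_plus, rsum_const, rsum_minus.
    pose proof (rsum_periodic_zero c _ (trig_term_periodic phi') (trig_sum_zero phi')) as HP.
    rewrite (rsum_periodic_shift c (rsum (trig_term g alpha phi')) 1 HP
      : rsum (fun j => rsum (trig_term g alpha phi') (S j)) c = _).
    rewrite (rsum_ext (fun j => rsum (trig_term g alpha phi') (S j + q))
        (fun j => rsum (trig_term g alpha phi') (S q + j)%nat))
      by (intros i _; replace (S q + i)%nat with (S i + q)%nat by lia; reflexivity).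
    rewrite (rsum_periodic_shift c _ (S q) HP). ring. }
  apply (Rmult_eq_reg_l (2 * sin (alpha * INR q / 2) * INR c)).
  - rewrite <- Rmult_assoc, (Rmult_assoc _ (INR c)), Rinv_r, Rmult_1_r, E by easy.
    field. easy.
  - repeat apply Rmult_integral_contrapositive_currified; auto; lra.
Qed.

End TrigSums.

Definition character (q : Z) (chi : Z -> Z) : Prop :=
  (1 < q)%Z /\ chi 1%Z = 1%Z /\ (forall m n, chi (m * n)%Z = (chi m * chi n)%Z) /\
  (forall n r, chi (n + r * q)%Z = chi n) /\
  (forall n, chi n <> 0%Z -> Z.gcd n q = 1%Z) /\
  (forall n, chi n = 0%Z \/ chi n = 1%Z \/ chi n = (-1)%Z).

Lemma prim_quad_char_character q chi : prim_quad_char q chi -> character q chi.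
Proof.
  intros [[(Hq & H1 & Hm & Hp & Hg) [Hv [n Hn]]] _].
  assert (Hp1 : forall r : nat, forall n, chi (n + Z.of_nat r * q)%Z = chi n).
  { induction r as [|r IH]; intros n0; [f_equal; lia|].
    replace (n0 + Z.of_nat (S r) * q)%Z with (n0 + Z.of_nat r * q + q)%Z by lia.
    now rewrite Hp. }
  assert (Hp2 : forall n r, chi (n + r * q)%Z = chi n).
  { intros n0 r. destruct (Z_le_dec 0 r).
    - rewrite <- (Hp1 (Z.to_nat r) n0). f_equal. lia.
    - rewrite <- (Hp1 (Z.to_nat (- r)) (n0 + r * q)%Z). f_equal. lia. }
  repeat split; auto.
  (* With modulus 1 periodicity makes [chi] constantly 1, against the value -1. *)
  - destruct (Z.eq_dec q 1) as [->|]; [|lia]. exfalso.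
    specialize (Hp2 1%Z (n - 1)%Z). replace (1 + (n - 1) * 1)%Z with n in Hp2 by lia.
    rewrite Hn, H1 in Hp2. lia.
  - intros n0 H. destruct (Z.eq_dec (Z.gcd n0 q) 1) as [|E]; [easy|].
    apply Hg in E. contradiction.
Qed.

Lemma character_abs q chi n : character q chi -> Rabs (IZR (chi n)) <= 1.
Proof.
  intros (_ & _ & _ & _ & _ & Hv). destruct (Hv n) as [-> | [-> | ->]];
    apply Rabs_le; lra.
Qed.

Lemma character_periodic q chi : character q chi ->
  periodic (Z.to_nat q) (fun n => IZR (chi (Z.of_nat n))).
Proof.
  intros (Hq & _ & _ & Hp & _) n. f_equal.
  rewrite <- (Hp (Z.of_nat n) 1%Z). f_equal. lia.
Qed.

(** [a / c] in lowest terms, equivalent to infinity under [Gamma_0(q1 q2)]. *)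
Definition cusp_fraction (q1 q2 a c : Z) : Prop :=
  (0 < c)%Z /\ Z.gcd a c = 1%Z /\ (q1 * q2 | c)%Z.

Lemma cusp_fraction_comm q1 q2 a c : cusp_fraction q1 q2 a c -> cusp_fraction q2 q1 a c.
Proof. unfold cusp_fraction. now rewrite (Z.mul_comm q1 q2). Qed.

(** As [q1 q2] divides [c], the divisibility would give [q1 | m a]; since [a] is prime to [q1], then
    [q1 | m], against [chi1 m <> 0]. Hence a shift by [q2] rotates [e(m n a / c)] nontrivially,
    which is what gives the rows mean zero. *)
Lemma cusp_fraction_mod q1 q2 chi1 a c m :
  character q1 chi1 -> cusp_fraction q1 q2 a c -> chi1 m <> 0%Z ->
  ~ (c | q2 * m * a)%Z.
Proof.
  intros (Hq & _ & _ & _ & Hg & _) (Hc & Hac & [c' Hc']) Hm [r Hr].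
  specialize (Hg m Hm).
  assert (Hq2 : (q2 <> 0)%Z) by nia.
  assert (E : (m * a = r * c' * q1)%Z) by (apply (Z.mul_reg_l _ _ q2); [easy|nia]).
  assert (Ha : Z.gcd q1 a = 1%Z).
  { apply Zgcd_1_rel_prime. apply rel_prime_div with c; [|exists (c' * q2)%Z; lia].
    apply rel_prime_sym. now apply Zgcd_1_rel_prime. }
  assert (Hd : (q1 | m)%Z).
  { apply (Z.gauss q1 a m); [|easy]. exists (r * c')%Z. lia. }
  apply Z.divide_gcd_iff in Hd; [|lia]. rewrite Z.gcd_comm in Hd. lia.
Qed.

Lemma cusp_fraction_sin q1 q2 chi1 a c m :
  character q1 chi1 -> cusp_fraction q1 q2 a c -> chi1 m <> 0%Z ->
  sin (PI * (IZR (q2 * m * a) / IZR c)) <> 0.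
Proof.
  intros H1 Hac Hm H0. apply (cusp_fraction_mod q1 q2 chi1 a c m H1 Hac Hm).
  assert (Hc : IZR c <> 0) by (apply not_0_IZR; destruct Hac; lia).
  apply sin_eq_0_0 in H0. destruct H0 as [r Hr]. exists r. apply eq_IZR.
  rewrite (mult_IZR r c). apply (Rmult_eq_reg_l (PI / IZR c)).
  - replace (PI / IZR c * (IZR r * IZR c)) with (IZR r * PI) by (field; easy).
    rewrite <- Hr. field; easy.
  - apply Rmult_integral_contrapositive_currified; [apply PI_neq0|now apply Rinv_neq_0_compat].
Qed.

Definition twist (chi1 chi2 : Z -> Z) (x phi : R) (m n : nat) : R :=
  IZR (chi1 (Z.of_nat m)) * IZR (chi2 (Z.of_nat n)) * cos (2 * PI * x * INR m * INR n + phi).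

Definition twist0 (chi1 chi2 : Z -> Z) (x phi : R) (i j : nat) : R :=
  twist chi1 chi2 x phi (S i) (S j).

Lemma twist_comm chi1 chi2 x phi m n : twist chi1 chi2 x phi m n = twist chi2 chi1 x phi n m.
Proof.
  unfold twist. rewrite (Rmult_comm (IZR (chi1 _))). do 2 f_equal. ring.
Qed.

Lemma twist0_trig chi1 chi2 x phi i j :
  twist0 chi1 chi2 x phi i j = IZR (chi1 (Z.of_nat (S i)))
    * trig_term (fun n => IZR (chi2 (Z.of_nat n))) (2 * PI * x * INR (S i)) phi j.
Proof. unfold twist0, twist, trig_term. ring. Qed.

Lemma rsum_twist0 chi1 chi2 x phi i n :
  rsum (twist0 chi1 chi2 x phi i) n = IZR (chi1 (Z.of_nat (S i)))
    * rsum (trig_term (fun n => IZR (chi2 (Z.of_nat n))) (2 * PI * x * INR (S i)) phi) n.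
Proof. rewrite <- rsum_scal. apply rsum_ext. intros; apply twist0_trig. Qed.

Section Twists.

Variables (q1 q2 : Z) (chi1 chi2 : Z -> Z).
Hypotheses (H1 : character q1 chi1) (H2 : character q2 chi2).

Lemma cusp_fraction_data a c m : cusp_fraction q1 q2 a c ->
  let x := IZR a / IZR c in
  let alpha := 2 * PI * x * INR m in
  Z.to_nat c <> O /\ Nat.divide (Z.to_nat q2) (Z.to_nat c) /\
  alpha * INR (Z.to_nat c) = 2 * PI * IZR (Z.of_nat m * a) /\
  alpha * INR (Z.to_nat q2) / 2 = PI * (IZR (q2 * Z.of_nat m * a) / IZR c).
Proof.
  intros (Hc & Hac & [c' Hc']) x alpha.
  assert (Hq1 : (1 < q1)%Z) by apply H1. assert (Hq2 : (1 < q2)%Z) by apply H2.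
  assert (Hc0 : IZR c <> 0) by (apply not_0_IZR; lia).
  repeat split.
  - lia.
  - exists (Z.to_nat (c' * q1)). rewrite <- Z2Nat.inj_mul by nia. f_equal. lia.
  - unfold alpha, x. rewrite !INR_IZR_INZ, Z2Nat.id by lia. rewrite mult_IZR. field. easy.
  - unfold alpha, x. rewrite !INR_IZR_INZ, Z2Nat.id by lia. rewrite !mult_IZR. field. easy.
Qed.

Lemma twist0_row_zero a c phi i : cusp_fraction q1 q2 a c ->
  rsum (twist0 chi1 chi2 (IZR a / IZR c) phi i) (Z.to_nat c) = 0.
Proof.
  intros Hac. rewrite rsum_twist0.
  destruct (Z.eq_dec (chi1 (Z.of_nat (S i))) 0) as [->|Hi]; [lra|].
  destruct (cusp_fraction_data a c (S i) Hac) as (D1 & D2 & D3 & D4).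
  rewrite (trig_sum_zero _ (Z.to_nat q2) _ _ _ (character_periodic _ _ H2) D2 D1 D3); [lra|].
  rewrite D4. now apply cusp_fraction_sin with q1 chi1.
Qed.

Lemma twist0_row_periodic a c phi i : cusp_fraction q1 q2 a c ->
  periodic (Z.to_nat c) (twist0 chi1 chi2 (IZR a / IZR c) phi i).
Proof.
  intros Hac j. rewrite !twist0_trig.
  destruct (cusp_fraction_data a c (S i) Hac) as (D1 & D2 & D3 & D4).
  now rewrite (trig_term_periodic _ (Z.to_nat q2) _ _ _ (character_periodic _ _ H2) D2 D1 D3).
Qed.

Lemma row_mean_twist0 a c phi i : cusp_fraction q1 q2 a c ->
  chi1 (Z.of_nat (S i)) <> 0%Z ->
  let alpha := 2 * PI * (IZR a / IZR c) * INR (S i) in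
  let beta := alpha * INR (Z.to_nat q2) / 2 in
  sin beta <> 0 /\
  row_mean (Z.to_nat c) (twist0 chi1 chi2 (IZR a / IZR c) phi) i
  = IZR (chi1 (Z.of_nat (S i)))
    * (rsum (trig_term (fun n => IZR (chi2 (Z.of_nat n))) alpha (phi - beta + PI / 2))
        (Z.to_nat q2) / (2 * sin beta)).
Proof.
  intros Hac Hi alpha beta.
  destruct (cusp_fraction_data a c (S i) Hac) as (D1 & D2 & D3 & D4).
  assert (Hs : sin beta <> 0).
  { unfold beta, alpha. rewrite D4. now apply cusp_fraction_sin with q1 chi1. }
  split; [exact Hs|].
  unfold beta. rewrite <- (trig_mean_closed _ _ (Z.to_nat c) alpha _
    (character_periodic _ _ H2) D2 D1 D3 Hs).
  unfold row_mean. rewrite (rsum_ext _ _ _ (fun j _ => rsum_twist0 _ _ _ _ i (S j))).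
  rewrite rsum_scal. fold alpha. ring.
Qed.

End Twists.

(** The columns are rows for the exchanged pair of characters, and [cusp_fraction] is symmetric in
    [q1] and [q2]. *)
Lemma twist0_balanced q1 q2 chi1 chi2 a c phi :
  character q1 chi1 -> character q2 chi2 -> cusp_fraction q1 q2 a c ->
  doubly_balanced (Z.to_nat c) (twist0 chi1 chi2 (IZR a / IZR c) phi).
Proof.
  intros H1 H2 Hac. pose proof (cusp_fraction_comm _ _ _ _ Hac) as Hac'.
  repeat split.
  - destruct Hac; lia.
  - intros i. now apply twist0_row_periodic with q1 q2.
  - intros j i. unfold twist0. rewrite !(twist_comm chi1).
    now apply (twist0_row_periodic q2 q1 chi2 chi1 H2 H1 a c phi j).
  - intros i. now apply twist0_row_zero with q1 q2.
  - intros j. rewrite (rsum_ext _ (twist0 chi2 chi1 (IZR a / IZR c) phi j)).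
    + now apply twist0_row_zero with q2 q1.
    + intros i _. apply twist_comm.
Qed.

Lemma twist_abs q1 q2 chi1 chi2 x phi m n :
  character q1 chi1 -> character q2 chi2 -> Rabs (twist chi1 chi2 x phi m n) <= 1.
Proof.
  intros H1 H2. unfold twist. rewrite !Rabs_mult.
  pose proof (character_abs q1 chi1 (Z.of_nat m) H1).
  pose proof (character_abs q2 chi2 (Z.of_nat n) H2).
  pose proof (COS_bound (2 * PI * x * INR m * INR n + phi)).
  assert (Rabs (cos (2 * PI * x * INR m * INR n + phi)) <= 1) by (apply Rabs_le; lra).
  pose proof (Rabs_pos (IZR (chi1 (Z.of_nat m)))).
  pose proof (Rabs_pos (IZR (chi2 (Z.of_nat n)))).
  pose proof (Rabs_pos (cos (2 * PI * x * INR m * INR n + phi))).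
  assert (Rabs (IZR (chi1 (Z.of_nat m))) * Rabs (IZR (chi2 (Z.of_nat n))) <= 1) by nra.
  nra.
Qed.

(** * The integral at a cusp as a convergent series *)

Lemma fold_right_Cplus_RtoC (f : nat -> C) (g : nat -> R) n :
  (forall i, f (S i) = RtoC (g i)) ->
  fold_right Cplus (RtoC 0) (map f (seq 1 n)) = RtoC (rsum g n).
Proof.
  intros H. induction n as [|n IH]; [easy|].
  rewrite seq_S, map_app, fold_right_app. cbn [map fold_right rsum Nat.add].
  rewrite H, RtoC_plus, <- IH.
  set (l := map f (seq 1 n)). clearbody l. clear.
  replace (RtoC (g n) + RtoC 0)%C with (RtoC (g n)) by (rewrite <- RtoC_plus; f_equal; ring).
  induction l as [|z l IH]; cbn [fold_right]; [now rewrite Cplus_0_l|].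
  rewrite IH. apply Cplus_assoc.
Qed.

Definition eis_coef (chi1 chi2 : Z -> Z) (p N : nat) : R :=
  divsum (fun m n => IZR (chi1 (Z.of_nat m)) * IZR (chi2 (Z.of_nat n)) * INR n ^ (p + 1)) N.

Lemma E_coeff_real chi1 chi2 k N :
  (2 <= k)%nat -> E_coeff chi1 chi2 k N = RtoC (eis_coef chi1 chi2 (k - 2) N).
Proof.
  intros Hk. apply fold_right_Cplus_RtoC. intros i.
  destruct (Nat.eqb (N mod S i) 0); [|easy].
  unfold chiC. replace (k - 1)%nat with (k - 2 + 1)%nat by lia.
  replace (Cconj (RtoC (IZR (chi2 (Z.of_nat (N / S i))))))
    with (RtoC (IZR (chi2 (Z.of_nat (N / S i)))))
    by (unfold Cconj, RtoC; simpl; f_equal; ring).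
  now rewrite <- !RtoC_mult.
Qed.

Lemma twist_divsum chi1 chi2 x phi p N :
  divsum (fun m n => twist chi1 chi2 x phi m n * INR n ^ (p + 1)) N
  = eis_coef chi1 chi2 p N * cos (2 * PI * x * INR N + phi).
Proof.
  unfold eis_coef. rewrite <- divsum_scal. apply divsum_ext. intros m n <-.
  unfold twist. rewrite mult_INR, <- (Rmult_assoc _ (INR m)). ring.
Qed.

Definition fourier (chi1 chi2 : Z -> Z) (p : nat) (x phi : R) : R -> R :=
  expser (fun N => divsum (fun m n => twist chi1 chi2 x phi m n * INR n ^ (p + 1)) (S N)).

Lemma Eis_fourier chi1 chi2 k x y : (2 <= k)%nat ->
  Eis chi1 chi2 k (x, y) =
  (2 * (fourier chi1 chi2 (k - 2) x 0 y, fourier chi1 chi2 (k - 2) x (- (PI / 2)) y))%C.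
Proof.
  intros Hk. unfold Eis, CSeries. f_equal. unfold fourier, expser.
  assert (E : forall n, (E_coeff chi1 chi2 k (S n) * e (RtoC (INR (S n)) * (x, y)))%C =
    (eis_coef chi1 chi2 (k - 2) (S n) * (exp (- (2 * PI * INR (S n) * y))
       * cos (2 * PI * x * INR (S n))),
     eis_coef chi1 chi2 (k - 2) (S n) * (exp (- (2 * PI * INR (S n) * y))
       * sin (2 * PI * x * INR (S n))))).
  { intros n. rewrite E_coeff_real by easy. unfold e, RtoC, Cmult, Re, Im.
    cbn [fst snd].
    replace (2 * PI * (INR (S n) * x - 0 * y)) with (2 * PI * x * INR (S n)) by ring.
    replace (-2 * PI * (INR (S n) * y + 0 * x)) with (- (2 * PI * INR (S n) * y)) by ring.
    f_equal; ring. }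
  f_equal; apply Series_ext; intros n; rewrite E, twist_divsum; cbn [Re Im fst snd].
  - rewrite Rplus_0_r. ring.
  - replace (2 * PI * x * INR (S n) + - (PI / 2)) with (2 * PI * x * INR (S n) - PI / 2) by ring.
    rewrite cos_minus, cos_PI2, sin_PI2. ring.
Qed.

Lemma Ppoly_vertical k x y :
  Ppoly k (x, y) (RtoC 1) (RtoC (- x)) = (Cpow Ci (k - 2) * RtoC (y ^ (k - 2)))%C.
Proof.
  unfold Ppoly. rewrite RtoC_pow, <- Cpow_mult_l. f_equal.
  unfold Ci, RtoC, Cmult, Cplus; simpl. f_equal; ring.
Qed.

(** By [kern_at_0] the weights are [p! / (2 pi m)^(p+1)] with [m = i + 1]; the factor [chi1(m)] sits
    inside [row_mean]. *)
Definition cusp_limit (chi1 chi2 : Z -> Z) (p : nat) (a c : Z) (phi V : R) : Prop :=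
  is_lim_seq (rsum (fun i => row_mean (Z.to_nat c) (twist0 chi1 chi2 (IZR a / IZR c) phi) i
    * kern p (2 * PI * INR (S i)) 0)) V.

Definition Shat_const (chi1 : Z -> Z) (q1 : Z) (k : nat) : C :=
  (RtoC ((-1) ^ k) * gauss_sum q1 (fun n => Cconj (chiC chi1 n)) * RtoC (INR k - 1)
   * (- Ci * (2 * Cpow Ci (k - 2))))%C.

Lemma Shat_fin_formula chi1 chi2 q1 q2 k a c :
  (2 <= k)%nat -> character q1 chi1 -> character q2 chi2 -> cusp_fraction q1 q2 a c ->
  exists V0 V1, cusp_limit chi1 chi2 (k - 2) a c 0 V0 /\
    cusp_limit chi1 chi2 (k - 2) a c (- (PI / 2)) V1 /\
    Shat_fin chi1 chi2 q1 k (IZR a / IZR c) = (Shat_const chi1 q1 k * (V0, V1))%C.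
Proof.
  intros Hk H1 H2 Hac. set (p := (k - 2)%nat). set (x := IZR a / IZR c).
  assert (HV : forall phi, exists V, cusp_limit chi1 chi2 p a c phi V /\
    is_RInt_gen (fun y => y ^ p * fourier chi1 chi2 p x phi y)
      (at_right 0) (Rbar_locally p_infty) V).
  { intros phi. apply (is_RInt_gen_balanced p (Z.to_nat c) (twist chi1 chi2 x phi) 1).
    - intros m n. now apply twist_abs with q1 q2.
    - now apply twist0_balanced with q1 q2. }
  destruct (HV 0) as (V0 & L0 & I0). destruct (HV (- (PI / 2))) as (V1 & L1 & I1).
  exists V0, V1. split; [exact L0|]. split; [exact L1|].
  set (f0 := fun y => y ^ p * fourier chi1 chi2 p x 0 y) in *.
  set (f1 := fun y => y ^ p * fourier chi1 chi2 p x (- (PI / 2)) y) in *.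
  unfold Shat_fin, int_from_infty.
  (* The factor [i^p] comes from [z - x = i y]. In coordinates, multiplication by it is a real
     combination of the two convergent integrals. *)
  destruct (2 * Cpow Ci p)%C as [al be] eqn:Ec.
  assert (EI : is_RInt_gen (V := C_R_CompleteNormedModule)
    (fun y => (Eis chi1 chi2 k (x, y) * Ppoly k (x, y) (RtoC 1) (RtoC (- x)))%C)
    (at_right 0) (Rbar_locally p_infty) ((2 * Cpow Ci p) * (V0, V1))%C).
  { apply (is_RInt_gen_ext (V := C_R_NormedModule)
      (fun y => (al * f0 y - be * f1 y, al * f1 y + be * f0 y))).
    - apply filter_forall. intros ab y _. rewrite Eis_fourier, Ppoly_vertical by easy.
      fold p. set (z := (fourier _ _ _ _ _ _, _)).
      replace (2 * z * (Ci ^ p * RtoC (y ^ p)))%C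
        with ((2 * Ci ^ p) * (RtoC (y ^ p) * z))%C by ring.
      rewrite Ec. unfold z, f0, f1, Cmult, RtoC; cbn [fst snd]. f_equal; ring.
    - rewrite Ec. unfold Cmult; cbn [fst snd].
      apply (is_RInt_gen_pair (at_right 0) (Rbar_locally p_infty)).
      + apply (is_RInt_gen_minus (V := R_NormedModule) (fun y => al * f0 y) (fun y => be * f1 y));
          now apply (is_RInt_gen_scal (V := R_NormedModule)).
      + apply (is_RInt_gen_plus (V := R_NormedModule) (fun y => al * f1 y) (fun y => be * f0 y));
          now apply (is_RInt_gen_scal (V := R_NormedModule)). }
  apply is_RInt_gen_unique in EI. rewrite EI. unfold Shat_const. fold p. ring.
Qed.

(** * The sawtooth series *)

Lemma cos_progression_sum y j (q : nat) : q <> O ->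
  rsum (fun l => cos (y + 2 * PI * IZR j * INR l / INR q)) q
  = if Zdivide_dec (Z.of_nat q) j then INR q * cos y else 0.
Proof.
  intros Hq. assert (Hq' : INR q <> 0) by now apply not_0_INR.
  destruct (Zdivide_dec (Z.of_nat q) j) as [[r Hr]|Hn].
  - rewrite <- rsum_const. apply rsum_ext. intros l _.
    rewrite <- (cos_add_two_pi_Z y (r * Z.of_nat l)). f_equal.
    rewrite Hr, !mult_IZR, <- !INR_IZR_INZ. field. easy.
  - set (beta := PI * IZR j / INR q).
    assert (Hs : sin beta <> 0).
    { intros H0. apply Hn. apply sin_eq_0_0 in H0. destruct H0 as [r Hr].
      exists r. apply eq_IZR. rewrite mult_IZR, <- INR_IZR_INZ.
      apply (Rmult_eq_reg_l (PI / INR q)).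
      - replace (PI / INR q * (IZR r * INR q)) with (IZR r * PI) by (field; easy).
        rewrite <- Hr. unfold beta. field; easy.
      - apply Rmult_integral_contrapositive_currified;
          [apply PI_neq0|now apply Rinv_neq_0_compat]. }
    apply (Rmult_eq_reg_l (2 * sin beta)); [|lra].
    rewrite <- rsum_scal, Rmult_0_r.
    rewrite (rsum_ext _ (fun l => - sin (y + 2 * beta * INR l - beta)
       - - sin (y + 2 * beta * INR (S l) - beta))).
    + rewrite (rsum_telescope (fun l => - sin (y + 2 * beta * INR l - beta))).
      replace (y + 2 * beta * INR q - beta) with
        (y + 2 * beta * INR 0 - beta + 2 * PI * IZR j)
        by (unfold beta; simpl; field; easy).
      rewrite <- !(cos_shift (_ - _)), <- (cos_shift (_ + 2 * PI * IZR j)).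
      set (z := y + 2 * beta * INR 0 - beta).
      replace (PI / 2 - (z + 2 * PI * IZR j)) with (PI / 2 - z + 2 * PI * IZR (- j))
        by (rewrite opp_IZR; ring).
      rewrite cos_add_two_pi_Z. ring.
    + intros l _. rewrite S_INR.
      replace (y + 2 * PI * IZR j * INR l / INR q) with (y + 2 * beta * INR l)
        by (unfold beta; field; easy).
      set (z := y + 2 * beta * INR l).
      replace (y + 2 * beta * (INR l + 1) - beta) with (z + beta) by (unfold z; ring).
      rewrite sin_plus, sin_minus. ring.
Qed.

Lemma rsum_residue (h : Z -> R) (z : Z) (q : nat) : q <> O ->
  rsum (fun s => h (Z.of_nat s)
    * (if Zdivide_dec (Z.of_nat q) (Z.of_nat s + z) then 1 else 0)) q
  = h ((- z) mod Z.of_nat q)%Z.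
Proof.
  intros Hq.
  pose proof (Z.mod_pos_bound (- z) (Z.of_nat q) ltac:(lia)) as Hb.
  set (r := ((- z) mod Z.of_nat q)%Z) in *.
  assert (Hr : (Z.of_nat q | r + z)%Z).
  { pose proof (Z.div_mod (- z) (Z.of_nat q) ltac:(lia)) as E. fold r in E.
    exists (- (- z / Z.of_nat q))%Z. lia. }
  rewrite (rsum_single _ _ (Z.to_nat r)).
  - rewrite Z2Nat.id by lia. destruct (Zdivide_dec _ _); [ring|contradiction].
  - lia.
  - intros s Hs Hne. destruct (Zdivide_dec _ _) as [Hd|]; [|ring]. exfalso. apply Hne.
    assert (Hd' : (Z.of_nat q | Z.of_nat s - r)%Z).
    { replace (Z.of_nat s - r)%Z with (Z.of_nat s + z - (r + z))%Z by lia.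
      now apply Z.divide_sub_r. }
    destruct Hd' as [w Hw]. assert (w = 0)%Z by nia. lia.
Qed.

Lemma is_derive_rsum (f df : nat -> R -> R) n x :
  (forall i, is_derive (f i) x (df i x)) ->
  is_derive (fun y => rsum (fun i => f i y) n) x (rsum (fun i => df i x) n).
Proof.
  intros H. induction n as [|n IH]; simpl.
  - apply (is_derive_const (V := R_NormedModule)).
  - apply (is_derive_plus (V := R_NormedModule) (fun y => rsum (fun i => f i y) n)); auto.
Qed.

Lemma dirichlet_kernel x n :
  2 * sin (x / 2) * (/ 2 + rsum (fun i => cos (INR (S i) * x)) n)
  = sin ((INR n + / 2) * x).
Proof.
  induction n as [|n IH].
  - simpl. replace ((0 + / 2) * x) with (x / 2) by field. lra.
  - cbn [rsum]. rewrite <- Rplus_assoc, Rmult_plus_distr_l, IH.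
    replace ((INR n + / 2) * x) with (INR (S n) * x - x / 2) by (rewrite S_INR; field).
    replace ((INR (S n) + / 2) * x) with (INR (S n) * x + x / 2) by field.
    rewrite sin_plus, sin_minus. ring.
Qed.

(** The correction term makes the derivative of this function [O(1/n)]. *)
Definition sawtooth_aux (n : nat) (x : R) : R :=
  rsum (fun i => sin (INR (S i) * x) / INR (S i)) n + x / 2
  + cos ((INR n + / 2) * x) / ((2 * INR n + 1) * sin (x / 2)).

Lemma sawtooth_aux_derive n x : sin (x / 2) <> 0 ->
  is_derive (sawtooth_aux n) x
    (- (cos ((INR n + / 2) * x) * cos (x / 2))
     / (2 * (2 * INR n + 1) * sin (x / 2) ^ 2)).
Proof.
  intros Hs. pose proof (pos_INR n) as Hn.
  set (f := fun x => rsum (fun i => sin (INR (S i) * x) / INR (S i)) n).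
  assert (D1 : is_derive f x (rsum (fun i => cos (INR (S i) * x)) n)).
  { apply (is_derive_rsum (fun i x => sin (INR (S i) * x) / INR (S i))
      (fun i x => cos (INR (S i) * x))). intros i.
    assert (INR (S i) <> 0) by (apply not_0_INR; lia).
    set (m := INR (S i)) in *. clearbody m. auto_derive; [easy|field; easy]. }
  assert (E : rsum (fun i => cos (INR (S i) * x)) n
    = sin ((INR n + / 2) * x) / (2 * sin (x / 2)) - / 2).
  { rewrite <- dirichlet_kernel. field. easy. }
  unfold sawtooth_aux. change (is_derive (fun x => f x + x / 2
    + cos ((INR n + / 2) * x) / ((2 * INR n + 1) * sin (x / 2))) x
    (- (cos ((INR n + / 2) * x) * cos (x / 2)) / (2 * (2 * INR n + 1) * sin (x / 2) ^ 2))).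
  clearbody f. auto_derive.
  - split; [eexists; eassumption|]. split; [|easy].
    apply Rmult_integral_contrapositive_currified; [lra|exact Hs].
  - apply is_derive_unique in D1. change (fun x => f x) with f. rewrite D1, E.
    change (x * / 2) with (x / 2). field. split; [exact Hs|lra].
Qed.

(** At [x = PI] the function [sawtooth_aux n] equals [PI / 2] exactly. Between [PI] and [x] the
    value [sin (y / 2)] stays at least [sin (x / 2)], so the mean value theorem transports this
    value to [x] with error [O(1/n)]. *)
Lemma sawtooth_series x : 0 < x < 2 * PI ->
  is_lim_seq (rsum (fun i => sin (INR (S i) * x) / INR (S i))) ((PI - x) / 2).
Proof.
  intros Hx. set (s := sin (x / 2)).
  assert (Hs : 0 < s) by (apply sin_gt_0; lra).
  assert (Hmin : forall y, Rmin x PI <= y <= Rmax x PI -> s <= sin (y / 2)).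
  { intros y Hy. unfold s. destruct (Rle_dec x PI).
    - rewrite Rmin_left, Rmax_right in Hy by lra. apply sin_incr_1; lra.
    - rewrite Rmin_right, Rmax_left in Hy by lra. apply sin_decr_1; lra. }
  assert (Hpi : forall n, sawtooth_aux n PI = PI / 2).
  { intros n. unfold sawtooth_aux. rewrite rsum_zero.
    - replace ((INR n + / 2) * PI) with (PI / 2 - - (INR n * PI)) by field.
      rewrite cos_shift, sin_neg.
      replace (sin (INR n * PI)) with 0; [unfold Rdiv; ring|].
      symmetry. apply sin_eq_0_1. exists (Z.of_nat n). now rewrite <- INR_IZR_INZ.
    - intros i _. replace (sin (INR (S i) * PI)) with 0; [unfold Rdiv; ring|].
      symmetry. apply sin_eq_0_1. exists (Z.of_nat (S i)). now rewrite <- INR_IZR_INZ. }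
  assert (Hb : forall n,
    Rabs (rsum (fun i => sin (INR (S i) * x) / INR (S i)) n - (PI - x) / 2)
    <= (PI / s ^ 2 + / s) * / (INR n + 1)).
  { intros n. pose proof (pos_INR n) as Hn.
    destruct (MVT_gen (sawtooth_aux n) PI x (fun x =>
      - (cos ((INR n + / 2) * x) * cos (x / 2))
     / (2 * (2 * INR n + 1) * sin (x / 2) ^ 2))) as (y & Hy & E).
    { intros y Hy. apply sawtooth_aux_derive. rewrite Rmin_comm, Rmax_comm in Hy.
      specialize (Hmin y ltac:(lra)). lra. }
    { intros y Hy. apply continuity_pt_filterlim.
      apply (ex_derive_continuous (K := R_AbsRing) (V := R_NormedModule)).
      eexists. apply sawtooth_aux_derive. rewrite Rmin_comm, Rmax_comm in Hy.
      specialize (Hmin y ltac:(lra)). lra. }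
    rewrite Rmin_comm, Rmax_comm in Hy. specialize (Hmin y Hy). rewrite Hpi in E.
    set (w := cos ((INR n + / 2) * y) * cos (y / 2)) in *.
    assert (Hw : Rabs w <= 1).
    { unfold w. rewrite Rabs_mult. pose proof (COS_bound ((INR n + / 2) * y)).
      pose proof (COS_bound (y / 2)).
      rewrite <- (Rmult_1_r 1). apply Rmult_le_compat; auto using Rabs_pos; apply Rabs_le; lra. }
    set (z := cos ((INR n + / 2) * x)).
    assert (Hz : Rabs z <= 1).
    { unfold z. pose proof (COS_bound ((INR n + / 2) * x)). apply Rabs_le; lra. }
    replace (rsum _ n - (PI - x) / 2) with
      (- w / (2 * (2 * INR n + 1) * sin (y / 2) ^ 2) * (x - PI)
       + - z / ((2 * INR n + 1) * s)).
    2:{ rewrite <- E. unfold sawtooth_aux. fold z s. field. lra. }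
    assert (H1n : / (2 * INR n + 1) <= / (INR n + 1)) by (apply Rinv_le_contravar; lra).
    assert (H0n : 0 < / (2 * INR n + 1)) by (apply Rinv_0_lt_compat; lra).
    assert (Hs2 : 0 < s ^ 2) by (apply pow_lt; lra).
    assert (Hss : s ^ 2 <= sin (y / 2) ^ 2) by (apply pow_incr; lra).
    assert (His : / sin (y / 2) ^ 2 <= / s ^ 2) by (apply Rinv_le_contravar; lra).
    assert (His0 : 0 < / sin (y / 2) ^ 2) by (apply Rinv_0_lt_compat; lra).
    assert (Hs1 : 0 < / s) by now apply Rinv_0_lt_compat.
    pose proof PI_RGT_0 as HP.
    eapply Rle_trans; [apply Rabs_triang|].
    rewrite (Rmult_plus_distr_r (PI / s ^ 2) (/ s)).
    apply Rplus_le_compat.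
    - replace (- w / (2 * (2 * INR n + 1) * sin (y / 2) ^ 2) * (x - PI)) with
        (w * ((PI - x) / 2) * (/ sin (y / 2) ^ 2) * / (2 * INR n + 1)) by (field; lra).
      rewrite !Rabs_mult, (Rabs_pos_eq (/ _ ^ 2)), (Rabs_pos_eq (/ (2 * INR n + 1))) by lra.
      assert (Rabs ((PI - x) / 2) <= PI) by (apply Rabs_le; lra).
      unfold Rdiv at 2.
      apply Rmult_le_compat; try lra.
      + repeat apply Rmult_le_pos; try lra; apply Rabs_pos.
      + apply Rmult_le_compat; try lra.
        * apply Rmult_le_pos; apply Rabs_pos.
        * apply Rle_trans with (1 * PI); [|lra].
          apply Rmult_le_compat; auto using Rabs_pos.
    - replace (- z / ((2 * INR n + 1) * s)) with (- z * / s * / (2 * INR n + 1)) by (field; lra).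
      rewrite !Rabs_mult, Rabs_Ropp, (Rabs_pos_eq (/ s)), (Rabs_pos_eq (/ (2 * INR n + 1))) by lra.
      apply Rmult_le_compat; try lra.
      + apply Rmult_le_pos; [apply Rabs_pos|lra].
      + rewrite <- (Rmult_1_l (/ s)) at 2. apply Rmult_le_compat_r; lra. }
  set (K := PI / s ^ 2 + / s) in *.
  assert (HK : is_lim_seq (fun n => K * / (INR n + 1)) 0).
  { replace (Finite 0) with (Rbar_mult K 0) by (simpl; f_equal; ring).
    apply is_lim_seq_scal_l.
    apply (is_lim_seq_ext (fun n => / INR (S n))); [intros n; now rewrite S_INR|].
    exact is_lim_seq_inv_INR_S. }
  apply (is_lim_seq_ext (fun n => (PI - x) / 2
    + (rsum (fun i => sin (INR (S i) * x) / INR (S i)) n - (PI - x) / 2))); [intros; ring|].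
  replace (Finite ((PI - x) / 2)) with (Finite ((PI - x) / 2 + 0)) by (f_equal; ring).
  apply is_lim_seq_plus'; [apply is_lim_seq_const|].
  apply is_lim_seq_abs_0.
  apply (is_lim_seq_le_le (fun _ => 0) _ (fun n => K * / (INR n + 1))); auto.
  - intros n. split; [apply Rabs_pos|apply Hb].
  - apply is_lim_seq_const.
Qed.

(** * Weight two: a Dedekind sum reciprocity *)

Lemma character_multiple q chi n : character q chi -> (q | n)%Z -> chi n = 0%Z.
Proof.
  intros (Hq & _ & _ & _ & Hg & _) Hd. destruct (Z.eq_dec (chi n) 0) as [|Hn]; [easy|].
  specialize (Hg n Hn). apply Z.divide_gcd_iff in Hd; [|lia].
  rewrite Z.gcd_comm in Hd. lia.
Qed.

Lemma character_mod q chi m n : character q chi -> (q | m - n)%Z -> chi m = chi n.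
Proof.
  intros (_ & _ & _ & Hp & _) [r Hr]. rewrite <- (Hp n r). f_equal. lia.
Qed.

Lemma rsum_shift_1 h n : rsum (fun j => h (S j)) n = rsum h n + h n - h O.
Proof. induction n as [|n IH]; simpl in *; lra. Qed.

Lemma twist_multiple q chi1 chi2 x phi m n : character q chi2 -> (q | Z.of_nat n)%Z ->
  twist chi1 chi2 x phi m n = 0.
Proof.
  intros H Hd. unfold twist. rewrite (character_multiple q chi2 _ H Hd). ring.
Qed.

(** Summation by parts: for a sequence of sum zero over a period, the mean of the partial sums is
    minus the mean weighted by the position. Passing from [j] to [r = j + 1] is harmless because the
    end terms [r = 0] and [r = c] vanish, the latter by [q2 | c]. *)
Lemma row_mean_weighted q1 q2 chi1 chi2 a c phi i :
  character q1 chi1 -> character q2 chi2 -> cusp_fraction q1 q2 a c ->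
  row_mean (Z.to_nat c) (twist0 chi1 chi2 (IZR a / IZR c) phi) i
  = - / IZR c * rsum (fun r => INR r * twist chi1 chi2 (IZR a / IZR c) phi (S i) r)
      (Z.to_nat c).
Proof.
  intros H1 H2 Hac. set (x := IZR a / IZR c). set (n := Z.to_nat c).
  assert (Hc : (0 < c)%Z) by apply Hac.
  assert (Hn : INR n = IZR c) by (unfold n; rewrite INR_IZR_INZ, Z2Nat.id; [easy|lia]).
  set (t := twist0 chi1 chi2 x phi i).
  set (h := fun r => INR r * twist chi1 chi2 x phi (S i) r).
  assert (Z0 : rsum t n = 0) by now apply twist0_row_zero with q1 q2.
  unfold row_mean. fold t. rewrite Hn, Ropp_mult_distr_l_reverse, Ropp_mult_distr_r.
  f_equal. pose proof (rsum_abel t INR n) as E.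
  rewrite (rsum_ext (fun j => rsum t (S j) * (INR j - INR (S j)))
    (fun j => (-1) * rsum t (S j))), rsum_scal, Z0 in E
    by (intros; rewrite (S_INR i0); ring).
  assert (E1 : rsum (fun j => h (S j)) n = rsum (fun j => t j * INR j) n + rsum t n).
  { rewrite <- rsum_plus. apply rsum_ext. intros j _. unfold h, t, twist0.
    rewrite (S_INR j). ring. }
  rewrite rsum_shift_1 in E1.
  assert (Hh0 : h O = 0) by (unfold h; simpl; ring).
  assert (Hhn : h n = 0).
  { unfold h. rewrite (twist_multiple q2); [ring|easy|].
    unfold n. rewrite Z2Nat.id by lia. destruct Hac as (_ & _ & [w Hw]).
    exists (w * q1)%Z. lia. }
  lra.
Qed.

(** The substitution [r -> c - r] produces [chi2(-1)], and evenness of the cosine reverses the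
    phase. The weight becomes [c - r], whose constant part contributes zero. *)
Lemma twist_weighted_parity q1 q2 chi1 chi2 a c phi i :
  character q1 chi1 -> character q2 chi2 -> cusp_fraction q1 q2 a c ->
  rsum (fun r => INR r * twist chi1 chi2 (IZR a / IZR c) phi (S i) r) (Z.to_nat c)
  = - IZR (chi2 (-1)%Z)
    * rsum (fun r => INR r * twist chi1 chi2 (IZR a / IZR c) (- phi) (S i) r) (Z.to_nat c).
Proof.
  intros H1 H2 Hac. set (x := IZR a / IZR c).
  assert (Hc : (0 < c)%Z) by apply Hac.
  assert (Hd : (q2 | c)%Z).
  { destruct Hac as (_ & _ & [w Hw]). exists (w * q1)%Z. lia. }
  pose proof (twist0_row_zero q1 q2 chi1 chi2 H1 H2 a c (- phi) i Hac) as Z0. fold x in Z0.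
  destruct (Z.to_nat c) as [|n] eqn:En; [lia|].
  cbn [rsum] in Z0. unfold twist0 at 2 in Z0.
  rewrite (twist_multiple q2) in Z0; [|easy|rewrite <- En, Z2Nat.id by lia; exact Hd].
  rewrite !rsum_S_l. simpl (INR 0). rewrite !Rmult_0_l, !Rplus_0_l.
  rewrite <- rsum_rev.
  rewrite (rsum_ext _ (fun j => - IZR (chi2 (-1)%Z)
      * (INR (S j) * twist chi1 chi2 x (- phi) (S i) (S j))
     + INR (S n) * IZR (chi2 (-1)%Z) * twist0 chi1 chi2 x (- phi) i j)).
  - rewrite rsum_plus, !rsum_scal. rewrite Rplus_0_r in Z0. rewrite Z0. ring.
  - intros j Hj. unfold twist0, twist.
    set (r := S (n - 1 - j)). assert (Er : (r + S j = S n)%nat) by lia.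
    assert (Er' : INR r = INR (S n) - INR (S j)) by (rewrite <- Er, plus_INR; ring).
    assert (Ec : INR (S n) = IZR c) by (rewrite <- En, INR_IZR_INZ, Z2Nat.id; [easy|lia]).
    assert (Hc0 : IZR c <> 0) by (apply not_0_IZR; lia).
    replace (chi2 (Z.of_nat r)) with (chi2 (-1) * chi2 (Z.of_nat (S j)))%Z.
    2:{ rewrite <- (proj1 (proj2 (proj2 H2))). apply (character_mod q2); [easy|].
        replace (-1 * Z.of_nat (S j) - Z.of_nat r)%Z with (- c)%Z by lia.
        now apply Z.divide_opp_r. }
    replace (cos (2 * PI * x * INR (S i) * INR r + phi))
      with (cos (2 * PI * x * INR (S i) * INR (S j) + - phi)).
    + rewrite mult_IZR, Er'. ring.
    + rewrite <- (cos_neg (2 * PI * x * INR (S i) * INR (S j) + - phi)).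
      rewrite <- (cos_add_two_pi_Z _ (Z.of_nat (S i) * a)). f_equal.
      rewrite Er', Ec, mult_IZR, <- INR_IZR_INZ. unfold x. field. easy.
Qed.

(** At [phi = 0] this forces [V = 0] for even [chi2]; at [phi = - PI / 2], where reversing the phase
    changes the sign of the limit, it forces [V = 0] for odd [chi2]. So one of the two components of
    the cusp series vanishes. *)
Lemma cusp_limit_parity q1 q2 chi1 chi2 p a c phi V V' :
  character q1 chi1 -> character q2 chi2 -> cusp_fraction q1 q2 a c ->
  cusp_limit chi1 chi2 p a c phi V -> cusp_limit chi1 chi2 p a c (- phi) V' ->
  V = - IZR (chi2 (-1)%Z) * V'.
Proof.
  intros H1 H2 Hac HV HV'.
  apply (is_lim_seq_scal_l _ (- IZR (chi2 (-1)%Z))) in HV'. simpl (Rbar_mult _ _) in HV'.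
  apply (is_lim_seq_inj _ _ _ HV). revert HV'.
  apply is_lim_seq_ext. intros n. symmetry. rewrite <- rsum_scal.
  apply rsum_ext. intros i _.
  rewrite !(row_mean_weighted q1 q2) by easy.
  rewrite (twist_weighted_parity q1 q2) by easy. ring.
Qed.

(** The phase that [cusp_limit_parity] leaves alive. It is read off [chi1], which in weight two has
    the same sign at [-1] as [chi2]. *)
Definition active_phase (chi : Z -> Z) : R := if Z.eqb (chi (-1)%Z) 1 then - (PI / 2) else 0.

Lemma character_minus_one q chi : character q chi ->
  chi (-1)%Z = 1%Z \/ chi (-1)%Z = (-1)%Z.
Proof.
  intros (_ & H1 & Hm & _ & _ & Hv). destruct (Hv (-1)%Z) as [H|H]; [|easy].
  specialize (Hm (-1)%Z (-1)%Z). rewrite H in Hm. simpl in Hm. lia.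
Qed.

(** Finite Fourier inversion modulo [q]; the parity of [chi] against the phase leaves only sines.
    The coefficients sum to a multiple of [chi(0) = 0], which later removes the constant term of the
    sawtooth. *)
Lemma character_sine_expansion q chi : character q chi ->
  exists kappa : nat -> R, rsum kappa (Z.to_nat q) = 0 /\
  forall (m : nat) theta,
  IZR (chi (Z.of_nat m)) * cos (INR m * theta + active_phase chi)
  = rsum (fun l => kappa l * sin (INR m * (theta + 2 * PI * INR l / IZR q))) (Z.to_nat q).
Proof.
  intros H. assert (Hq : (1 < q)%Z) by apply H.
  set (n := Z.to_nat q). assert (Hn : n <> O) by (unfold n; lia).
  assert (En : IZR q = INR n) by (unfold n; rewrite INR_IZR_INZ, Z2Nat.id; [easy|lia]).
  assert (Ez : Z.of_nat n = q) by (unfold n; lia).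
  assert (Hn0 : INR n <> 0) by now apply not_0_INR.
  (* [psi] is [0] for even and [- PI / 2] for odd [chi], so [kappa] is the cosine transform of [chi]
     in the first case and its sine transform in the second. *)
  rewrite En. set (psi := - (PI / 2) - active_phase chi).
  exists (fun l => / INR n * rsum (fun s => IZR (chi (Z.of_nat s))
     * cos (psi + 2 * PI * IZR (Z.of_nat s) * INR l / INR n)) n).
  assert (Hres : forall z, rsum (fun s => IZR (chi (Z.of_nat s))
     * (if Zdivide_dec (Z.of_nat n) (Z.of_nat s + z) then 1 else 0)) n = IZR (chi (- z)%Z)).
  { intros z. rewrite (rsum_residue (fun s => IZR (chi s))) by easy. f_equal.
    apply (character_mod q); [easy|]. rewrite Ez.
    exists (- ((- z) / q))%Z. pose proof (Z.div_mod (- z) q ltac:(lia)). lia. }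
  split.
  - rewrite rsum_scal, rsum_swap.
    rewrite (rsum_ext _ (fun s => IZR (chi (Z.of_nat s)) *
      (if Zdivide_dec (Z.of_nat n) (Z.of_nat s + 0) then 1 else 0) * (INR n * cos psi))).
    + rewrite (rsum_ext _ (fun s => (INR n * cos psi) * (IZR (chi (Z.of_nat s)) *
        (if Zdivide_dec (Z.of_nat n) (Z.of_nat s + 0) then 1 else 0)))) by (intros; ring).
      rewrite rsum_scal, Hres. rewrite (character_multiple q chi _ H).
      * ring.
      * exists 0%Z. lia.
    + intros s _. rewrite rsum_scal, cos_progression_sum, Z.add_0_r by easy.
      destruct (Zdivide_dec _ _); ring.
  - intros m theta.
    (* Product to sum: orthogonality in [l] selects [s = - m] from the first cosine and [s = m] from
       the second, and the parity of [chi] merges the two. *)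
    rewrite (rsum_ext _ (fun l => rsum (fun s => / INR n * IZR (chi (Z.of_nat s)) * / 2 *
       (cos (psi + INR m * theta - PI / 2
          + 2 * PI * IZR (Z.of_nat s + Z.of_nat m) * INR l / INR n)
        - cos (psi - INR m * theta - PI / 2
          + 2 * PI * IZR (Z.of_nat s + - Z.of_nat m) * INR l / INR n))) n)).
    2:{ intros l _. rewrite Rmult_assoc, (Rmult_comm (rsum _ _)), <- rsum_scal, <- rsum_scal.
        apply rsum_ext. intros s _.
        set (A := psi + 2 * PI * IZR (Z.of_nat s) * INR l / INR n).
        set (B := INR m * (theta + 2 * PI * INR l / INR n)).
        replace (psi + INR m * theta - PI / 2
          + 2 * PI * IZR (Z.of_nat s + Z.of_nat m) * INR l / INR n) with (A + B - PI / 2)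
          by (unfold A, B; rewrite plus_IZR, <- !INR_IZR_INZ; field; easy).
        replace (psi - INR m * theta - PI / 2
          + 2 * PI * IZR (Z.of_nat s + - Z.of_nat m) * INR l / INR n) with (A - B - PI / 2)
          by (unfold A, B; rewrite plus_IZR, opp_IZR, <- !INR_IZR_INZ; field; easy).
        rewrite !(cos_minus _ (PI / 2)), cos_PI2, sin_PI2, sin_plus, sin_minus. field. easy. }
    rewrite rsum_swap.
    rewrite (rsum_ext _ (fun s =>
      / 2 * cos (psi + INR m * theta - PI / 2) * (IZR (chi (Z.of_nat s)) *
         (if Zdivide_dec (Z.of_nat n) (Z.of_nat s + Z.of_nat m) then 1 else 0))
      - / 2 * cos (psi - INR m * theta - PI / 2) * (IZR (chi (Z.of_nat s)) *
         (if Zdivide_dec (Z.of_nat n) (Z.of_nat s + - Z.of_nat m) then 1 else 0)))).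
    2:{ intros s _. rewrite rsum_scal, rsum_minus, !cos_progression_sum by easy.
        destruct (Zdivide_dec _ (_ + Z.of_nat m)), (Zdivide_dec _ (_ + - Z.of_nat m));
          field; easy. }
    rewrite rsum_minus, !rsum_scal, !Hres, Z.opp_involutive.
    replace (- Z.of_nat m)%Z with (-1 * Z.of_nat m)%Z by lia.
    rewrite (proj1 (proj2 (proj2 H))), mult_IZR.
    unfold psi, active_phase.
    destruct (character_minus_one q chi H) as [E|E]; rewrite E; cbn [Z.eqb Pos.eqb].
    + replace (- (PI / 2) - - (PI / 2) + INR m * theta - PI / 2)
        with (INR m * theta - PI / 2) by ring.
      replace (- (PI / 2) - - (PI / 2) - INR m * theta - PI / 2)
        with (- (INR m * theta) - PI / 2) by ring.
      replace (INR m * theta + - (PI / 2)) with (INR m * theta - PI / 2) by ring.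
      rewrite !cos_minus, cos_PI2, sin_PI2, sin_neg, cos_neg. field.
    + replace (- (PI / 2) - 0 + INR m * theta - PI / 2) with (INR m * theta - PI) by field.
      replace (- (PI / 2) - 0 - INR m * theta - PI / 2) with (- (INR m * theta) - PI) by field.
      rewrite Rplus_0_r, !cos_minus, cos_PI, sin_PI, sin_neg, cos_neg. field.
Qed.

(** The integers [r] and [(r a + l c / q1) mod c] are [c] times the fractional parts of [r / c] and
    [r a / c + l / q1]: a generalized Dedekind sum cleared of denominators. *)
Definition dedekind_sum (kappa : nat -> R) (chi2 : Z -> Z) (q1 a c : Z) : R :=
  rsum (fun l => kappa l * rsum (fun r => INR r * IZR (chi2 (Z.of_nat r))
    * IZR ((Z.of_nat r * a + Z.of_nat l * (c / q1)) mod c)) (Z.to_nat c)) (Z.to_nat q1).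

Lemma cusp_fraction_div q1 q2 a c : (1 < q1)%Z -> cusp_fraction q1 q2 a c ->
  (c = q1 * (c / q1))%Z /\ (q2 | c / q1)%Z.
Proof.
  intros Hq (Hc & _ & [w Hw]). replace (c / q1)%Z with (w * q2)%Z.
  - split; [lia|]. now exists w.
  - apply Z.div_unique_exact; lia.
Qed.

(** With [p = 0] the weight is [1 / (2 pi m)]. Writing the row means as finite sums over [r] and
    [chi1] as a combination of sines leaves sawtooth series in [m], to be summed for each pair
    [(r, l)]. *)
Lemma cusp_limit_weight_two q1 q2 chi1 chi2 kappa a c V :
  character q1 chi1 -> character q2 chi2 -> cusp_fraction q1 q2 a c ->
  rsum kappa (Z.to_nat q1) = 0 ->
  (forall (m : nat) theta,
   IZR (chi1 (Z.of_nat m)) * cos (INR m * theta + active_phase chi1)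
   = rsum (fun l => kappa l * sin (INR m * (theta + 2 * PI * INR l / IZR q1))) (Z.to_nat q1)) ->
  cusp_limit chi1 chi2 0 a c (active_phase chi1) V ->
  V = / (2 * IZR c ^ 2) * dedekind_sum kappa chi2 q1 a c.
Proof.
  intros H1 H2 Hac Hk0 Hk HV.
  assert (Hc : (0 < c)%Z) by apply Hac. assert (Hq : (1 < q1)%Z) by apply H1.
  assert (Hc0 : IZR c <> 0) by (apply not_0_IZR; lia).
  assert (Hq0 : IZR q1 <> 0) by (apply not_0_IZR; lia).
  pose proof PI_neq0 as HP.
  destruct (cusp_fraction_div q1 q2 a c Hq Hac) as [Ec Hd].
  set (c1 := (c / q1)%Z) in *. set (x := IZR a / IZR c) in *.
  set (t := fun r l : nat => ((Z.of_nat r * a + Z.of_nat l * c1) mod c)%Z).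
  (* [- 1 / c] comes from [row_mean_weighted] and [1 / (2 pi)] from the kernel; the remaining
     [1 / m] belongs to the sawtooth series. *)
  set (coef := fun r l : nat => - / (2 * PI * IZR c) * (INR r * IZR (chi2 (Z.of_nat r)) * kappa l)).
  assert (L : cusp_limit chi1 chi2 0 a c (active_phase chi1)
    (rsum (fun l => rsum (fun r => coef r l * ((PI - 2 * PI * IZR (t r l) / IZR c) / 2))
      (Z.to_nat c)) (Z.to_nat q1))).
  { unfold cusp_limit. fold x.
    apply (is_lim_seq_ext (fun M => rsum (fun l => rsum (fun r => coef r l *
      rsum (fun i => sin (INR (S i) * (2 * PI * x * INR r + 2 * PI * INR l / IZR q1))
        / INR (S i)) M) (Z.to_nat c)) (Z.to_nat q1))).
    - intros M. symmetry.
      rewrite (rsum_ext (fun i => row_mean _ _ i * _) (fun i =>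
        rsum (fun l => rsum (fun r => coef r l *
          (sin (INR (S i) * (2 * PI * x * INR r + 2 * PI * INR l / IZR q1)) / INR (S i)))
          (Z.to_nat c)) (Z.to_nat q1))).
      + rewrite rsum_swap. apply rsum_ext. intros l _. rewrite rsum_swap.
        apply rsum_ext. intros r _. now rewrite rsum_scal.
      + intros i _. unfold x. rewrite (row_mean_weighted q1 q2) by easy. fold x.
        rewrite rsum_swap, (Rmult_comm (- / IZR c)), Rmult_assoc, Rmult_comm, <- rsum_scal.
        apply rsum_ext. intros r _. unfold twist.
        replace (2 * PI * x * INR (S i) * INR r + active_phase chi1)
          with (INR (S i) * (2 * PI * x * INR r) + active_phase chi1) by ring.
        set (m := S i).
        replace (IZR (chi1 (Z.of_nat m)) * IZR (chi2 (Z.of_nat r))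
          * cos (INR m * (2 * PI * x * INR r) + active_phase chi1))
          with (IZR (chi2 (Z.of_nat r)) * (IZR (chi1 (Z.of_nat m))
          * cos (INR m * (2 * PI * x * INR r) + active_phase chi1))) by ring.
        rewrite Hk, <- !rsum_scal.
        apply rsum_ext. intros l _. unfold coef. cbn [kern].
        rewrite Rmult_0_r, Ropp_0, exp_0. field.
        repeat split; auto. unfold m; apply not_0_INR; lia.
    - apply is_lim_seq_rsum. intros l _. apply is_lim_seq_rsum. intros r _.
      destruct (Z.eq_dec (chi2 (Z.of_nat r)) 0) as [E0|E0].
      { unfold coef. rewrite E0. rewrite Rmult_0_r, Rmult_0_l, Rmult_0_r, Rmult_0_l.
        apply (is_lim_seq_ext (fun _ => 0)); [intros; ring|apply is_lim_seq_const]. }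
      apply (is_lim_seq_scal_l _ (coef r l) (Finite _)).
      pose proof (Z.mod_pos_bound (Z.of_nat r * a + Z.of_nat l * c1) c Hc) as Hb.
      pose proof (Z.div_mod (Z.of_nat r * a + Z.of_nat l * c1) c ltac:(lia)) as Hdm.
      fold (t r l) in Hb, Hdm. set (k := ((Z.of_nat r * a + Z.of_nat l * c1) / c)%Z) in *.
      (* The sawtooth series needs an angle off the jump. A zero residue would give [q2 | r a],
         hence [q2 | r] and [chi2 r = 0], the case already dismissed. *)
      assert (Ht : (t r l <> 0)%Z).
      { intros E. apply E0. apply (character_multiple q2); [easy|].
        destruct Hd as [w Hw]. apply (Z.gauss q2 a).
        - exists (k * (q1 * w) - Z.of_nat l * w)%Z. nia.
        - rewrite Z.gcd_comm. apply Zgcd_1_rel_prime. apply rel_prime_sym.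
          apply rel_prime_div with c.
          + apply rel_prime_sym. apply Zgcd_1_rel_prime, Hac.
          + exists (q1 * w)%Z. nia. }
      apply (is_lim_seq_ext (rsum (fun i => sin (INR (S i) * (2 * PI * IZR (t r l) / IZR c))
        / INR (S i)))).
      + intros M. apply rsum_ext. intros i _. f_equal.
        rewrite <- !cos_shift.
        rewrite <- (cos_add_two_pi_Z (PI / 2 - INR (S i) * (2 * PI * x * INR r
            + 2 * PI * INR l / IZR q1)) (Z.of_nat (S i) * k)). f_equal.
        rewrite mult_IZR, <- INR_IZR_INZ.
        assert (Et : IZR (t r l) = INR r * IZR a + INR l * IZR c1 - IZR c * IZR k).
        { rewrite !INR_IZR_INZ, <- !mult_IZR, <- plus_IZR, <- minus_IZR. f_equal. lia. }
        rewrite Et. unfold x.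
        assert (Ec' : IZR c = IZR q1 * IZR c1) by (rewrite <- mult_IZR; now f_equal).
        assert (Hc1 : IZR c1 <> 0) by (intros E; rewrite E in Ec'; lra).
        rewrite Ec'. field. split; easy.
      + apply sawtooth_series.
        assert (H0t : 0 < IZR (t r l)) by (apply IZR_lt; lia).
        assert (Htc : IZR (t r l) < IZR c) by (apply IZR_lt; lia).
        assert (Hcp : 0 < IZR c) by (apply IZR_lt; lia). pose proof PI_RGT_0.
        split; [apply Rdiv_lt_0_compat; nra|].
        apply Rmult_lt_reg_r with (IZR c); [easy|].
        unfold Rdiv. rewrite Rmult_assoc, Rinv_l, Rmult_1_r by easy. nra. }
  rewrite (is_lim_seq_inj _ _ _ HV L).
  unfold dedekind_sum. fold c1.
  (* The constant [PI / 2] of the sawtooth yields a term proportional to [kappa l] with a factor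
     free of [l]; it disappears on summing over [l]. *)
  rewrite (rsum_ext _ (fun l => / (2 * IZR c ^ 2) * (kappa l * rsum (fun r => INR r
      * IZR (chi2 (Z.of_nat r)) * IZR (t r l)) (Z.to_nat c))
    + (- / (4 * IZR c) * rsum (fun r => INR r * IZR (chi2 (Z.of_nat r))) (Z.to_nat c))
      * kappa l)).
  - rewrite rsum_plus, !rsum_scal, Hk0. unfold t. ring.
  - intros l _.
    transitivity ((/ (2 * IZR c ^ 2) * kappa l) * rsum (fun r => INR r
        * IZR (chi2 (Z.of_nat r)) * IZR (t r l)) (Z.to_nat c)
      + (- / (4 * IZR c) * kappa l)
        * rsum (fun r => INR r * IZR (chi2 (Z.of_nat r))) (Z.to_nat c)); [|ring].
    rewrite <- !rsum_scal, <- rsum_plus.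
    apply rsum_ext. intros r _. unfold coef. field. split; easy.
Qed.

(** The substitution [t = a r + l c / q1] modulo [c] exchanges the two factors
    of the sum. *)
Lemma dedekind_sum_reciprocity q1 q2 chi2 kappa a d c :
  (1 < q1)%Z -> character q2 chi2 -> cusp_fraction q1 q2 a c ->
  (c | a * d - 1)%Z -> (q1 * q2 | a - 1)%Z -> (q1 * q2 | d - 1)%Z ->
  rsum kappa (Z.to_nat q1) = 0 ->
  dedekind_sum kappa chi2 q1 a c = - dedekind_sum kappa chi2 q1 (- d) c.
Proof.
  intros Hq H2 Hac Had Ha Hd Hk0.
  assert (Hc : (0 < c)%Z) by apply Hac.
  destruct (cusp_fraction_div q1 q2 a c Hq Hac) as [Ec Hd1].
  unfold dedekind_sum. set (c1 := (c / q1)%Z) in *. set (n := Z.to_nat c).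
  assert (En : Z.of_nat n = c) by (unfold n; lia).
  assert (Hn : n <> O) by lia.
  set (K := IZR c * rsum (fun s => INR s * IZR (chi2 (Z.of_nat s))) n).
  assert (E : forall l, rsum (fun r => INR r * IZR (chi2 (Z.of_nat r))
      * IZR ((Z.of_nat r * a + Z.of_nat l * c1) mod c)) n
    = K - rsum (fun r => INR r * IZR (chi2 (Z.of_nat r))
      * IZR ((Z.of_nat r * - d + Z.of_nat l * c1) mod c)) n).
  { intros l.
    (* The residue [s] of [r a + l c1] is made a summation variable under an indicator, so that
       after exchanging the sums [r] can be solved for as the residue of [d s - l c1]. *)
    rewrite (rsum_ext _ (fun r => rsum (fun s => INR s * ((IZR (Z.of_nat r)
        * IZR (chi2 (Z.of_nat r)))
      * (if Zdivide_dec (Z.of_nat n) (Z.of_nat r + (Z.of_nat l * c1 - d * Z.of_nat s))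
         then 1 else 0))) n)).
    2:{ intros r _. rewrite <- En at 1.
        replace (Z.of_nat r * a + Z.of_nat l * c1)%Z
          with (- - (Z.of_nat r * a + Z.of_nat l * c1))%Z by lia.
        rewrite <- (rsum_residue IZR) by easy. rewrite <- rsum_scal.
        apply rsum_ext. intros s _. rewrite <- !INR_IZR_INZ, En.
        (* [a] and [d] are inverse modulo [c], and being 1 modulo [q1 q2] they fix [c1] modulo [c],
           since [c1] is a multiple of [q2] and [q1 c1 = c]. *)
        assert (Hiff : (c | Z.of_nat s + - (Z.of_nat r * a + Z.of_nat l * c1))%Z
          <-> (c | Z.of_nat r + (Z.of_nat l * c1 - d * Z.of_nat s))%Z).
        { destruct Had as [w Hw], Ha as [wa Hwa], Hd as [wd Hwd].
          split; intros [u Hu].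
          - exists (- u * d - Z.of_nat r * w - Z.of_nat l * q2 * wd)%Z.
            assert (E1 : (Z.of_nat l * c1 * d = Z.of_nat l * c1 + Z.of_nat l * q2 * wd * c)%Z).
            { replace (Z.of_nat l * q2 * wd * c)%Z with (Z.of_nat l * q2 * wd * (q1 * c1))%Z
                by now rewrite <- Ec.
              replace d with (1 + wd * (q1 * q2))%Z by lia. ring. }
            assert (E2 : (Z.of_nat r * (a * d) = Z.of_nat r + Z.of_nat r * w * c)%Z) by nia.
            assert (E3 : (u * c * d = (Z.of_nat s + - (Z.of_nat r * a + Z.of_nat l * c1)) * d)%Z)
              by (rewrite Hu; ring).
            nia.
          - exists (- u * a - Z.of_nat s * w + Z.of_nat l * q2 * wa)%Z.
            assert (E1 : (Z.of_nat l * c1 * a = Z.of_nat l * c1 + Z.of_nat l * q2 * wa * c)%Z).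
            { replace (Z.of_nat l * q2 * wa * c)%Z with (Z.of_nat l * q2 * wa * (q1 * c1))%Z
                by now rewrite <- Ec.
              replace a with (1 + wa * (q1 * q2))%Z by lia. ring. }
            assert (E2 : (Z.of_nat s * (a * d) = Z.of_nat s + Z.of_nat s * w * c)%Z) by nia.
            assert (E3 : (u * c * a = (Z.of_nat r + (Z.of_nat l * c1 - d * Z.of_nat s)) * a)%Z)
              by (rewrite Hu; ring).
            nia. }
        destruct (Zdivide_dec _ _) as [D1|D1], (Zdivide_dec _ _) as [D2|D2];
          try ring; exfalso; tauto. }
    rewrite rsum_swap. unfold K. rewrite <- rsum_scal, <- rsum_minus.
    apply rsum_ext. intros s _. rewrite rsum_scal.
    rewrite (rsum_residue (fun z => IZR z * IZR (chi2 z))) by easy. rewrite En.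
    replace (- (Z.of_nat l * c1 - d * Z.of_nat s))%Z
      with (- (Z.of_nat s * - d + Z.of_nat l * c1))%Z by lia.
    set (y := (Z.of_nat s * - d + Z.of_nat l * c1)%Z).
    assert (Hchi : chi2 ((- y) mod c)%Z = chi2 (Z.of_nat s)).
    { apply (character_mod q2); [easy|].
      pose proof (Z.div_mod (- y) c ltac:(lia)) as Hy.
      destruct Hd1 as [w Hw], Hd as [wd Hwd].
      exists (Z.of_nat s * wd * q1 - Z.of_nat l * w - q1 * w * (- y / c))%Z.
      replace ((- y) mod c)%Z with (- y - c * (- y / c))%Z by lia.
      set (k := (- y / c)%Z). unfold y. rewrite Ec, Hw.
      replace d with (1 + wd * (q1 * q2))%Z by lia. ring. }
    rewrite Hchi. destruct (Z.eq_dec (chi2 (Z.of_nat s)) 0) as [->|Hs]; [ring|].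
    (* For a nonzero residue [(- y) mod c = c - y mod c]; the part [c] sums to [K] and the minus
       sign gives the reciprocity. *)
    assert (Hym : (y mod c <> 0)%Z).
    { intros E0. apply Hs. rewrite <- Hchi. apply (character_multiple q2); [easy|].
      rewrite Z.mod_opp_l_z by lia. exists 0%Z. lia. }
    rewrite Z.mod_opp_l_nz, minus_IZR by lia. ring. }
  rewrite <- (Rminus_0_l (rsum _ _)), <- (Rmult_0_r K), <- Hk0, <- rsum_scal, <- rsum_minus.
  apply rsum_ext. intros l _. rewrite E. ring.
Qed.

(** Parity annihilates the same component at both cusps; the other one is a multiple of the Dedekind
    sum, with the same [kappa] and denominator on both sides. *)
Lemma Shat_reciprocity_weight_two q1 q2 chi1 chi2 a d c :
  character q1 chi1 -> character q2 chi2 -> chi1 (-1)%Z = chi2 (-1)%Z ->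
  cusp_fraction q1 q2 a c -> (c | a * d - 1)%Z ->
  (q1 * q2 | a - 1)%Z -> (q1 * q2 | d - 1)%Z ->
  Shat_fin chi1 chi2 q1 2 (IZR a / IZR c) = (- Shat_fin chi1 chi2 q1 2 (IZR (- d) / IZR c))%C.
Proof.
  intros H1 H2 Hpar Hac Had Ha Hd.
  assert (Hdc : cusp_fraction q1 q2 (- d) c).
  { split; [apply Hac|]. split; [|apply Hac]. rewrite Z.gcd_opp_l.
    destruct Had as [w Hw]. apply Zgcd_1_rel_prime. apply bezout_rel_prime.
    apply Bezout_intro with a (- w)%Z. lia. }
  destruct (Shat_fin_formula chi1 chi2 q1 q2 2 a c ltac:(lia) H1 H2 Hac)
    as (V0 & V1 & L0 & L1 & ->).
  destruct (Shat_fin_formula chi1 chi2 q1 q2 2 (- d) c ltac:(lia) H1 H2 Hdc)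
    as (W0 & W1 & M0 & M1 & ->).
  destruct (character_sine_expansion q1 chi1 H1) as (kappa & Hk0 & Hk).
  assert (Hq : (1 < q1)%Z) by apply H1.
  pose proof (dedekind_sum_reciprocity q1 q2 chi2 kappa a d c Hq H2 Hac Had Ha Hd Hk0) as R.
  pose proof (fun V => cusp_limit_weight_two q1 q2 chi1 chi2 kappa a c V H1 H2 Hac Hk0 Hk) as F.
  pose proof (fun V => cusp_limit_weight_two q1 q2 chi1 chi2 kappa (- d) c V H1 H2 Hdc Hk0 Hk) as F'.
  change (2 - 2)%nat with O in *.
  (* [cos (z + PI / 2) = - cos (z - PI / 2)], so the opposite phase needed by [cusp_limit_parity]
     has the opposite limit. *)
  assert (Hneg : forall a V, cusp_limit chi1 chi2 0 a c (- (PI / 2)) V ->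
    cusp_limit chi1 chi2 0 a c (- - (PI / 2)) (- V)).
  { intros a0 V HV. unfold cusp_limit in *.
    apply (is_lim_seq_scal_l _ (-1)) in HV. simpl (Rbar_mult _ _) in HV.
    replace (-1 * V) with (- V) in HV by ring. revert HV. apply is_lim_seq_ext. intros n.
    rewrite <- rsum_scal. apply rsum_ext. intros i _. rewrite <- Rmult_assoc. f_equal.
    unfold row_mean. rewrite <- Rmult_assoc, (Rmult_comm (-1)), Rmult_assoc, <- rsum_scal.
    f_equal. apply rsum_ext. intros j _. rewrite <- rsum_scal. apply rsum_ext. intros j' _.
    unfold twist0, twist. set (z := 2 * PI * _ * _ * _).
    replace (z + - - (PI / 2)) with (z + PI / 2) by ring.
    replace (z + - (PI / 2)) with (z - PI / 2) by ring.
    rewrite cos_plus, cos_minus, cos_PI2, sin_PI2. ring. }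
  assert (P0 := L0). assert (P0' := M0). rewrite <- Ropp_0 in P0, P0'.
  pose proof (cusp_limit_parity _ _ _ _ _ _ _ _ _ _ H1 H2 Hac L0 P0) as S0.
  pose proof (cusp_limit_parity _ _ _ _ _ _ _ _ _ _ H1 H2 Hac L1 (Hneg _ _ L1)) as S1.
  pose proof (cusp_limit_parity _ _ _ _ _ _ _ _ _ _ H1 H2 Hdc M0 P0') as T0.
  pose proof (cusp_limit_parity _ _ _ _ _ _ _ _ _ _ H1 H2 Hdc M1 (Hneg _ _ M1)) as T1.
  assert (EV : (V0, V1) = (- (W0, W1))%C).
  { unfold Copp; cbn [fst snd]. unfold active_phase in F, F'.
    destruct (character_minus_one q1 chi1 H1) as [E|E]; rewrite E in F, F', Hpar;
      cbn [Z.eqb Pos.eqb] in F, F'; rewrite <- Hpar in *.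
    - specialize (F V1 L1). specialize (F' W1 M1). f_equal; [lra|].
      rewrite F, F', R. ring.
    - specialize (F V0 L0). specialize (F' W0 M0). f_equal; [|lra].
      rewrite F, F', R. ring. }
  rewrite EV. ring.
Qed.

(** * Weight at least three: continuity along parabolic orbits *)

Lemma rsum_mult f h n :
  rsum f n * rsum h n = rsum (fun r => rsum (fun s => f r * h s) n) n.
Proof.
  rewrite Rmult_comm, <- rsum_scal. apply rsum_ext. intros r _. rewrite rsum_scal. ring.
Qed.

(** By [row_mean_weighted] the row means are components of the discrete Fourier transform of
    [r / c * chi2(r)] at the frequencies [m a], which run over all residues modulo [c]. Parseval
    bounds the sum of squares by [c] times at most [c]. *)
Lemma row_mean_parseval q1 q2 chi1 chi2 a c phi :
  character q1 chi1 -> character q2 chi2 -> cusp_fraction q1 q2 a c ->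
  rsum (fun i => row_mean (Z.to_nat c) (twist0 chi1 chi2 (IZR a / IZR c) phi) i ^ 2)
    (Z.to_nat c) <= IZR c ^ 2.
Proof.
  intros H1 H2 Hac. set (x := IZR a / IZR c). set (n := Z.to_nat c).
  assert (Hc : (0 < c)%Z) by apply Hac.
  assert (Hn : INR n = IZR c) by (unfold n; rewrite INR_IZR_INZ, Z2Nat.id; [easy|lia]).
  assert (En : Z.of_nat n = c) by (unfold n; lia).
  assert (Hn0 : n <> O) by lia.
  assert (Hc0 : 0 < IZR c) by (apply IZR_lt; lia).
  set (g := fun r : nat => INR r / IZR c * IZR (chi2 (Z.of_nat r))).
  set (th := fun i r : nat => 2 * PI * x * INR (S i) * INR r + phi).
  assert (Hg : forall r, (r < n)%nat -> g r ^ 2 <= 1).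
  { intros r Hr. unfold g. pose proof (character_abs q2 chi2 (Z.of_nat r) H2) as Hx.
    assert (0 <= INR r / IZR c <= 1).
    { split; [apply Rdiv_le_0_compat; [apply pos_INR|easy]|].
      apply Rmult_le_reg_r with (IZR c); [easy|]. unfold Rdiv.
      rewrite Rmult_assoc, Rinv_l, Rmult_1_r, Rmult_1_l by lra.
      rewrite <- Hn. apply le_INR. lia. }
    rewrite Rpow_mult_distr. apply Rabs_le_between in Hx.
    set (y := IZR (chi2 (Z.of_nat r))) in *. assert (y ^ 2 <= 1) by nra.
    assert ((INR r / IZR c) ^ 2 <= 1) by nra. pose proof (pow2_ge_0 y).
    pose proof (pow2_ge_0 (INR r / IZR c)). nra. }
  apply Rle_trans with (rsum (fun i => rsum (fun r => rsum (fun s =>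
      g r * g s * cos (2 * PI * x * INR (S i) * (INR r - INR s))) n) n) n).
  - apply rsum_le. intros i _. unfold x, n. rewrite (row_mean_weighted q1 q2) by easy. fold x n.
    apply Rle_trans with (rsum (fun r => g r * cos (th i r)) n ^ 2).
    + replace (- / IZR c * rsum (fun r => INR r * twist chi1 chi2 x phi (S i) r) n)
        with (- IZR (chi1 (Z.of_nat (S i))) * rsum (fun r => g r * cos (th i r)) n).
      * rewrite Rpow_mult_distr. pose proof (character_abs q1 chi1 (Z.of_nat (S i)) H1) as Hx.
        apply Rabs_le_between in Hx.
        set (y := IZR (chi1 (Z.of_nat (S i)))) in *.
        assert ((- y) ^ 2 <= 1) by nra. pose proof (pow2_ge_0 (rsum (fun r => g r * cos (th i r)) n)).
        nra.
      * rewrite <- !rsum_scal. apply rsum_ext. intros r _. unfold g, th, twist. field. lra.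
    (* Adding the square of the sine sum only enlarges the bound and completes a squared modulus,
       which expands into cosines of differences accessible to orthogonality. *)
    + apply Rle_trans with (rsum (fun r => g r * cos (th i r)) n ^ 2
        + rsum (fun r => g r * sin (th i r)) n ^ 2).
      { pose proof (pow2_ge_0 (rsum (fun r => g r * sin (th i r)) n)). lra. }
      right. rewrite <- !Rsqr_pow2. unfold Rsqr. rewrite !rsum_mult, <- rsum_plus.
      apply rsum_ext. intros r _. rewrite <- rsum_plus. apply rsum_ext. intros s _.
      replace (2 * PI * x * INR (S i) * (INR r - INR s)) with (th i r - th i s)
        by (unfold th; ring).
      rewrite cos_minus. ring.
  - rewrite rsum_swap.
    rewrite (rsum_ext _ (fun r => IZR c * g r ^ 2)).
    + rewrite rsum_scal. replace (IZR c ^ 2) with (IZR c * (INR n * 1)) by (rewrite Hn; ring).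
      apply Rmult_le_compat_l; [lra|]. rewrite <- rsum_const. now apply rsum_le.
    + intros r Hr. rewrite rsum_swap. rewrite (rsum_single _ _ r Hr).
      * rewrite (rsum_ext _ (fun _ => g r ^ 2)).
        -- rewrite rsum_const, Hn. ring.
        -- intros i _. rewrite Rminus_diag, Rmult_0_r, cos_0. ring.
      * intros s Hs Hne. rewrite rsum_scal.
        rewrite (rsum_ext _ (fun i => cos (2 * PI * x * (INR r - INR s)
          + 2 * PI * IZR (a * (Z.of_nat r - Z.of_nat s)) * INR i / INR n))).
        -- rewrite cos_progression_sum by easy.
           destruct (Zdivide_dec _ _) as [Hd|]; [exfalso|ring].
           rewrite En in Hd. apply Z.gauss in Hd.
           ++ destruct Hd as [w Hw]. assert (w = 0)%Z by nia. lia.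
           ++ rewrite Z.gcd_comm. apply Hac.
        -- intros i _. f_equal. rewrite mult_IZR, minus_IZR, <- !INR_IZR_INZ, S_INR, Hn.
           unfold x. field. lra.
Qed.

(** Cauchy-Schwarz in the form [2 |y| <= s + y^2 / s] with [s = sqrt c], applied over one period.
    The saving of [sqrt c] over the trivial order [c^2] makes the tails small at cusps of growing
    denominator. *)
Lemma row_mean_psum_sqrt_bound q1 q2 chi1 chi2 a c phi i :
  character q1 chi1 -> character q2 chi2 -> cusp_fraction q1 q2 a c ->
  Rabs (rsum (row_mean (Z.to_nat c) (twist0 chi1 chi2 (IZR a / IZR c) phi)) i)
  <= IZR c * sqrt (IZR c).
Proof.
  intros H1 H2 Hac.
  pose proof (twist0_balanced q1 q2 chi1 chi2 a c phi H1 H2 Hac) as Hb.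
  pose proof (row_mean_parseval q1 q2 chi1 chi2 a c phi H1 H2 Hac) as HP.
  assert (Hc : (0 < c)%Z) by apply Hac.
  set (v := twist0 chi1 chi2 (IZR a / IZR c) phi) in *. set (n := Z.to_nat c) in *.
  assert (Hn : INR n = IZR c) by (unfold n; rewrite INR_IZR_INZ, Z2Nat.id; [easy|lia]).
  assert (Hn0 : n <> O) by apply Hb.
  assert (Hper : periodic n (rsum (row_mean n v))).
  { intros j. rewrite !row_mean_psum. f_equal. apply rsum_ext. intros j' _.
    apply (psum2_periodic_l n v (S j') Hb j). }
  rewrite (periodic_mod n _ i Hn0 Hper).
  assert (Hi : (i mod n < n)%nat) by now apply Nat.mod_upper_bound.
  set (j := (i mod n)%nat) in *.
  assert (Hc0 : 0 < IZR c) by (apply IZR_lt; lia).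
  set (s := sqrt (IZR c)). assert (Hs : 0 < s) by now apply sqrt_lt_R0.
  assert (Hss : s * s = IZR c) by (apply sqrt_sqrt; lra).
  eapply Rle_trans; [apply rsum_abs|].
  eapply Rle_trans; [apply (rsum_mono _ j n); [intros; apply Rabs_pos|lia]|].
  apply Rle_trans with (rsum (fun i => / 2 * s + / (2 * s) * row_mean n v i ^ 2) n).
  - apply rsum_le. intros r _. rewrite <- pow2_abs. set (y := Rabs (row_mean n v r)).
    apply Rmult_le_reg_l with (2 * s); [lra|].
    replace (2 * s * (/ 2 * s + / (2 * s) * y ^ 2)) with (s ^ 2 + y ^ 2) by (field; lra).
    pose proof (pow2_ge_0 (s - y)). nra.
  - rewrite rsum_plus, rsum_const, rsum_scal, Hn.
    apply Rle_trans with (IZR c * (/ 2 * s) + / (2 * s) * IZR c ^ 2).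
    + apply Rplus_le_compat_l, Rmult_le_compat_l; [|easy].
      apply Rlt_le, Rinv_0_lt_compat. lra.
    + right. rewrite <- Hss. field. lra.
Qed.

Lemma row_mean_zero q1 q2 chi1 chi2 a c phi i :
  character q1 chi1 -> character q2 chi2 -> cusp_fraction q1 q2 a c ->
  chi1 (Z.of_nat (S i)) = 0%Z ->
  row_mean (Z.to_nat c) (twist0 chi1 chi2 (IZR a / IZR c) phi) i = 0.
Proof.
  intros H1 H2 Hac E. rewrite (row_mean_weighted q1 q2) by easy.
  rewrite rsum_zero; [ring|]. intros r _. unfold twist. rewrite E. ring.
Qed.

Lemma sin_add_PI_Z y k : sin (y + PI * IZR k) ^ 2 = sin y ^ 2.
Proof.
  assert (Hs : sin (PI * IZR k) = 0) by (apply sin_eq_0_1; exists k; ring).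
  pose proof (sin2_cos2 (PI * IZR k)) as H. rewrite Hs in H. unfold Rsqr in H.
  rewrite sin_plus, Hs. nra.
Qed.

(** The cusps [approach_num a c n / (c^2 n)] tend to [a/c]; they are the
    images of infinity under [g T^n g^-1] if [g] maps infinity to [a/c]. *)
Definition approach_num (a c : Z) (n : nat) : Z := (a * c * Z.of_nat n - 1)%Z.
Definition approach_den (c : Z) (n : nat) : Z := (c * c * Z.of_nat n)%Z.

Lemma approach_cusp_fraction q1 q2 a c n : cusp_fraction q1 q2 a c -> n <> O ->
  cusp_fraction q1 q2 (approach_num a c n) (approach_den c n).
Proof.
  intros (Hc & Hac & [w Hw]) Hn. unfold approach_num, approach_den. repeat split.
  - nia.
  - apply Zgcd_1_rel_prime. apply bezout_rel_prime.
    apply Bezout_intro with (- (a * c * Z.of_nat n) - 1)%Z (a * a * Z.of_nat n)%Z. ring.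
  - exists (w * c * Z.of_nat n)%Z. rewrite Hw at 2. ring.
Qed.

Lemma approach_value a c n : (0 < c)%Z -> n <> O ->
  IZR (approach_num a c n) / IZR (approach_den c n)
  = IZR a / IZR c - / IZR c ^ 2 * / INR n.
Proof.
  intros Hc Hn. unfold approach_num, approach_den.
  rewrite minus_IZR, !mult_IZR, <- INR_IZR_INZ. field.
  split; [now apply not_0_INR|apply not_0_IZR; lia].
Qed.

(** In the closed form only the denominator [sin beta] is dangerous. At [a / c] the number
    [q2 m a / c] is at distance at least [1 / c] from the integers; moving to the approaching cusp
    changes it by [q2 m / (c^2 n)], at most [1 / (2 c)] in the stated range. So
    [|sin beta| >= sin (PI / (2 c))]. *)
Lemma row_mean_uniform_bound q1 q2 chi1 chi2 a c phi :
  character q1 chi1 -> character q2 chi2 -> cusp_fraction q1 q2 a c ->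
  exists K, 0 <= K /\ forall n i, (2 * q2 * Z.of_nat (S i) <= c * Z.of_nat n)%Z ->
  Rabs (row_mean (Z.to_nat (approach_den c n))
    (twist0 chi1 chi2 (IZR (approach_num a c n) / IZR (approach_den c n)) phi) i) <= K.
Proof.
  intros H1 H2 Hac. assert (Hc : (0 < c)%Z) by apply Hac.
  assert (Hq2 : (1 < q2)%Z) by apply H2.
  assert (Hc0 : 1 <= IZR c) by (apply IZR_le; lia).
  pose proof PI_RGT_0 as HP.
  assert (Hs0 : 0 < PI / (2 * IZR c) <= PI / 2).
  { split; [apply Rdiv_lt_0_compat; lra|].
    apply Rmult_le_compat_l; [lra|]. apply Rinv_le_contravar; lra. }
  set (s := sin (PI / (2 * IZR c))). assert (Hs : 0 < s) by (apply sin_gt_0; lra).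
  exists (IZR q2 / (2 * s)). split.
  { apply Rdiv_le_0_compat; [apply IZR_le; lia|lra]. }
  intros n i Hni. assert (Hn : n <> O) by (intros ->; nia).
  pose proof (approach_cusp_fraction q1 q2 a c n Hac Hn) as Hn'.
  destruct (Z.eq_dec (chi1 (Z.of_nat (S i))) 0) as [E|E].
  { rewrite (row_mean_zero q1 q2) by easy. rewrite Rabs_R0.
    apply Rdiv_le_0_compat; [apply IZR_le; lia|lra]. }
  destruct (row_mean_twist0 q1 q2 chi1 chi2 H1 H2 _ _ phi i Hn' E) as [Hsin ->].
  set (alpha := 2 * PI * _ * INR (S i)) in *.
  set (beta := alpha * INR (Z.to_nat q2) / 2) in *.
  assert (Hbeta : s <= Rabs (sin beta)).
  { set (m := Z.of_nat (S i)) in *. set (y := (q2 * m * a)%Z).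
    pose proof (cusp_fraction_mod q1 q2 chi1 a c m H1 Hac E) as Hnd. fold y in Hnd.
    pose proof (Z.mod_pos_bound y c Hc) as Hb. pose proof (Z.div_mod y c ltac:(lia)) as Hdm.
    set (t := (y mod c)%Z) in *. set (k := (y / c)%Z) in *.
    assert (Ht : (t <> 0)%Z).
    { intros E0. apply Hnd. exists k. lia. }
    set (eps := IZR q2 * IZR m / (IZR c ^ 2 * INR n)).
    set (z := PI * (IZR t / IZR c - eps)).
    assert (Hnp : 0 < INR n) by (apply lt_0_INR; lia).
    assert (Hm : 0 < IZR m) by (apply IZR_lt; lia).
    assert (Hq : 0 < IZR q2) by (apply IZR_lt; lia).
    assert (Hcn : 0 < IZR c ^ 2 * INR n)
      by (apply Rmult_lt_0_compat; [apply pow_lt; lra|easy]).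
    assert (Heps : 0 <= eps <= / (2 * IZR c)).
    { unfold eps. split; [apply Rdiv_le_0_compat; [apply Rmult_le_pos|]; lra|].
      apply IZR_le in Hni. rewrite !mult_IZR, <- INR_IZR_INZ in Hni.
      apply Rmult_le_reg_r with (2 * (IZR c ^ 2 * INR n)); [lra|].
      replace (/ (2 * IZR c) * (2 * (IZR c ^ 2 * INR n))) with (IZR c * INR n) by (field; lra).
      replace (IZR q2 * IZR m / (IZR c ^ 2 * INR n) * (2 * (IZR c ^ 2 * INR n)))
        with (2 * IZR q2 * IZR m) by (field; lra). lra. }
    assert (Hbz : beta = z + PI * IZR k).
    { assert (Ey : IZR q2 * IZR m * IZR a = IZR c * IZR k + IZR t).
      { rewrite <- !mult_IZR, <- plus_IZR. f_equal. fold y. lia. }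
      unfold beta, alpha. rewrite approach_value by easy.
      rewrite (INR_IZR_INZ (Z.to_nat q2)), Z2Nat.id by lia.
      rewrite (INR_IZR_INZ (S i)). fold m. unfold z, eps.
      replace (IZR t) with (IZR q2 * IZR m * IZR a - IZR c * IZR k) by lra.
      field. lra. }
    assert (Hti : / IZR c <= IZR t / IZR c <= 1 - / IZR c).
    { assert (1 <= IZR t) by (apply IZR_le; lia).
      assert (IZR t <= IZR c - 1) by (rewrite <- minus_IZR; apply IZR_le; lia).
      split; apply Rmult_le_reg_r with (IZR c); try lra; field_simplify; lra. }
    assert (Hhalf : / IZR c = 2 * / (2 * IZR c)) by (field; lra).
    assert (Hz : PI / (2 * IZR c) <= z <= PI - PI / (2 * IZR c)).
    { unfold z. unfold Rdiv at 1 4. nra. }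
    assert (Hsz : s <= sin z).
    { unfold s. destruct (Rle_dec z (PI / 2)).
      - apply sin_incr_1; lra.
      - rewrite <- (sin_PI_x z). apply sin_incr_1; lra. }
    apply Rsqr_incr_0_var; [|apply Rabs_pos].
    rewrite <- Rsqr_abs, !Rsqr_pow2, Hbz, sin_add_PI_Z. apply pow_incr. lra. }
  assert (Hsum : Rabs (rsum (trig_term (fun n0 => IZR (chi2 (Z.of_nat n0))) alpha
      (phi - beta + PI / 2)) (Z.to_nat q2)) <= IZR q2).
  { eapply Rle_trans; [apply rsum_abs|].
    replace (IZR q2) with (INR (Z.to_nat q2) * 1)
      by (rewrite INR_IZR_INZ, Z2Nat.id by lia; ring).
    rewrite <- rsum_const. apply rsum_le. intros j _. unfold trig_term.
    rewrite Rabs_mult. pose proof (character_abs q2 chi2 (Z.of_nat (S j)) H2).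
    pose proof (COS_bound (alpha * INR (S j) + (phi - beta + PI / 2))).
    rewrite <- (Rmult_1_r 1). apply Rmult_le_compat; auto using Rabs_pos; apply Rabs_le; lra. }
  pose proof (character_abs q1 chi1 (Z.of_nat (S i)) H1) as Hx.
  unfold Rdiv at 1. rewrite !Rabs_mult, Rabs_inv, Rabs_mult, (Rabs_pos_eq 2) by lra.
  rewrite <- (Rmult_1_l (IZR q2 / (2 * s))).
  apply Rmult_le_compat; auto using Rabs_pos.
  { apply Rmult_le_pos; [apply Rabs_pos|]. apply Rlt_le, Rinv_0_lt_compat. lra. }
  apply Rmult_le_compat; auto using Rabs_pos.
  { apply Rlt_le, Rinv_0_lt_compat. lra. }
  apply Rinv_le_contravar; lra.
Qed.

(** * Passage to the limit in the cusp series along the approaching cusps *)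

Lemma approach_lim a c : (0 < c)%Z ->
  is_lim_seq (fun n => IZR (approach_num a c (S n)) / IZR (approach_den c (S n)))
    (IZR a / IZR c).
Proof.
  intros Hc. apply (is_lim_seq_ext (fun n => IZR a / IZR c - / IZR c ^ 2 * / INR (S n))).
  { intros n. symmetry. now apply approach_value. }
  replace (Finite (IZR a / IZR c)) with (Finite (IZR a / IZR c - / IZR c ^ 2 * 0))
    by (f_equal; ring).
  apply is_lim_seq_minus'; [apply is_lim_seq_const|].
  apply (is_lim_seq_scal_l _ (/ IZR c ^ 2) (Finite 0)), is_lim_seq_inv_INR_S.
Qed.

(** The definition of [row_mean] averages over a period that grows with [n]; the closed form has a
    fixed number [q2] of terms and is continuous in the cusp wherever its sine does not vanish. *)
Lemma row_mean_approach_lim q1 q2 chi1 chi2 a c phi i :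
  character q1 chi1 -> character q2 chi2 -> cusp_fraction q1 q2 a c ->
  is_lim_seq (fun n => row_mean (Z.to_nat (approach_den c (S n)))
    (twist0 chi1 chi2 (IZR (approach_num a c (S n)) / IZR (approach_den c (S n))) phi) i)
    (row_mean (Z.to_nat c) (twist0 chi1 chi2 (IZR a / IZR c) phi) i).
Proof.
  intros H1 H2 Hac. assert (Hc : (0 < c)%Z) by apply Hac.
  destruct (Z.eq_dec (chi1 (Z.of_nat (S i))) 0) as [E|E].
  - rewrite (row_mean_zero q1 q2) by easy.
    apply (is_lim_seq_ext (fun _ => 0)); [|apply is_lim_seq_const].
    intros n. symmetry. apply (row_mean_zero q1 q2); auto. now apply approach_cusp_fraction.
  - set (f := fun x => let alpha := 2 * PI * x * INR (S i) in
      let beta := alpha * INR (Z.to_nat q2) / 2 in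
      IZR (chi1 (Z.of_nat (S i)))
      * (rsum (trig_term (fun n => IZR (chi2 (Z.of_nat n))) alpha (phi - beta + PI / 2))
        (Z.to_nat q2) / (2 * sin beta))).
    apply (is_lim_seq_ext (fun n => f (IZR (approach_num a c (S n)) / IZR (approach_den c (S n))))).
    { intros n. symmetry.
      apply (row_mean_twist0 q1 q2 chi1 chi2 H1 H2 _ _ phi i); [|easy].
      now apply approach_cusp_fraction. }
    destruct (row_mean_twist0 q1 q2 chi1 chi2 H1 H2 _ _ phi i Hac E) as [Hs ->].
    apply (is_lim_seq_continuous f); [|now apply approach_lim].
    unfold f. apply continuity_pt_mult; [now apply continuity_pt_const|].
    apply continuity_pt_div.
    + apply (rsum_continuity (fun j x => trig_term (fun n => IZR (chi2 (Z.of_nat n)))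
        (2 * PI * x * INR (S i)) (phi - 2 * PI * x * INR (S i) * INR (Z.to_nat q2) / 2 + PI / 2) j)).
      intros j. unfold trig_term. apply ex_derive_continuity_pt. auto_derive. easy.
    + apply ex_derive_continuity_pt. auto_derive. easy.
    + apply Rmult_integral_contrapositive_currified; [lra|exact Hs].
Qed.

(** The condition [1 <= p] is weight at least three: it provides a second power of [m] in the
    weights. *)
Lemma kern_at_0_le_inv_sq p i : (1 <= p)%nat ->
  kern p (2 * PI * INR (S i)) 0 <= INR (fact p) / INR (S i) ^ 2.
Proof.
  intros Hp. rewrite kern_at_0 by apply two_pi_nat_pos.
  pose proof PI2_1 as H. unfold PI2 in H.
  assert (Hi : 1 <= INR (S i)) by (apply (le_INR 1); lia).
  assert (Hs : INR (S i) <= 2 * PI * INR (S i)) by nra.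
  set (s := 2 * PI * INR (S i)) in *.
  apply Rmult_le_compat_l; [apply pos_INR|].
  apply Rinv_le_contravar; [apply pow_lt; lra|].
  apply Rle_trans with (s ^ 2); [apply pow_incr; lra|].
  apply Rle_pow; [lra|lia].
Qed.

Lemma inv_sq_sum M n : M <> O ->
  rsum (fun j => / INR (S (M + j)) ^ 2) n <= / INR M.
Proof.
  intros HM. assert (HM0 : 0 < INR M) by (apply lt_0_INR; lia).
  apply Rle_trans with (rsum (fun j => / INR (M + j) - / INR (M + S j)) n).
  - apply rsum_le. intros j _. rewrite Nat.add_succ_r, S_INR, plus_INR.
    pose proof (pos_INR j). set (y := INR M + INR j).
    assert (Hy : 0 < y) by (unfold y; lra).
    replace (/ y - / (y + 1)) with (/ (y * (y + 1))) by (field; lra).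
    apply Rinv_le_contravar; [apply Rmult_lt_0_compat; lra|]. simpl. nra.
  - rewrite (rsum_telescope (fun j => / INR (M + j))), Nat.add_0_r.
    assert (0 < / INR (M + n)); [|lra].
    apply Rinv_0_lt_compat, lt_0_INR. lia.
Qed.

Lemma cusp_limit_tail q1 q2 chi1 chi2 p a c phi V M :
  character q1 chi1 -> character q2 chi2 -> cusp_fraction q1 q2 a c ->
  cusp_limit chi1 chi2 p a c phi V ->
  Rabs (V - rsum (fun i => row_mean (Z.to_nat c) (twist0 chi1 chi2 (IZR a / IZR c) phi) i
     * kern p (2 * PI * INR (S i)) 0) M)
  <= 2 * (IZR c * sqrt (IZR c)) * kern p (2 * PI * INR (S M)) 0.
Proof.
  intros H1 H2 Hac HV. apply (is_lim_seq_abs_le _ _ _ _ HV). exists M. intros n Hn.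
  apply (abel_inequality _ (fun i => kern p (2 * PI * INR (S i)) 0)); auto.
  - intros i. now apply row_mean_psum_sqrt_bound with q1 q2.
  - intros i. apply kern_nonneg; [apply two_pi_nat_pos|lra].
  - intros i. apply kern_nat_decreasing. lra.
Qed.

Lemma sqrt_over_nat_small B eps : 0 < eps ->
  exists N, forall n, (N <= n)%nat -> B * sqrt (INR (S n)) / INR (S n) < eps.
Proof.
  intros He. set (X := Rabs B / eps).
  assert (HX : 0 <= X) by (apply Rdiv_le_0_compat; [apply Rabs_pos|easy]).
  destruct (nfloor_ex (X * X)) as [N [_ HN]]; [nra|].
  exists N. intros n Hn. set (s := sqrt (INR (S n))).
  assert (Hp : 0 < INR (S n)) by (apply lt_0_INR; lia).
  assert (Hs : 0 < s) by now apply sqrt_lt_R0.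
  assert (Hss : s * s = INR (S n)) by (apply sqrt_sqrt; lra).
  assert (HXs : X < s).
  { apply Rsqr_incrst_0; [|easy|lra]. unfold Rsqr. rewrite Hss.
    eapply Rlt_le_trans; [apply HN|]. rewrite <- S_INR. apply le_INR. lia. }
  rewrite <- Hss. replace (B * s / (s * s)) with (B / s) by (field; lra).
  apply Rmult_lt_reg_r with s; [easy|]. unfold Rdiv.
  rewrite Rmult_assoc, Rinv_l, Rmult_1_r by lra.
  apply Rmult_lt_compat_l with (r := eps) in HXs; [|easy].
  unfold X in HXs. replace (eps * (Rabs B / eps)) with (Rabs B) in HXs by (field; lra).
  pose proof (Rle_abs B). lra.
Qed.

(** Three ranges of rows at the approaching cusp: below [M] termwise convergence; from [M] to [s]
    the uniform bound against the sum of [1 / m^2]; beyond [s] the Abel tail. Together with the tail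
    of [V] they give four errors of [eps / 4]. *)
Lemma cusp_limit_approach q1 q2 chi1 chi2 p a c phi (V : R) :
  (1 <= p)%nat ->
  character q1 chi1 -> character q2 chi2 -> cusp_fraction q1 q2 a c ->
  cusp_limit chi1 chi2 p a c phi V ->
  forall eps, 0 < eps -> exists N, forall n, (N <= n)%nat -> forall Vn,
  cusp_limit chi1 chi2 p (approach_num a c (S n)) (approach_den c (S n)) phi Vn ->
  Rabs (Vn - V) < eps.
Proof.
  intros Hp H1 H2 Hac HV eps He.
  assert (Hc : (0 < c)%Z) by apply Hac.
  assert (Hq2 : (1 < q2)%Z) by apply H2.
  assert (Hc0 : 1 <= IZR c) by (apply IZR_le; lia).
  assert (Hq0 : 1 <= IZR q2) by (apply IZR_le; lia).
  set (w := fun i => kern p (2 * PI * INR (S i)) 0).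
  assert (Hw : forall i, 0 <= w i).
  { intros i. apply kern_nonneg; [apply two_pi_nat_pos|lra]. }
  destruct (row_mean_uniform_bound q1 q2 chi1 chi2 a c phi H1 H2 Hac) as (K & HK & HKb).
  set (F := INR (fact p)). assert (HF : 0 < F) by apply INR_fact_lt_0.
  set (B := IZR c * sqrt (IZR c)).
  assert (HB : 0 <= B) by (apply Rmult_le_pos; [lra|apply sqrt_pos]).
  destruct (kern_at_0_small p (eps / 4 / (2 * B + 1))) as (M1 & HM1).
  { apply Rdiv_lt_0_compat; lra. }
  destruct (archimed_cor1 (eps / 4 / (K * F + 1))) as (M2 & HM2 & HM2').
  { assert (0 <= K * F) by nra. apply Rdiv_lt_0_compat; lra. }
  set (M := (M1 + M2)%nat). specialize (HM1 M ltac:(lia)). fold (w M) in HM1.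
  set (D := fun n i => row_mean (Z.to_nat (approach_den c (S n)))
    (twist0 chi1 chi2 (IZR (approach_num a c (S n)) / IZR (approach_den c (S n))) phi) i).
  set (D0 := row_mean (Z.to_nat c) (twist0 chi1 chi2 (IZR a / IZR c) phi)).
  assert (LA : is_lim_seq (fun n => rsum (fun i => D n i * w i) M) (rsum (fun i => D0 i * w i) M)).
  { apply (is_lim_seq_rsum (fun i n => D n i * w i)). intros i _.
    apply (is_lim_seq_scal_r _ (w i) (Finite (D0 i))).
    now apply row_mean_approach_lim with q1 q2. }
  apply is_lim_seq_spec in LA. assert (He4 : 0 < eps / 4) by lra.
  destruct (LA (mkposreal _ He4)) as [N1 HN1]. cbn [pos] in HN1.
  (* With [y = n + 1] the Abel tail is [2 (c^2 y)^(3/2)] times the weight [F (2 q2)^2 / (c y)^2] at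
     the cut, which is [8 F q2^2 c sqrt(y) / y]. *)
  destruct (sqrt_over_nat_small (8 * F * IZR q2 ^ 2 * IZR c) (eps / 4) He4) as [N2 HN2].
  (* The last summand guarantees [M <= s]. *)
  exists (N1 + N2 + Z.to_nat (2 * q2) * M)%nat. intros n Hn Vn HVn.
  specialize (HN1 n ltac:(lia)). specialize (HN2 n ltac:(lia)).
  pose proof (approach_cusp_fraction q1 q2 a c (S n) Hac ltac:(lia)) as Hn'.
  (* The number of rows covered by the uniform bound. It grows linearly in [n], so that
     [c_n^(3/2) / s^2] tends to zero. *)
  set (s := Z.to_nat (c * Z.of_nat (S n) / (2 * q2))).
  assert (Hs1 : forall i, (i < s)%nat -> (2 * q2 * Z.of_nat (S i) <= c * Z.of_nat (S n))%Z).
  { intros i Hi. unfold s in Hi.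
    pose proof (Z.mul_div_le (c * Z.of_nat (S n)) (2 * q2) ltac:(lia)). nia. }
  assert (Hs2 : (c * Z.of_nat (S n) <= 2 * q2 * Z.of_nat (S s))%Z).
  { pose proof (Z.mul_succ_div_gt (c * Z.of_nat (S n)) (2 * q2) ltac:(lia)).
    assert (0 <= c * Z.of_nat (S n) / (2 * q2))%Z by (apply Z.div_pos; lia).
    assert (Es : Z.of_nat s = (c * Z.of_nat (S n) / (2 * q2))%Z) by (unfold s; lia).
    rewrite (Nat2Z.inj_succ s), Es. lia. }
  assert (HMs : (M <= s)%nat).
  { assert (Hn2 : (2 * q2 * Z.of_nat M <= c * Z.of_nat (S n))%Z).
    { assert (2 * q2 * Z.of_nat M <= Z.of_nat n)%Z by lia. nia. }
    assert (Z.of_nat M <= c * Z.of_nat (S n) / (2 * q2))%Z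
      by (apply Z.div_le_lower_bound; lia).
    unfold s. lia. }
  pose proof (cusp_limit_tail q1 q2 chi1 chi2 p a c phi V M H1 H2 Hac HV) as T0.
  pose proof (cusp_limit_tail q1 q2 chi1 chi2 p _ _ phi Vn s H1 H2 Hn' HVn) as T1.
  change (Rabs (V - rsum (fun i => D0 i * w i) M) <= 2 * B * w M) in T0.
  match type of T1 with _ <= ?b =>
    change (Rabs (Vn - rsum (fun i => D n i * w i) s) <= b) in T1 end.
  fold (w s) in T1.
  assert (E0 : 2 * B * w M <= eps / 4).
  { specialize (Hw M). apply Rle_trans with ((2 * B + 1) * w M); [nra|].
    apply Rmult_le_reg_l with (/ (2 * B + 1)); [apply Rinv_0_lt_compat; lra|].
    rewrite <- Rmult_assoc, Rinv_l, Rmult_1_l by lra.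
    rewrite (Rmult_comm _ (eps / 4)). apply Rlt_le, HM1. }
  assert (E1 : 2 * (IZR (approach_den c (S n)) * sqrt (IZR (approach_den c (S n)))) * w s
    <= eps / 4).
  { unfold approach_den. rewrite !mult_IZR, <- INR_IZR_INZ.
    set (y := INR (S n)) in *. assert (Hy : 0 < y) by (apply lt_0_INR; lia).
    rewrite sqrt_mult by nra. rewrite sqrt_square by lra.
    assert (Hws : w s <= F * (2 * IZR q2) ^ 2 / (IZR c * y) ^ 2).
    { eapply Rle_trans; [now apply kern_at_0_le_inv_sq|]. fold F.
      assert (Hs3 : IZR c * y <= 2 * IZR q2 * INR (S s)).
      { unfold y. rewrite !INR_IZR_INZ, <- !mult_IZR. now apply IZR_le. }
      assert (Hss : 0 < INR (S s)) by (apply lt_0_INR; lia).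
      apply Rmult_le_reg_r with (INR (S s) ^ 2 * (IZR c * y) ^ 2).
      { apply Rmult_lt_0_compat; apply pow_lt; nra. }
      replace (F / INR (S s) ^ 2 * (INR (S s) ^ 2 * (IZR c * y) ^ 2))
        with (F * (IZR c * y) ^ 2) by (field; lra).
      replace (F * (2 * IZR q2) ^ 2 / (IZR c * y) ^ 2 * (INR (S s) ^ 2 * (IZR c * y) ^ 2))
        with (F * (2 * IZR q2 * INR (S s)) ^ 2) by (field; lra).
      apply Rmult_le_compat_l; [lra|]. apply pow_incr. nra. }
    pose proof (sqrt_pos y).
    apply Rle_trans with (2 * (IZR c * IZR c * y * (IZR c * sqrt y))
      * (F * (2 * IZR q2) ^ 2 / (IZR c * y) ^ 2)).
    - apply Rmult_le_compat_l; [|easy]. repeat apply Rmult_le_pos; lra.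
    - apply Rlt_le. eapply Rle_lt_trans; [|exact HN2]. right. field. lra. }
  assert (E2 : Rabs (rsum (fun i => D n i * w i) s - rsum (fun i => D n i * w i) M) <= eps / 4).
  { replace s with (M + (s - M))%nat at 1 by lia. rewrite rsum_app.
    replace (_ + _ - _) with (rsum (fun j => D n (M + j)%nat * w (M + j)%nat) (s - M)) by lra.
    eapply Rle_trans; [apply rsum_abs|].
    apply Rle_trans with (rsum (fun j => K * F * / INR (S (M + j)) ^ 2) (s - M)).
    - apply rsum_le. intros j Hj. rewrite Rabs_mult, Rmult_assoc, (Rabs_pos_eq (w _)) by auto.
      apply Rmult_le_compat; auto using Rabs_pos.
      + apply HKb. apply Hs1. lia.
      + now apply kern_at_0_le_inv_sq.
    - rewrite rsum_scal. assert (HKF : 0 <= K * F) by nra.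
      apply Rle_trans with (K * F * / INR M).
      + apply Rmult_le_compat_l; [easy|]. apply inv_sq_sum. unfold M. lia.
      + assert (HM0 : / INR M <= / INR M2).
        { apply Rinv_le_contravar; [now apply lt_0_INR|]. apply le_INR. unfold M. lia. }
        assert (HMp : 0 < / INR M2) by (apply Rinv_0_lt_compat, lt_0_INR; easy).
        apply Rle_trans with ((K * F + 1) * / INR M2).
        * apply Rmult_le_compat; try lra. apply Rlt_le, Rinv_0_lt_compat, lt_0_INR.
          unfold M. lia.
        * apply Rmult_le_reg_l with (/ (K * F + 1)); [apply Rinv_0_lt_compat; lra|].
          rewrite <- Rmult_assoc, Rinv_l, Rmult_1_l by lra.
          rewrite (Rmult_comm _ (eps / 4)). apply Rlt_le, HM2. }
  apply Rabs_le_between in T0, T1, E2. apply Rabs_lt_between in HN1. apply Rabs_lt_between.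
  lra.
Qed.

Lemma Shat_fin_approach q1 q2 chi1 chi2 k a c :
  (3 <= k)%nat ->
  character q1 chi1 -> character q2 chi2 -> cusp_fraction q1 q2 a c ->
  let f n := Shat_fin chi1 chi2 q1 k
    (IZR (approach_num a c (S n)) / IZR (approach_den c (S n))) in
  let l := Shat_fin chi1 chi2 q1 k (IZR a / IZR c) in
  is_lim_seq (fun n => Re (f n)) (Re l) /\ is_lim_seq (fun n => Im (f n)) (Im l).
Proof.
  intros Hk H1 H2 Hac f l.
  destruct (Shat_fin_formula chi1 chi2 q1 q2 k a c ltac:(lia) H1 H2 Hac)
    as (V0 & V1 & L0 & L1 & E).
  set (K := Shat_const chi1 q1 k) in *. destruct K as [al be] eqn:EK.
  assert (HA : forall eps, 0 < eps -> exists N, forall n, (N <= n)%nat ->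
    exists u v, Rabs u < eps /\ Rabs v < eps /\
    f n = (al * (V0 + u) - be * (V1 + v), al * (V1 + v) + be * (V0 + u))).
  { intros eps He.
    destruct (cusp_limit_approach q1 q2 chi1 chi2 (k - 2) a c 0 V0 ltac:(lia) H1 H2 Hac L0 eps He)
      as [N0 HN0].
    destruct (cusp_limit_approach q1 q2 chi1 chi2 (k - 2) a c (- (PI / 2)) V1
      ltac:(lia) H1 H2 Hac L1 eps He) as [N1 HN1].
    exists (N0 + N1)%nat. intros n Hn.
    destruct (Shat_fin_formula chi1 chi2 q1 q2 k _ _ ltac:(lia) H1 H2
      (approach_cusp_fraction q1 q2 a c (S n) Hac ltac:(lia))) as (W0 & W1 & M0 & M1 & E').
    exists (W0 - V0), (W1 - V1). split; [now apply (HN0 n ltac:(lia))|].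
    split; [now apply (HN1 n ltac:(lia))|].
    unfold f. rewrite E'. fold K. rewrite EK. unfold Cmult; cbn [fst snd]. f_equal; ring. }
  assert (Hab : 0 < Rabs al + Rabs be + 1).
  { pose proof (Rabs_pos al). pose proof (Rabs_pos be). lra. }
  assert (HB : forall eps u v, 0 < eps -> Rabs u < eps / (Rabs al + Rabs be + 1) ->
    Rabs v < eps / (Rabs al + Rabs be + 1) ->
    Rabs (al * u - be * v) < eps /\ Rabs (al * v + be * u) < eps).
  { intros eps u v He Hu Hv. set (d := eps / (Rabs al + Rabs be + 1)) in *.
    assert (Ed : eps = (Rabs al + Rabs be + 1) * d) by (unfold d; field; lra).
    assert (Hd : 0 < d) by (apply Rdiv_lt_0_compat; lra).
    pose proof (Rabs_pos al). pose proof (Rabs_pos be).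
    assert (P : forall x y, Rabs y < d -> Rabs (x * y) <= Rabs x * d).
    { intros x y Hy. rewrite Rabs_mult. apply Rmult_le_compat_l; [apply Rabs_pos|lra]. }
    pose proof (P al u Hu) as P1. pose proof (P be v Hv) as P2.
    pose proof (P al v Hv) as P3. pose proof (P be u Hu) as P4.
    apply Rabs_le_between in P1, P2, P3, P4.
    split; apply Rabs_lt_between; nra. }
  split; apply is_lim_seq_eps; intros eps He;
    (destruct (HA (eps / (Rabs al + Rabs be + 1))) as [N HN]; [apply Rdiv_lt_0_compat; lra|]);
    exists N; intros n Hn; destruct (HN n Hn) as (u & v & Hu & Hv & Ef);
    rewrite Ef; unfold l; rewrite E; cbn [Re Im fst snd Cmult];
    destruct (HB eps u v He Hu Hv) as [B1 B2].
  - replace (_ - _) with (al * u - be * v) by ring. exact B1.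
  - replace (_ - _) with (al * v + be * u) by ring. exact B2.
Qed.

(** * Cusps and cocycles *)

(** Invariance under [z -> z + 1], read off the series: an integer shift of the cusp changes every
    angle by a multiple of [2 PI]. *)
Lemma Shat_fin_shift q1 q2 chi1 chi2 k a c n :
  (2 <= k)%nat -> character q1 chi1 -> character q2 chi2 -> cusp_fraction q1 q2 a c ->
  Shat_fin chi1 chi2 q1 k (IZR (a + n * c) / IZR c) = Shat_fin chi1 chi2 q1 k (IZR a / IZR c).
Proof.
  intros Hk H1 H2 Hac. assert (Hc : (0 < c)%Z) by apply Hac.
  assert (Hac' : cusp_fraction q1 q2 (a + n * c) c).
  { destruct Hac as (_ & Hg & Hd). repeat split; auto.
    rewrite Z.gcd_comm, Z.gcd_add_mult_diag_r, Z.gcd_comm. exact Hg. }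
  destruct (Shat_fin_formula chi1 chi2 q1 q2 k a c Hk H1 H2 Hac) as (V0 & V1 & L0 & L1 & ->).
  destruct (Shat_fin_formula chi1 chi2 q1 q2 k _ c Hk H1 H2 Hac') as (W0 & W1 & M0 & M1 & ->).
  assert (E : forall phi V W, cusp_limit chi1 chi2 (k - 2) a c phi V ->
    cusp_limit chi1 chi2 (k - 2) (a + n * c) c phi W -> W = V).
  { intros phi V W HV HW. apply (is_lim_seq_inj _ _ _ HW). revert HV.
    apply is_lim_seq_ext. intros M. symmetry. apply rsum_ext. intros i _. f_equal.
    unfold row_mean. f_equal. apply rsum_ext. intros j _. apply rsum_ext. intros j' _.
    unfold twist0, twist. f_equal.
    rewrite <- (cos_add_two_pi_Z (2 * PI * (IZR a / IZR c) * INR (S i) * INR (S j') + phi)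
      (n * Z.of_nat (S i) * Z.of_nat (S j'))). f_equal.
    rewrite plus_IZR, !mult_IZR, <- !INR_IZR_INZ. field. apply not_0_IZR; lia. }
  now rewrite (E _ _ _ L0 M0), (E _ _ _ L1 M1).
Qed.

(** * Integrality of the values, and the action of the group on primitive vectors *)

Definition multiples (m : R) (q : Z) (z : C) : Prop := exists n : Z, z = RtoC (m * IZR n / IZR q).

Lemma multiples_plus m q z w : multiples m q z -> multiples m q w -> multiples m q (z + w)%C.
Proof.
  intros [n ->] [r ->]. exists (n + r)%Z. rewrite <- RtoC_plus, plus_IZR.
  f_equal. unfold Rdiv; ring.
Qed.

Lemma multiples_scal m q (r : Z) z : multiples m q z -> multiples m q (RtoC (IZR r) * z)%C.
Proof.
  intros [n ->]. exists (r * n)%Z. rewrite <- RtoC_mult, mult_IZR. f_equal. unfold Rdiv; ring.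
Qed.

Lemma multiples_opp m q z : multiples m q z -> multiples m q (- z)%C.
Proof.
  intros [n ->]. exists (- n)%Z. rewrite <- RtoC_opp, opp_IZR. f_equal. unfold Rdiv; ring.
Qed.

Lemma multiples_0 m q : multiples m q 0%C.
Proof. exists 0%Z. f_equal. unfold Rdiv; ring. Qed.

Lemma poly_eval_rsum k coef x : (2 <= k)%nat ->
  poly_eval k coef x = rsum (fun n => Q2R (coef n) * x ^ (k - 2 - n)) (S (k - 2)).
Proof.
  intros Hk. unfold poly_eval. replace (k - 1)%nat with (S (k - 2)) by lia.
  assert (F : forall f n s, fold_right Rplus 0 (map f (seq s n))
    = rsum (fun i => f (s + i)%nat) n).
  { intros f n. induction n as [|n IH]; intros s; [easy|].
    rewrite rsum_S_l, Nat.add_0_r. cbn [seq map fold_right]. rewrite IH. f_equal.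
    apply rsum_ext. intros i _. f_equal. lia. }
  rewrite F. apply rsum_ext. intros n _. do 2 f_equal. lia.
Qed.

(** With [c = w q], the term [c^(k-2) a_n (A / c)^(k-2-n)] equals [w^n A^(k-2-n) q^n a_n], and
    [q^n a_n] lies in [mZ / q] by the condition on [q^(n+1) a_n]. *)
Lemma poly_eval_multiples k m q coef A c :
  (2 <= k)%nat -> (0 < q)%Z -> in_Pkmq k m q coef -> (q | c)%Z -> c <> 0%Z ->
  multiples m q (RtoC (IZR c ^ (k - 2) * poly_eval k coef (IZR A / IZR c))).
Proof.
  intros Hk Hq Hin [w ->] Hc.
  assert (Hq0 : IZR q <> 0) by (apply not_0_IZR; lia).
  assert (Hw0 : IZR w <> 0) by (apply not_0_IZR; lia).
  rewrite poly_eval_rsum, <- rsum_scal by easy.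
  assert (H : forall n, (n <= S (k - 2))%nat -> exists z : Z,
    rsum (fun n => IZR (w * q) ^ (k - 2) * (Q2R (coef n)
      * (IZR A / IZR (w * q)) ^ (k - 2 - n))) n = m * IZR z / IZR q).
  { induction n as [|n IH]; intros Hn.
    - exists 0%Z. simpl. unfold Rdiv; ring.
    - destruct IH as [z Hz]; [lia|]. destruct (Hin n ltac:(lia)) as [t Ht].
      exists (z + t * A ^ Z.of_nat (k - 2 - n) * w ^ Z.of_nat n)%Z.
      cbn [rsum]. rewrite Hz, plus_IZR, !mult_IZR, <- !pow_IZR.
      replace (IZR w * IZR q) with (IZR q * IZR w) by ring.
      replace (k - 2)%nat with (n + (k - 2 - n))%nat at 1 by lia.
      rewrite pow_add. unfold Rdiv at 2. rewrite !Rpow_mult_distr, pow_inv, !Rpow_mult_distr.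
      assert (Ht' : IZR q ^ n * Q2R (coef n) = m * IZR t / IZR q).
      { rewrite <- Ht, pow_add. field. easy. }
      replace (IZR q ^ n * IZR w ^ n * (IZR q ^ (k - 2 - n) * IZR w ^ (k - 2 - n)) *
        (Q2R (coef n) * (IZR A ^ (k - 2 - n) * / (IZR q ^ (k - 2 - n) * IZR w ^ (k - 2 - n)))))
        with (IZR q ^ n * Q2R (coef n) * IZR w ^ n * IZR A ^ (k - 2 - n)).
      + rewrite Ht'. field. easy.
      + field. split; now apply pow_nonzero. }
  destruct (H _ (le_n _)) as [z Hz]. exists z. now rewrite Hz.
Qed.

(** A cusp is represented by a primitive integer vector. *)
Definition Shat_vec (chi1 chi2 : Z -> Z) (q1 : Z) (k : nat) (A c : Z) : C :=
  if Z.eqb c 0 then 0%C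
  else (RtoC (IZR c ^ (k - 2)) * Shat_fin chi1 chi2 q1 k (IZR A / IZR c))%C.

Definition orbit_vec (N A c : Z) : Prop := exists g, Gamma0 N g /\ ma g = A /\ mc g = c.

Lemma Gamma0_mmul N g h : Gamma0 N g -> Gamma0 N h -> Gamma0 N (mmul g h).
Proof.
  intros [Dg [r Hr]] [Dh [s Hs]]. split; unfold mmul; cbn [ma mb mc md].
  - transitivity ((ma g * md g - mb g * mc g) * (ma h * md h - mb h * mc h))%Z; [ring|].
    rewrite Dg, Dh. easy.
  - exists (r * ma h + md g * s)%Z. rewrite Hr, Hs. ring.
Qed.

Lemma Gamma0_minv N g : Gamma0 N g -> Gamma0 N (minv g).
Proof.
  intros [Dg [r Hr]]. split; unfold minv; cbn [ma mb mc md]; [lia|].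
  exists (- r)%Z. lia.
Qed.

Lemma orbit_vec_act N g A c : Gamma0 N g -> orbit_vec N A c ->
  orbit_vec N (ma g * A + mb g * c) (mc g * A + md g * c).
Proof.
  intros Hg (h & Hh & <- & <-). exists (mmul g h). split; [now apply Gamma0_mmul|easy].
Qed.

Lemma orbit_vec_cusp N A c : orbit_vec N A c -> c <> 0%Z ->
  finite_Gamma0_cusp N (IZR A / IZR c).
Proof.
  intros (g & Hg & <- & <-) Hc. exists g. split; [easy|].
  unfold act_cusp. now rewrite (proj2 (Z.eqb_neq _ _) Hc).
Qed.

Lemma orbit_vec_fraction q1 q2 A c : orbit_vec (q1 * q2) A c -> (0 < c)%Z ->
  cusp_fraction q1 q2 A c.
Proof.
  intros (g & [Dg Hd] & <- & <-) Hc. repeat split; auto.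
  apply Zgcd_1_rel_prime, bezout_rel_prime. apply Bezout_intro with (md g) (- mb g)%Z. lia.
Qed.

(** With [c'] the lower entry of the image vector, [j(g, A / c) = c' / c], so homogenizing by
    [c^(k-2)] absorbs the automorphy factor. When [c' = 0] both sides use the value zero at
    infinity. *)
Lemma hfun_vec chi1 chi2 q1 k g A c : c <> 0%Z ->
  (RtoC (IZR c ^ (k - 2)) * hfun chi1 chi2 q1 k g (IZR A / IZR c))%C
  = (Shat_vec chi1 chi2 q1 k A c
     - Shat_vec chi1 chi2 q1 k (ma g * A + mb g * c) (mc g * A + md g * c))%C.
Proof.
  intros Hc. set (A' := (ma g * A + mb g * c)%Z). set (c' := (mc g * A + md g * c)%Z).
  assert (Hc0 : IZR c <> 0) by now apply not_0_IZR.
  assert (Ej : IZR (mc g) * (IZR A / IZR c) + IZR (md g) = IZR c' / IZR c).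
  { unfold c'. rewrite plus_IZR, !mult_IZR. field. easy. }
  assert (En : IZR (ma g) * (IZR A / IZR c) + IZR (mb g) = IZR A' / IZR c).
  { unfold A'. rewrite plus_IZR, !mult_IZR. field. easy. }
  unfold hfun, jfac, Shat_vec. rewrite (proj2 (Z.eqb_neq _ _) Hc).
  unfold act_cusp. rewrite Ej, En.
  destruct (Z.eqb_spec c' 0) as [E|E].
  - rewrite E. destruct (Req_EM_T (0 / IZR c) 0) as [_|Hn]; [|exfalso; apply Hn; field; easy].
    unfold Shat. ring.
  - assert (Hc0' : IZR c' <> 0) by now apply not_0_IZR.
    destruct (Req_EM_T (IZR c' / IZR c) 0) as [H0|_].
    + exfalso. apply Hc0'. apply (Rmult_eq_reg_r (/ IZR c)); [|now apply Rinv_neq_0_compat].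
      rewrite Rmult_0_l. exact H0.
    + unfold Shat.
      replace (IZR A' / IZR c / (IZR c' / IZR c)) with (IZR A' / IZR c') by (field; easy).
      assert (Ep : IZR c' ^ (k - 2) = IZR c ^ (k - 2) * (IZR c' / IZR c) ^ (k - 2)).
      { rewrite <- Rpow_mult_distr. f_equal. field. easy. }
      rewrite Ep, RtoC_mult. ring.
Qed.

(** A cusp determines its vector only up to sign; the sign costs the integer [(-1)^(k-2)], which
    preserves [multiples]. *)
Lemma Shat_vec_neg chi1 chi2 q1 k A c :
  Shat_vec chi1 chi2 q1 k (- A) (- c)
  = (RtoC (IZR ((-1) ^ Z.of_nat (k - 2))) * Shat_vec chi1 chi2 q1 k A c)%C.
Proof.
  unfold Shat_vec. destruct (Z.eqb_spec c 0) as [->|E]; [simpl; ring|].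
  rewrite (proj2 (Z.eqb_neq _ _)) by lia.
  assert (Hc0 : IZR c <> 0) by now apply not_0_IZR.
  rewrite !opp_IZR. replace (- IZR A / - IZR c) with (IZR A / IZR c) by (field; easy).
  replace (- IZR c) with ((-1) * IZR c) by ring.
  rewrite Rpow_mult_distr, RtoC_mult, <- pow_IZR. ring.
Qed.

(** In the variable [u = 1 / (n + 1)] the quotient is a polynomial whose value at [u = 0] is the
    leading coefficient. *)
Lemma poly_eval_leading_coef k coef b : (2 <= k)%nat ->
  is_lim_seq (fun n => poly_eval k coef (INR (S n) + b) / INR (S n) ^ (k - 2)) (Q2R (coef O)).
Proof.
  intros Hk. set (p := (k - 2)%nat).
  set (f := fun u => rsum (fun j => Q2R (coef j) * ((1 + b * u) ^ (p - j) * u ^ j)) (S p)).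
  apply (is_lim_seq_ext (fun n => f (/ INR (S n)))).
  - intros n. rewrite poly_eval_rsum by easy. fold p. unfold f, Rdiv.
    rewrite (Rmult_comm (rsum _ _)), <- rsum_scal. apply rsum_ext. intros j Hj.
    assert (Hn : INR (S n) <> 0) by (apply not_0_INR; lia).
    set (y := INR (S n)) in *.
    replace (1 + b * / y) with ((y + b) * / y) by (field; easy).
    replace (y ^ p) with (y ^ (p - j) * y ^ j) by (rewrite <- pow_add; f_equal; lia).
    rewrite Rpow_mult_distr, !pow_inv. field. split; now apply pow_nonzero.
  - replace (Q2R (coef O)) with (f 0).
    + apply is_lim_seq_continuous; [|exact is_lim_seq_inv_INR_S].
      apply (rsum_continuity (fun j u => Q2R (coef j) * ((1 + b * u) ^ (p - j) * u ^ j))).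
      intros j. apply ex_derive_continuity_pt. auto_derive. easy.
    + unfold f. rewrite (rsum_single _ _ O).
      * rewrite Rmult_0_r, Rplus_0_r, pow1. simpl. ring.
      * lia.
      * intros j _ Hj. rewrite (pow_i j) by lia. ring.
Qed.

(** The path between cusps may start with the step from infinity to [g(infinity)], about
    which the hypothesis on [h_g], restricted to finite cusps, says nothing. *)
Lemma Shat_vec_generator k chi1 chi2 q1 q2 m g coef :
  (2 <= k)%nat -> character q1 chi1 -> character q2 chi2 ->
  IZR (chi1 (-1)%Z * chi2 (-1)%Z) = (-1) ^ k ->
  Gamma1 (q1 * q2) g -> mc g <> 0%Z -> in_Pkmq k m q1 coef ->
  (forall a, finite_Gamma0_cusp (q1 * q2)%Z a ->
     hfun chi1 chi2 q1 k g a = RtoC (poly_eval k coef a)) ->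
  multiples m q1 (Shat_vec chi1 chi2 q1 k (ma g) (mc g)).
Proof.
  intros Hk H1 H2 Hpar [Hg0 [Ha Hd]] Hc Hin Hh.
  assert (Hq1 : (1 < q1)%Z) by apply H1. assert (Hq2 : (1 < q2)%Z) by apply H2.
  assert (Hdet : (ma g * md g - mb g * mc g = 1)%Z) by apply Hg0.
  set (a := ma g) in *. set (b := mb g) in *. set (c := mc g) in *. set (d := md g) in *.
  assert (Hc0 : IZR c <> 0) by now apply not_0_IZR.
  assert (Hda : (q1 * q2 | a - 1)%Z) by (apply Z.mod_divide; [nia|];
    rewrite Zminus_mod, Ha, Z.sub_diag; apply Zmod_0_l).
  assert (Hdd : (q1 * q2 | d - 1)%Z) by (apply Z.mod_divide; [nia|];
    rewrite Zminus_mod, Hd, Z.sub_diag; apply Zmod_0_l).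
  assert (Hq1c : (q1 | c)%Z).
  { destruct Hg0 as [_ [w Hw]]. exists (w * q2)%Z. fold c in Hw. lia. }
  (* The first column of [T^n g^-1]. *)
  assert (Horb : forall n : Z, orbit_vec (q1 * q2) (d - n * c) (- c)).
  { intros n. exists (mmul (mkM2Z 1 n 0 1) (minv g)). split; [apply Gamma0_mmul|split].
    - split; cbn [ma mb mc md]; [lia|apply Z.divide_0_r].
    - now apply Gamma0_minv.
    - unfold mmul, minv; cbn [ma mb mc md]. fold c d. ring.
    - unfold mmul, minv; cbn [ma mb mc md]. fold c a. ring. }
  assert (Horb_a : orbit_vec (q1 * q2) a c) by now exists g.
  (* By determinant one, [g] sends this vector to the first column of [g T^n g^-1], which for
     [n > 0] represents the approaching cusp. *)
  assert (Hstep : forall n : Z,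
    (RtoC (IZR (- c) ^ (k - 2)) * RtoC (poly_eval k coef (IZR (d - n * c) / IZR (- c))))%C
    = (Shat_vec chi1 chi2 q1 k (d - n * c) (- c)
      - Shat_vec chi1 chi2 q1 k (1 - a * c * n) (- (c * c * n)))%C).
  { intros n. rewrite <- Hh by (apply orbit_vec_cusp; [apply Horb|lia]).
    rewrite hfun_vec by lia. fold a b c d.
    replace (a * (d - n * c) + b * - c)%Z with (1 - a * c * n)%Z by lia.
    replace (c * (d - n * c) + d * - c)%Z with (- (c * c * n))%Z by lia. reflexivity. }
  destruct (Nat.eq_dec k 2) as [Ek|Ek].
  (* For [n = 0] the vector is carried to infinity, where [Shat_vec] is zero, so [h_g] yields
     [Shat(g^-1(infinity))] itself. *)
  - assert (HS : multiples m q1 (Shat_fin chi1 chi2 q1 k (IZR d / IZR (- c)))).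
    { specialize (Hstep 0%Z). replace (d - 0 * c)%Z with d in Hstep by lia.
      replace (- (c * c * 0))%Z with 0%Z in Hstep by lia.
      pose proof (poly_eval_multiples k m q1 coef d (- c) Hk ltac:(lia) Hin
        ltac:(now apply Z.divide_opp_r) ltac:(lia)) as HM.
      rewrite RtoC_mult, Hstep in HM. unfold Shat_vec in HM.
      rewrite (proj2 (Z.eqb_neq (- c) 0)) in HM by lia. rewrite Z.eqb_refl in HM.
      replace (k - 2)%nat with O in HM by lia.
      replace (RtoC (IZR (- c) ^ 0) * Shat_fin chi1 chi2 q1 k (IZR d / IZR (- c)) - 0)%C
        with (Shat_fin chi1 chi2 q1 k (IZR d / IZR (- c))) in HM by (simpl; ring).
      exact HM. }
    assert (HR : Shat_fin chi1 chi2 q1 k (IZR a / IZR c)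
      = (- Shat_fin chi1 chi2 q1 k (IZR d / IZR (- c)))%C).
    { assert (Hp : chi1 (-1)%Z = chi2 (-1)%Z).
      { subst k. replace ((-1) ^ 2) with 1 in Hpar by ring. apply eq_IZR in Hpar.
        destruct (character_minus_one q1 chi1 H1) as [E1|E1],
          (character_minus_one q2 chi2 H2) as [E2|E2]; rewrite E1, E2 in *; lia. }
      rewrite Ek. destruct (Z_lt_dec 0 c) as [Hpos|Hneg].
      - rewrite (Shat_reciprocity_weight_two q1 q2 chi1 chi2 a d c); auto.
        + do 2 f_equal. rewrite !opp_IZR. field. easy.
        + now apply orbit_vec_fraction.
        + exists b. lia.
      - rewrite (Shat_reciprocity_weight_two q1 q2 chi1 chi2 d a (- c)); auto.
        + replace (IZR (- a) / IZR (- c)) with (IZR a / IZR c)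
            by (rewrite !opp_IZR; field; easy). ring.
        + apply orbit_vec_fraction; [|lia]. specialize (Horb 0%Z).
          now replace (d - 0 * c)%Z with d in Horb by lia.
        + exists (- b)%Z. lia. }
    unfold Shat_vec. rewrite (proj2 (Z.eqb_neq c 0)) by easy.
    replace (k - 2)%nat with O by lia. rewrite HR. simpl (IZR c ^ 0).
    rewrite Cmult_1_l. now apply multiples_opp.
  (* [q1 a_0 = m t], and the value will turn out to be [- a_0]. *)
  - destruct (Hin O ltac:(lia)) as [t Ht]. exists (- t)%Z.
    assert (Hq0 : IZR q1 <> 0) by (apply not_0_IZR; lia).
    assert (E0 : m * IZR (- t) / IZR q1 = - Q2R (coef O)).
    { rewrite opp_IZR. simpl in Ht. rewrite Rmult_1_r in Ht.
      replace (m * - IZR t) with (- (m * IZR t)) by ring. rewrite <- Ht. field. easy. }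
    rewrite E0. unfold Shat_vec. rewrite (proj2 (Z.eqb_neq c 0)) by easy.
    set (p := (k - 2)%nat) in *.
    (* [cusp_fraction] asks for a positive denominator; the sign of [c] is moved to the
       numerator. *)
    set (e := if Z_lt_dec 0 c then 1%Z else (-1)%Z).
    assert (Hec : (0 < e * c)%Z) by (unfold e; destruct (Z_lt_dec 0 c); lia).
    assert (He2 : (e * e = 1)%Z) by (unfold e; destruct (Z_lt_dec 0 c); lia).
    assert (He0 : IZR e <> 0) by (apply not_0_IZR; nia).
    assert (Hfrac : cusp_fraction q1 q2 (e * a) (e * c)).
    { apply orbit_vec_fraction; [|easy]. unfold e. destruct (Z_lt_dec 0 c).
      - now rewrite !Z.mul_1_l.
      - exists (mmul (mkM2Z (-1) 0 0 (-1)) g). split; [apply Gamma0_mmul; [|easy]|split].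
        + split; cbn [ma mb mc md]; [lia|apply Z.divide_0_r].
        + unfold mmul; cbn [ma mb mc md]. fold a c. ring.
        + unfold mmul; cbn [ma mb mc md]. fold a c. ring. }
    assert (Hfrac' : cusp_fraction q1 q2 (- e * d) (e * c)).
    { apply orbit_vec_fraction; [|easy]. unfold e. destruct (Z_lt_dec 0 c).
      - exists (mmul (mkM2Z (-1) 0 0 (-1)) (minv g)). split; [apply Gamma0_mmul|split].
        + split; cbn [ma mb mc md]; [lia|apply Z.divide_0_r].
        + now apply Gamma0_minv.
        + unfold mmul, minv; cbn [ma mb mc md]. fold d c. ring.
        + unfold mmul, minv; cbn [ma mb mc md]. fold a c. ring.
      - specialize (Horb 0%Z). replace (d - 0 * c)%Z with d in Horb by lia.
        replace (- -1 * d)%Z with d by lia. now replace (-1 * c)%Z with (- c)%Z by lia. }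
    destruct (Shat_fin_approach q1 q2 chi1 chi2 k _ _ ltac:(lia) H1 H2 Hfrac) as [LR LI].
    replace (IZR (e * a) / IZR (e * c)) with (IZR a / IZR c) in LR, LI
      by (rewrite !mult_IZR; field; easy).
    set (l := Shat_fin chi1 chi2 q1 k (IZR a / IZR c)) in *.
    set (x := fun n => IZR (approach_num (e * a) (e * c) (S n)) / IZR (approach_den (e * c) (S n))) in *.
    set (z := Shat_fin chi1 chi2 q1 k (IZR (- e * d) / IZR (e * c))).
    (* By the integer shift, [z] does not depend on [n]. The common factor [(-c)^p] is cancelled,
       and division by [(n + 1)^p] isolates the value at the approaching cusp; as [p >= 1], the term
       in [z] dies in the limit. *)
    assert (Hid : forall n, (RtoC (IZR c ^ p) * Shat_fin chi1 chi2 q1 k (x n))%C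
      = ((z - RtoC (poly_eval k coef (INR (S n) + - (IZR d / IZR c)))) * RtoC (/ INR (S n) ^ p))%C).
    { intros n. assert (Hn : INR (S n) <> 0) by (apply not_0_INR; lia).
      specialize (Hstep (Z.of_nat (S n))). unfold Shat_vec in Hstep. fold p in Hstep.
      rewrite (proj2 (Z.eqb_neq (- c) 0)) in Hstep by lia.
      rewrite (proj2 (Z.eqb_neq (- (c * c * Z.of_nat (S n))) 0)) in Hstep by nia.
      replace (IZR (d - Z.of_nat (S n) * c) / IZR (- c))
        with (IZR (- e * d + Z.of_nat (S n) * (e * c)) / IZR (e * c)) in Hstep at 2.
      2:{ rewrite plus_IZR, minus_IZR, opp_IZR, !mult_IZR, opp_IZR. field. split; easy. }
      rewrite (Shat_fin_shift q1 q2) in Hstep by easy. fold z in Hstep.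
      replace (IZR (d - Z.of_nat (S n) * c) / IZR (- c))
        with (INR (S n) + - (IZR d / IZR c)) in Hstep.
      2:{ rewrite minus_IZR, opp_IZR, !mult_IZR, <- INR_IZR_INZ. field. easy. }
      replace (IZR (1 - a * c * Z.of_nat (S n)) / IZR (- (c * c * Z.of_nat (S n))))
        with (x n) in Hstep.
      2:{ unfold x, approach_num, approach_den.
          replace (e * a * (e * c) * Z.of_nat (S n))%Z with ((e * e) * (a * c * Z.of_nat (S n)))%Z by ring.
          replace (e * c * (e * c) * Z.of_nat (S n))%Z with ((e * e) * (c * c * Z.of_nat (S n)))%Z by ring.
          rewrite He2, !Z.mul_1_l, !minus_IZR, opp_IZR, !mult_IZR, <- INR_IZR_INZ. field. split; easy. }
      replace (IZR (- (c * c * Z.of_nat (S n))) ^ p)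
        with (IZR (- c) ^ p * (IZR c ^ p * INR (S n) ^ p)) in Hstep.
      2:{ rewrite !opp_IZR, !mult_IZR, <- INR_IZR_INZ, <- !Rpow_mult_distr. f_equal. ring. }
      set (P := poly_eval k coef (INR (S n) + - (IZR d / IZR c))) in *.
      set (y := INR (S n)) in *.
      assert (Hyp : y ^ p <> 0) by now apply pow_nonzero.
      assert (Hcp : RtoC (IZR (- c) ^ p) <> 0%C).
      { intros E. apply RtoC_inj in E. revert E. apply pow_nonzero. rewrite opp_IZR. lra. }
      rewrite !RtoC_mult in Hstep.
      assert (Hs' : RtoC P = (z - RtoC (IZR c ^ p) * RtoC (y ^ p) * Shat_fin chi1 chi2 q1 k (x n))%C).
      { set (r := RtoC (IZR (- c) ^ p)) in *.
        transitivity (/ r * (r * RtoC P))%C; [field; easy|]. rewrite Hstep. field. easy. }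
      rewrite Hs'. rewrite RtoC_inv by easy.
      assert (Hyc : RtoC (y ^ p) <> 0%C) by (intros E; apply RtoC_inj in E; easy).
      field. exact Hyc. }
    pose proof (poly_eval_leading_coef k coef (- (IZR d / IZR c)) Hk) as Llead. fold p in Llead.
    assert (Hinv : forall r : R, is_lim_seq (fun n => r * / INR (S n) ^ p) 0).
    { intros r. replace (Finite 0) with (Rbar_mult r 0) by (simpl; f_equal; ring).
      apply is_lim_seq_scal_l.
      apply (is_lim_seq_le_le (fun _ => 0) _ (fun n => / INR (S n))).
      - intros n. assert (Hy : 1 <= INR (S n)) by (apply (le_INR 1); lia). split.
        + apply Rlt_le, Rinv_0_lt_compat, pow_lt. lra.
        + apply Rinv_le_contravar; [lra|]. rewrite <- (pow_1 (INR (S n))) at 1.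
          apply Rle_pow; [lra|unfold p; lia].
      - apply is_lim_seq_const.
      - exact is_lim_seq_inv_INR_S. }
    assert (HRe : forall r w, Re (RtoC r * w)%C = r * Re w).
    { intros r [u v]. unfold Re, RtoC, Cmult; cbn [fst snd]. ring. }
    assert (HIm : forall r w, Im (RtoC r * w)%C = r * Im w).
    { intros r [u v]. unfold Im, RtoC, Cmult; cbn [fst snd]. ring. }
    clearbody l.
    assert (ER : IZR c ^ p * Re l = - Q2R (coef O)).
    { apply (is_lim_seq_scal_l _ (IZR c ^ p)) in LR. change (Rbar_mult _ _) with (Finite (IZR c ^ p * Re l)) in LR.
      assert (LR' : is_lim_seq (fun n => IZR c ^ p * Re (Shat_fin chi1 chi2 q1 k (x n)))
        (0 - Q2R (coef O))).
      { apply (is_lim_seq_ext (fun n => Re z * / INR (S n) ^ p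
          - poly_eval k coef (INR (S n) + - (IZR d / IZR c)) / INR (S n) ^ p)).
        - intros n. specialize (Hid n). apply (f_equal Re) in Hid.
          rewrite HRe, Cmult_comm, HRe in Hid. rewrite Hid.
          destruct z as [u v]. unfold Re, RtoC, Cminus, Cplus, Copp; cbn [fst snd].
          unfold Rdiv. ring.
        - apply is_lim_seq_minus'; [apply Hinv|exact Llead]. }
      rewrite (is_lim_seq_inj _ _ _ LR LR'). ring. }
    assert (EI : IZR c ^ p * Im l = 0).
    { apply (is_lim_seq_scal_l _ (IZR c ^ p)) in LI. change (Rbar_mult _ _) with (Finite (IZR c ^ p * Im l)) in LI.
      assert (LI' : is_lim_seq (fun n => IZR c ^ p * Im (Shat_fin chi1 chi2 q1 k (x n))) 0).
      { apply (is_lim_seq_ext (fun n => Im z * / INR (S n) ^ p)).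
        - intros n. specialize (Hid n). apply (f_equal Im) in Hid.
          rewrite HIm, Cmult_comm, HIm in Hid. rewrite Hid.
          destruct z as [u v]. unfold Im, RtoC, Cminus, Cplus, Copp; cbn [fst snd]. ring.
        - apply Hinv. }
      exact (is_lim_seq_inj _ _ _ LI LI'). }
    destruct l as [lr li]. cbn [Re Im fst snd] in ER, EI.
    unfold RtoC, Cmult. cbn [fst snd]. f_equal.
    + transitivity (IZR c ^ p * lr); [ring|exact ER].
    + transitivity (IZR c ^ p * li); [ring|exact EI].
Qed.

Theorem theorem1p17 (k : nat) (chi1 chi2 : Z -> Z) (q1 q2 : Z) (m : R)
  (G : list M2Z) :
  (2 <= k)%nat ->
  prim_quad_char q1 chi1 ->
  prim_quad_char q2 chi2 ->
  IZR (chi1 (-1)%Z * chi2 (-1)%Z) = (-1) ^ k ->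
  generating_set (q1 * q2)%Z G ->
  (forall g, In g G ->
     exists coef : nat -> Q,
       in_Pkmq k m q1 coef /\
       forall a, finite_Gamma0_cusp (q1 * q2)%Z a ->
         hfun chi1 chi2 q1 k g a = RtoC (poly_eval k coef a)) ->
  forall g, Gamma1 (q1 * q2)%Z g -> mc g <> 0%Z ->
    exists n : Z, Stilde chi1 chi2 q1 k g = RtoC (m * IZR n / IZR q1).
Proof.
  intros Hk Hchi1 Hchi2 Hpar [HG Hgen] Hh g Hg Hc.
  pose proof (prim_quad_char_character _ _ Hchi1) as H1.
  pose proof (prim_quad_char_character _ _ Hchi2) as H2.
  set (N := (q1 * q2)%Z) in *. set (v := Shat_vec chi1 chi2 q1 k).
  assert (Hstep : forall h A c, In h G -> orbit_vec N A c ->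
    multiples m q1 (v A c - v (ma h * A + mb h * c)%Z (mc h * A + md h * c)%Z)%C).
  { intros h A c Hin Horb. destruct (Hh h Hin) as (coef & HP & Hpoly).
    specialize (HG h Hin). assert (Hq : (0 < q1)%Z) by (destruct H1; lia).
    destruct (Z.eq_dec c 0) as [->|E].
    (* The vector at infinity, about which [h] says nothing: [Shat_vec_generator] supplies the value
       for [A = 1], and [Shat_vec_neg] transfers it to [A = -1]. *)
    - assert (HA : A = 1%Z \/ A = (-1)%Z).
      { destruct Horb as (u & [Du _] & <- & E0). rewrite E0 in Du.
        apply (Z.mul_eq_1 (ma u) (md u)). lia. }
      assert (Hgen1 : multiples m q1 (v (ma h) (mc h))).
      { destruct (Z.eq_dec (mc h) 0) as [E|E].
        - unfold v, Shat_vec. rewrite E. apply multiples_0.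
        - apply (Shat_vec_generator k chi1 chi2 q1 q2 m h coef); auto. }
      unfold v at 1, Shat_vec at 1. rewrite Z.eqb_refl.
      replace (ma h * A + mb h * 0)%Z with (ma h * A)%Z by lia.
      replace (mc h * A + md h * 0)%Z with (mc h * A)%Z by lia.
      unfold Cminus. rewrite Cplus_0_l. apply multiples_opp.
      destruct HA as [-> | ->].
      + now rewrite !Z.mul_1_r.
      + replace (ma h * -1)%Z with (- ma h)%Z by lia.
        replace (mc h * -1)%Z with (- mc h)%Z by lia.
        unfold v. rewrite Shat_vec_neg. now apply multiples_scal.
    - unfold v. rewrite <- hfun_vec by easy.
      rewrite Hpoly by now apply orbit_vec_cusp. rewrite <- RtoC_mult.
      apply poly_eval_multiples; auto.
      destruct Horb as (u & [_ [w Hw]] & _ & <-). exists (w * q2)%Z. rewrite Hw. unfold N. ring. }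
  assert (Hall : forall h, generated G h -> forall A c, orbit_vec N A c ->
    multiples m q1 (v A c - v (ma h * A + mb h * c)%Z (mc h * A + md h * c)%Z)%C).
  { intros h Hgh. induction Hgh as [|u h Hu IH Hin|u h Hu IH Hin]; intros A c Horb.
    - unfold mid; cbn [ma mb mc md].
      replace (1 * A + 0 * c)%Z with A by lia. replace (0 * A + 1 * c)%Z with c by lia.
      replace (v A c - v A c)%C with (RtoC 0) by ring. apply multiples_0.
    - pose proof (Hstep h A c Hin Horb) as S1.
      pose proof (IH _ _ (orbit_vec_act N h A c (proj1 (HG h Hin)) Horb)) as S2.
      pose proof (multiples_plus _ _ _ _ S1 S2) as S3.
      unfold mmul; cbn [ma mb mc md].
      match type of S3 with multiples _ _ (?x - ?y + (?y' - ?z))%C =>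
        replace (x - y + (y' - z))%C with (x - z)%C in S3 by ring end.
      match type of S3 with multiples _ _ (_ - v ?i ?j)%C =>
        match goal with |- multiples _ _ (_ - v ?i' ?j')%C =>
          replace i' with i by ring; replace j' with j by ring end end.
      exact S3.
    (* The hypothesis concerns [h] and not its inverse, so the step for [h] is read at the vector
       [h^-1 (A, c)] and with the opposite sign. *)
    - pose proof (orbit_vec_act N (minv h) A c (Gamma0_minv N h (proj1 (HG h Hin))) Horb) as Horb'.
      pose proof (Hstep h _ _ Hin Horb') as S1. pose proof (IH _ _ Horb') as S2.
      assert (Dh : (ma h * md h - mb h * mc h = 1)%Z) by apply (HG h Hin).
      unfold minv in S1, S2; cbn [ma mb mc md] in S1, S2.
      unfold mmul, minv; cbn [ma mb mc md].
      set (A' := (md h * A + - mb h * c)%Z) in *. set (c' := (- mc h * A + ma h * c)%Z) in *.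
      replace (ma h * A' + mb h * c')%Z with A in S1
        by (unfold A', c'; transitivity ((ma h * md h - mb h * mc h) * A)%Z; [rewrite Dh|]; ring).
      replace (mc h * A' + md h * c')%Z with c in S1
        by (unfold A', c'; transitivity ((ma h * md h - mb h * mc h) * c)%Z; [rewrite Dh|]; ring).
      pose proof (multiples_plus _ _ _ _ (multiples_opp _ _ _ S1) S2) as S3.
      match type of S3 with multiples _ _ (- (?y - ?x) + (?y - ?z))%C =>
        replace (- (y - x) + (y - z))%C with (x - z)%C in S3 by ring end.
      match type of S3 with multiples _ _ (_ - v ?i ?j)%C =>
        match goal with |- multiples _ _ (_ - v ?i' ?j')%C =>
          replace i' with i by (unfold A', c'; ring); replace j' with j by (unfold A', c'; ring) end end.
      exact S3. }
  assert (Horb1 : orbit_vec N 1 0).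
  { exists mid. split; [|easy]. split; unfold mid; cbn [ma mb mc md]; [lia|apply Z.divide_0_r]. }
  (* The path starts at [(1, 0)], where [Shat_vec] is zero, so the total difference is minus the
     value at the first column of [g]. *)
  pose proof (multiples_opp _ _ _ (Hall g (Hgen g Hg) 1%Z 0%Z Horb1)) as HF.
  unfold v, Shat_vec in HF. rewrite Z.eqb_refl in HF.
  replace (mc g * 1 + md g * 0)%Z with (mc g) in HF by lia.
  replace (ma g * 1 + mb g * 0)%Z with (ma g) in HF by lia.
  rewrite (proj2 (Z.eqb_neq _ _) Hc) in HF. destruct HF as [n Hn]. exists n. rewrite <- Hn.
  unfold Stilde. change (Defs.S chi1 chi2 q1 k g)
    with (Shat_fin chi1 chi2 q1 k (IZR (ma g) / IZR (mc g))). ring.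
Qed.
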